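(* Let $1<p<\infty$. If $\zeta(s)$ has a zero with real part $\ge 1/p$, then the sequence $(G_n)$ diverges in $L_p(0,\infty)$. In particular, $(G_n)$ diverges in $L_2(0,\infty)$.
   Context: $\zeta$ is the Riemann zeta function. $\rho(x):=x-[x]$ is the fractional part of $x$. $M(x):=\sum_{k\le x}\mu(k)$ where $\mu$ is the Möbius function, and $M_1(\theta):=M(1/\theta)$ for $\theta>0$ (so $M_1(\theta)=0$ for $\theta>1$). For $n\in\mathbb N$ and $x>0$, $$G_n(x):=\int_{1/n}^{\infty}M_1(\theta)\,\rho\left(\frac{\theta}{x}\right)\frac{d\theta}{\theta},$$ and $G_n\in L_p(0,\infty)$ for all $p\in(1,\infty)$. ''Diverges in $L_p$'' means that the sequence does not converge in the $L_p(0,\infty)$ norm as $n\to\infty$. *)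

(* Defs.v *)
From HB Require Import structures.
From mathcomp Require Import all_boot all_order all_algebra.
From mathcomp Require Import complex.
From mathcomp Require Import all_classical all_reals all_analysis.

Set Implicit Arguments.
Unset Strict Implicit.
Unset Printing Implicit Defensive.

Import Order.TTheory GRing.Theory Num.Theory.
Import numFieldNormedType.Exports.

Local Open Scope classical_set_scope.
Local Open Scope complex_scope.
Local Open Scope ring_scope.

Section Zeta.
Context {R : realType}.

Definition cexp (z : R[i]) : R[i] :=
  (expR (complex.Re z))%:C * (cos (complex.Im z) +i* sin (complex.Im z)).

(* n ^ z = exp (z log n), meaningful for n > 0 *)
Definition natcpow (n : nat) (z : R[i]) : R[i] := cexp (z * (ln n%:R)%:C).

(* zeta is the analytic continuation to C \ {1} of the Dirichlet series
   sum_(n >= 1) n ^ (- s), Re s > 1.  By the identity theorem this determines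
   zeta on C \ {1}; its value at the pole 1 is left unspecified.
   Scalars range over R[i], so derivability in the direction 1 is complex
   differentiability. *)
Definition is_riemann_zeta (zeta : R[i] -> R[i]) : Prop :=
  (forall s : R[i], s != 1 -> derivable (zeta : R[i]^o -> R[i]^o) s 1) /\
  (forall s : R[i], 1 < complex.Re s ->
     series (fun n => natcpow n.+1 (- s) : R[i]^o) @ \oo
       --> (zeta s : R[i]^o)).

End Zeta.

Definition moebius (n : nat) : int :=
  if all (fun p => logn p n == 1%N) (primes n)
  then (-1) ^+ size (primes n) else 0.

Section G.
Context {R : realType}.

Definition rho (x : R) : R := x - (Num.floor x)%:~R.

Definition M (x : R) : R :=
  \sum_(1 <= k < (Num.truncn x).+1) (moebius k)%:~R.

Definition M1 (theta : R) : R := M theta^-1.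

(* Meant for n >= 1; at n = 0 the lower bound is 0^-1 = 0, which is irrelevant
   to convergence as n tends to infinity. *)
Definition G (n : nat) (x : R) : R :=
  Rintegral lebesgue_measure `[n%:R^-1, +oo[
    (fun theta => M1 theta * rho (theta / x) / theta).

End G.

Definition leb0y (R : realType) :
    {measure set (measurableTypeR R) -> \bar R} :=
  mrestr (@lebesgue_measure R)
    (measurable_itv `]0%R, +oo[ : measurable ([set` `]0%R, +oo[] : set R)).

Definition converges_Lp (R : realType) (p : R) (u : nat -> R -> R) : Prop :=
  exists2 f : R -> R, f \in Lfun (leb0y R) p%:E &
    (fun n => Lnorm (leb0y R) p%:E (EFin \o (u n \- f))) @ \oo --> 0%E.

Definition diverges_Lp (R : realType) (p : R) (u : nat -> R -> R) : Prop :=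
  ~ converges_Lp p u.

(* Main.v *)
(* For [n > m] and [x > 1/m] one has [rho (theta / x) = theta / x] on [[1/n, 1/m]], so
   [G n x - G m x] is [1/x] times the tail [c_n - c_m] of the integral of [M1]. Since [1/x]
   has [L_p]-norm of order [m^(1 - 1/p)] on [(1/m, oo)], convergence in [L_p] forces
   [c_n - c = o(n^(1/p - 1))]. Hence [T n = n (c_n - c)] is [o(n^(1/p))], and its second
   difference is [mu(n)/n].

   Summing by parts twice, [sum mu(n) n^(-s)] becomes a series in [T] that converges locally
   uniformly for [Re s > 1/p] and is the inverse of [zeta] there. It grows slower than [1/e]
   at [s + e] when [Re s >= 1/p], which excludes a zero of [zeta] at [s].

   For [p = 2] no zero is assumed. Let [bump v] be the eighth difference in [s], at [9],
   of [max(s - v, 0)^5]. Poisson summation for [sum_m bump (m y)] and Moebius inversion in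
   both variables give, thanks to [T n = o(sqrt n)],
   [sum_a mu(a) cfun (a x) = bump x] with [cfun z = O(z^-3)] elementary. As a function of
   [w = 1/x] the left side extends holomorphically to [Re w > 0], whereas [bump (1/w)]
   vanishes for [w >= 1/9] but not for [w = 2/33]: the identity theorem is contradicted. *)
Require Import Defs.
From mathcomp Require Import all_boot all_order all_algebra.
From mathcomp Require Import complex.
From mathcomp Require Import all_classical all_reals all_analysis.
From mathcomp Require Import measurable_realfun.
From mathcomp Require Import ring lra.

Set Implicit Arguments.
Unset Strict Implicit.
Unset Printing Implicit Defensive.

Import Order.TTheory GRing.Theory Num.Theory.
Import numFieldNormedType.Exports.
Local Open Scope classical_set_scope.
Local Open Scope complex_scope.
Local Open Scope ring_scope.

(** * Complex differentiability *)

(** The shape of the bump answers three demands. Its support [[9, 17]] spans less than a factor two,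
    so that among the [bump (x / b)] with [x <= 18] only [b = 1] survives. The eighth difference
    annihilates degree at most 7: this removes the degree-6 polynomial that accompanies the Fourier
    series of [sum_m (t - m)_+^5], that is the zero frequency, and gains [z^-8] against the factor
    [z^5] of [cfun]. The fifth power gives Fourier coefficients [j^-6], so that four derivatives,
    two in each variable, still leave the summable [j^-2].

    The obstacle is the exchange of the sums over [a] and [b] of
    [mu(a) mu(b) / b * fcomb (a x / b)], whose terms are too large to be summed in absolute value. A
    weight [min(b, N) / N] inserted in the sum over [b] costs a term of size [1 / N]; a second
    difference in each variable then reduces the error to the mean of [|T a| / sqrt a] over
    [a <= A], with [A] of order [N]. This is where [o(sqrt n)] rather than [O(sqrt n)] decides. *)

Notation cn := (@Normc.normc _).

Section ComplexNorm.
Context {R : realType}.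
Implicit Types z w : R[i].

Lemma cn_ge0 z : 0 <= cn z.
Proof. by case: z => a b; exact: sqrtr_ge0. Qed.

Lemma cn0 : cn (0 : R[i]) = 0. Proof. exact: Normc.normc0. Qed.

Lemma cn1 : cn (1 : R[i]) = 1. Proof. exact: Normc.normc1. Qed.

Lemma cn_eq0 z : (cn z == 0) = (z == 0).
Proof. by apply/eqP/eqP => [/Normc.eq0_normc|->] //; rewrite cn0. Qed.

Lemma cn_gt0 z : (0 < cn z) = (z != 0).
Proof. by rewrite lt_def cn_eq0 cn_ge0 andbT. Qed.

Lemma cnD z w : cn (z + w) <= cn z + cn w.
Proof. exact: le_normcD. Qed.

Lemma cnN z : cn (- z) = cn z.
Proof. exact: normcN. Qed.

Lemma cnB z w : cn (z - w) <= cn z + cn w.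
Proof. by rewrite -(cnN w) cnD. Qed.

Lemma cnBC z w : cn (z - w) = cn (w - z).
Proof. by rewrite -cnN opprB. Qed.

Lemma cnM z w : cn (z * w) = cn z * cn w.
Proof. exact: Normc.normcM. Qed.

Lemma cnV z : cn z^-1 = (cn z)^-1.
Proof. exact: Normc.normcV. Qed.

Lemma cnX z n : cn (z ^+ n) = cn z ^+ n.
Proof. by elim: n => [|n IH]; rewrite ?expr0 ?cn1 // !exprS cnM IH. Qed.

Lemma cn_real (x : R) : cn x%:C = `|x|.
Proof. by rewrite /= expr0n /= addr0 sqrtr_sqr. Qed.

Lemma cn_i : cn ('i : R[i]) = 1.
Proof. by rewrite /= expr0n expr1n add0r sqrtr1. Qed.

Lemma cn_sqr z : cn z ^+ 2 = complex.Re z ^+ 2 + complex.Im z ^+ 2.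
Proof. by case: z => a b; rewrite sqr_sqrtr // addr_ge0 ?sqr_ge0. Qed.

Lemma Re_le_cn z : `|complex.Re z| <= cn z.
Proof.
by case: z => a b /=; rewrite -sqrtr_sqr ler_wsqrtr // lerDl sqr_ge0.
Qed.

Lemma Im_le_cn z : `|complex.Im z| <= cn z.
Proof.
by case: z => a b /=; rewrite -sqrtr_sqr ler_wsqrtr // lerDr sqr_ge0.
Qed.

Lemma cn_le_ReIm z : cn z <= `|complex.Re z| + `|complex.Im z|.
Proof.
rewrite [z in cn z]complexE (le_trans (cnD _ _)) //.
by rewrite cnM cn_i mul1r !cn_real.
Qed.

Lemma cn_sum I (s : seq I) (P : pred I) (F : I -> R[i]) :
  cn (\sum_(i <- s | P i) F i) <= \sum_(i <- s | P i) cn (F i).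
Proof.
elim/big_ind2: _ => [|x x1 y y1 h1 h2|//]; first by rewrite cn0.
by rewrite (le_trans (cnD _ _)) // lerD.
Qed.

Lemma ReD z w : complex.Re (z + w) = complex.Re z + complex.Re w.
Proof. by case: z w => ? ? []. Qed.

Lemma ImD z w : complex.Im (z + w) = complex.Im z + complex.Im w.
Proof. by case: z w => ? ? []. Qed.

Lemma ReN z : complex.Re (- z) = - complex.Re z.
Proof. by case: z. Qed.

Lemma ImN z : complex.Im (- z) = - complex.Im z.
Proof. by case: z. Qed.

Lemma ReM z w : complex.Re (z * w) =
  complex.Re z * complex.Re w - complex.Im z * complex.Im w.
Proof. by case: z w => ? ? []. Qed.

Lemma ImM z w : complex.Im (z * w) =
  complex.Re z * complex.Im w + complex.Im z * complex.Re w.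
Proof. by case: z w => a b [c d] /=; rewrite [b * c]mulrC. Qed.

Lemma cn_eq0_le z : (forall e, 0 < e -> cn z <= e) -> z = 0.
Proof.
move=> h; apply/eqP; rewrite -cn_eq0; apply/eqP/le_anti.
rewrite cn_ge0 andbT; apply/ler_addgt0Pl => e e0; rewrite addr0; exact: h.
Qed.

End ComplexNorm.

Section ComplexDerivative.
Context {R : realType}.
Implicit Types (f g : R[i] -> R[i]) (z d : R[i]).

(** The condition uses the real norm [cn], so that all estimates stay in the ordered field [R];
    comparing with [e * cn h] without division makes [h = 0] harmless. *)
Definition cderiv f z d := forall e : R, 0 < e -> exists2 r, 0 < r &
  forall h, cn h < r -> cn (f (z + h) - f z - d * h) <= e * cn h.

Definition hol f z := exists d, cderiv f z d.

Definition ccont f z := forall e : R, 0 < e -> exists2 r, 0 < r &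
  forall h, cn h < r -> cn (f (z + h) - f z) <= e.

Lemma cderiv_lip f z d : cderiv f z d ->
  exists2 r, 0 < r & forall h, cn h < r -> cn (f (z + h) - f z) <= (cn d + 1) * cn h.
Proof.
move=> /(_ 1 ltr01) [r r0 H]; exists r => // h /H {}H.
rewrite -(subrK (d * h) (f _ - f z)) (le_trans (cnD _ _)) //.
by rewrite cnM addrC mulrDl lerD.
Qed.

Lemma hol_cont f z : hol f z -> ccont f z.
Proof.
move=> [d /cderiv_lip [r r0 H]] e e0.
have d0 : 0 < cn d + 1 by rewrite ltr_wpDl ?cn_ge0.
exists (Num.min r (e / (cn d + 1))); first by rewrite lt_min r0 divr_gt0.
move=> h; rewrite lt_min => /andP[/H H1 H2]; apply: (le_trans H1).
by rewrite mulrC -ler_pdivlMr // ltW.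
Qed.

Lemma cderiv_cst c z : cderiv (fun=> c) z 0.
Proof. by move=> e e0; exists 1 => // h _; rewrite subrr mul0r subr0 cn0 mulr_ge0 ?cn_ge0 // ltW. Qed.

Lemma cderiv_id z : cderiv id z 1.
Proof.
move=> e e0; exists 1 => // h _.
rewrite [X in cn X](_ : _ = 0) ?cn0 ?mulr_ge0 ?cn_ge0 1?ltW //; rewrite /=; ring.
Qed.

Lemma cderivD f g z a b : cderiv f z a -> cderiv g z b ->
  cderiv (fun x => f x + g x) z (a + b).
Proof.
move=> F G e e0; have e2 : 0 < e / 2 by rewrite divr_gt0.
have [r r0 {}F] := F _ e2; have [s s0 {}G] := G _ e2.
exists (Num.min r s); first by rewrite lt_min r0.
move=> h; rewrite lt_min => /andP[/F {}F /G {}G].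
rewrite [X in cn X](_ : _ = (f (z + h) - f z - a * h) + (g (z + h) - g z - b * h)); last by ring.
by rewrite (le_trans (cnD _ _)) // [e]splitr mulrDl lerD.
Qed.

Lemma cderivM f g z a b : cderiv f z a -> cderiv g z b ->
  cderiv (fun x => f x * g x) z (a * g z + f z * b).
Proof.
move=> F G e e0.
have [r1 r10 L1] := cderiv_lip F; have [r2 r20 L2] := cderiv_lip G.
set A := cn a + 1 in L1; set B := cn b + 1 in L2.
have A0 : 0 < A by rewrite ltr_wpDl ?cn_ge0.
have B0 : 0 < B by rewrite ltr_wpDl ?cn_ge0.
(* Three error terms are to stay below [e / 3] each; [K / 3] dominates both [cn (f z)] and
   [cn (g z)]. *)
pose K := 3 * (1 + cn (f z) + cn (g z)).
have K0 : 0 < K by rewrite mulr_gt0 // -addrA ltr_pwDl // addr_ge0 ?cn_ge0.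
have [s1 s10 {}F] := F _ (divr_gt0 e0 K0).
have [s2 s20 {}G] := G _ (divr_gt0 e0 K0).
exists (Num.min (Num.min r1 r2) (Num.min (Num.min s1 s2) (e / (3 * A * B)))).
  by rewrite !lt_min r10 r20 s10 s20 divr_gt0 // !mulr_gt0.
move=> h; rewrite !lt_min => /andP[/andP[/L1 {}L1 /L2 {}L2] /andP[/andP[/F {}F /G {}G] hs]].
rewrite [X in cn X](_ : _ = (f (z + h) - f z - a * h) * g z + (f (z + h) - f z) * (g (z + h) - g z)
   + f z * (g (z + h) - g z - b * h)); last by ring.
rewrite (le_trans (cnD _ _)) // [e * _](_ : _ = e / 3 * cn h + e / 3 * cn h + e / 3 * cn h); last by field.
have h0 := cn_ge0 h.
have kk x : 0 <= x -> x <= K / 3 -> e / K * x <= e / 3.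
  move=> x0 xK; rewrite mulrAC ler_pdivrMr // -mulrA [3^-1 * _]mulrC ler_pM2l //.
have K3 : K / 3 = 1 + cn (f z) + cn (g z) by rewrite /K mulrC mulKf.
have fz := cn_ge0 (f z); have gz := cn_ge0 (g z).
apply: lerD; first apply: (le_trans (cnD _ _)); first apply: lerD.
- rewrite cnM (le_trans (ler_wpM2r (cn_ge0 _) F)) // mulrAC ler_wpM2r // kk // K3; lra.
- rewrite cnM (le_trans (ler_pM (cn_ge0 _) (cn_ge0 _) L1 L2)) //.
  rewrite mulrACA mulrA ler_wpM2r // mulrC -ler_pdivlMr ?mulr_gt0 //.
  by rewrite -[e / 3 / _]mulrA -invfM mulrA ltW.
- rewrite cnM (le_trans (ler_wpM2l (cn_ge0 _) G)) // mulrA ler_wpM2r // mulrC kk // K3; lra.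
Qed.

Lemma cderiv_comp f g z a b : cderiv g z b -> cderiv f (g z) a ->
  cderiv (fun x => f (g x)) z (a * b).
Proof.
move=> G F e e0.
have [r1 r10 L] := cderiv_lip G.
set B := cn b + 1 in L; have B0 : 0 < B by rewrite ltr_wpDl ?cn_ge0.
have a0 : 0 < cn a + 1 by rewrite ltr_wpDl ?cn_ge0.
have e2 : 0 < e / 2 by rewrite divr_gt0.
have [s1 s10 {}F] := F _ (divr_gt0 e2 B0).
have [s2 s20 {}G] := G _ (divr_gt0 e2 a0).
exists (Num.min (Num.min r1 s2) (s1 / B)); first by rewrite !lt_min r10 s20 divr_gt0.
move=> h; rewrite !lt_min => /andP[/andP[/L {}L /G {}G] hs].
have hk : cn (g (z + h) - g z) < s1 by rewrite (le_lt_trans L) // mulrC -ltr_pdivlMr.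
move: (F _ hk); rewrite subrKC => {}F.
rewrite [X in cn X](_ : _ = (f (g (z + h)) - f (g z) - a * (g (z + h) - g z)) +
  a * (g (z + h) - g z - b * h)); last by ring.
rewrite (le_trans (cnD _ _)) // [e]splitr mulrDl; apply: lerD.
  rewrite (le_trans F) // -mulrA ler_wpM2l ?(ltW e2) //.
  by rewrite mulrC ler_pdivrMr // mulrC.
rewrite cnM (le_trans (ler_wpM2l (cn_ge0 _) G)) // mulrA ler_wpM2r ?cn_ge0 //.
by rewrite mulrC -mulrA ler_piMr ?(ltW e2) // mulrC ler_pdivrMr // mul1r lerDl.
Qed.

Lemma cderivV z : z != 0 -> cderiv (fun x => x^-1) z (- z ^- 2).
Proof.
move=> z0; have nz : 0 < cn z by rewrite cn_gt0.
move=> e e0; exists (Num.min (cn z / 2) (e * cn z ^+ 3 / 2)).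
  by rewrite lt_min !divr_gt0 // mulr_gt0 // exprn_gt0.
move=> h; rewrite lt_min => /andP[h1 h2].
have zh : cn z / 2 <= cn (z + h).
  have := cnB (z + h) h; rewrite addrK => /(fun x => x); lra.
have zh0 : z + h != 0 by rewrite -cn_gt0 (lt_le_trans _ zh) // divr_gt0.
rewrite [X in cn X](_ : _ = h ^+ 2 / ((z + h) * z ^+ 2)); last by field; rewrite zh0 z0.
rewrite cnM cnV cnM !cnX ler_pdivrMr; last first.
  by rewrite mulr_gt0 ?exprn_gt0 // cn_gt0.
rewrite expr2 mulrAC ler_wpM2r ?cn_ge0 // (le_trans (ltW h2)) // -mulrA ler_pM2l //.
by rewrite exprS mulrAC ler_wpM2r // ?exprn_ge0 ?cn_ge0.
Qed.

Lemma holD f g z : hol f z -> hol g z -> hol (fun x => f x + g x) z.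
Proof. by move=> [a F] [b G]; exists (a + b); exact: cderivD. Qed.

Lemma holM f g z : hol f z -> hol g z -> hol (fun x => f x * g x) z.
Proof. by move=> [a F] [b G]; eexists; exact: cderivM F G. Qed.

Lemma hol_cst c z : hol (fun=> c) z.
Proof. by exists 0; exact: cderiv_cst. Qed.

Lemma hol_id z : hol id z.
Proof. by exists 1; exact: cderiv_id. Qed.

Lemma holN f z : hol f z -> hol (fun x => - f x) z.
Proof.
move=> H; have := holM (hol_cst (-1) z) H; congr hol.
by apply/funext => x; rewrite mulN1r.
Qed.

Lemma holB f g z : hol f z -> hol g z -> hol (fun x => f x - g x) z.
Proof. by move=> F G; apply: holD => //; exact: holN. Qed.

Lemma hol_comp f g z : hol g z -> hol f (g z) -> hol (fun x => f (g x)) z.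
Proof. by move=> [b G] [a F]; eexists; exact: cderiv_comp G F. Qed.

Lemma holV f z : hol f z -> f z != 0 -> hol (fun x => (f x)^-1) z.
Proof. by move=> F fz; apply: (@hol_comp (fun x => x^-1)) => //; eexists; exact: cderivV. Qed.

Lemma holX f z n : hol f z -> hol (fun x => f x ^+ n) z.
Proof.
move=> F; elim: n => [|n IH]; first exact: hol_cst.
by have := holM F IH; congr hol; apply/funext => x; rewrite exprS.
Qed.

End ComplexDerivative.

(** * Integration of complex functions of a real variable *)

Section RealDerivative.
Context {R : realType}.

Definition eps_deriv (f : R -> R) (t v : R) := forall e, 0 < e ->
  exists2 r, 0 < r & forall h, `|h| < r -> `|f (t + h) - f t - h * v| <= e * `|h|.

Lemma eps_deriv_is_derive (f : R -> R) (t v : R) : eps_deriv f t v -> is_derive t (1 : R) f v.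
Proof.
move=> H.
have cv : (fun h : R => h^-1 *: (f (h *: 1 + t) - f t)) @ 0^' --> v.
  apply/cvgrPdist_le => e /H[r r0 {}H].
  near=> h.
  have h0 : h != 0 by near: h; exact: nbhs_dnbhs_neq.
  have hr : `|h| < r.
    near: h; apply: dnbhs0_lt; exact: r0.
  have := H _ hr; rewrite -ler_pdivrMr ?normr_gt0 //; apply: le_trans.
  rewrite -normrV ?unitfE // -normrM -normrN [h *: 1]mulr1 [h + t]addrC.
  suff -> : - (v - h^-1 *: (f (t + h) - f t)) = (f (t + h) - f t - h * v) / h by [].
  by rewrite /GRing.scale /=; field.
split; first by apply/cvg_ex; exists v.
exact: (cvg_lim _ cv).
Unshelve. all: by end_near.
Qed.

Lemma is_derive_eps_deriv (f : R -> R) (t v : R) : is_derive t (1 : R) f v -> eps_deriv f t v.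
Proof.
move=> [df dv] e e0.
have : (fun h : R => h^-1 *: (f (h *: 1 + t) - f t)) @ 0^' --> v by rewrite -dv.
move=> /cvgrPdist_le/(_ e e0).
rewrite near_withinE => /nbhs_ballP[r /= r0 H]; exists r => // h hr.
have [->|h0] := eqVneq h 0; first by rewrite addr0 subrr mul0r subrr normr0 mulr0.
have := H h; rewrite /ball /= sub0r normrN => /(_ hr h0).
rewrite [h *: 1]mulr1 [h + t]addrC => {}H.
rewrite -ler_pdivrMr ?normr_gt0 //; apply: le_trans H.
rewrite -normrV ?unitfE // -normrM -normrN.
suff -> : (f (t + h) - f t - h * v) / h = - (v - h^-1 *: (f (t + h) - f t)) by [].
by rewrite /GRing.scale /=; field.
Qed.

Lemma eps_deriv_cont f t v : eps_deriv f t v -> {for t, continuous f}.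
Proof.
by move=> /eps_deriv_is_derive [df _]; apply: differentiable_continuous; exact/derivable1_diffP.
Qed.

Lemma eps_deriv_MVT f df a b : a <= b ->
  (forall t, a <= t <= b -> eps_deriv f t (df t)) ->
  exists2 c, a <= c <= b & f b - f a = df c * (b - a).
Proof.
move=> ab H.
have [|c|c cI ->] := @MVT_segment _ f df a b ab; last by exists c => //; rewrite in_itv in cI.
  move=> t; rewrite in_itv /= => /andP[/ltW ta /ltW tb].
  by apply: eps_deriv_is_derive; apply: H; rewrite ta.
apply: continuous_in_subspaceT => t; rewrite inE /= in_itv => /H; exact: eps_deriv_cont.
Qed.

Definition eps_cont (f : R -> R) (t : R) := forall e, 0 < e ->
  exists2 r, 0 < r & forall h, `|h| < r -> `|f (t + h) - f t| <= e.

Lemma eps_contP f t : eps_cont f t -> {for t, continuous f}.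
Proof.
move=> H; apply/cvgrPdist_le => e /H[r r0 {}H].
apply/nbhs_ballP; exists r => //= u; rewrite /ball /= -normrN opprB => /H.
by rewrite subrKC -normrN opprB.
Qed.

Lemma eps_cont_primitive (f : R -> R) a b : a <= b ->
  (forall t, a <= t <= b -> eps_cont f t) ->
  exists F, forall t, a <= t <= b -> eps_deriv F t (f t).
Proof.
(* [cl] clamps the argument to [[a, b]]: [g] extends [f] continuously to the line, and on
   [[a - 1, b + 1]] the points [a] and [b] are interior for the fundamental theorem. *)
move=> ab H; pose cl t := Num.max a (Num.min b t); pose g t := f (cl t).
have clab t : a <= cl t <= b.
  by rewrite /cl le_max lexx /= ge_max ab ge_min lexx.
have cll s t : `|cl s - cl t| <= `|s - t|.
  rewrite /cl ler_norml; case: (ger0P (s - t)) => ?; case: (leP b s) => ?; case: (leP b t) => ?;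
  do 2?[case: (leP a _) => ?]; lra.
have cg t : {for t, continuous g}.
  apply: eps_contP => e /(H _ (clab t)) [r r0 {}H]; exists r => // h hr.
  have /H : `|cl (t + h) - cl t| < r.
    by apply: le_lt_trans hr; rewrite (le_trans (cll _ _)) // addrAC subrr add0r.
  by rewrite subrKC.
have ig : lebesgue_measure.-integrable `[a - 1, b + 1] (EFin \o g).
  apply: continuous_compact_integrable; first exact: segment_compact.
  by apply: continuous_subspaceT => t; exact: cg.
exists (fun x => \int[lebesgue_measure]_(t in `[a - 1, x]) g t)%R => t tab.
have [at' tb] := andP tab.
have [||df dg] := continuous_FTC1_closed _ ig _ (cg t); first by lra.
  by lra.
apply: is_derive_eps_deriv; split => //.
rewrite derive1E in dg; rewrite dg /g; congr f.
by rewrite /cl min_r // max_r.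
Qed.

Definition rderiv (F : R -> R[i]) (t : R) (v : R[i]) := forall e : R, 0 < e ->
  exists2 r, 0 < r & forall h : R, `|h| < r -> cn (F (t + h) - F t - h%:C * v) <= e * `|h|.

Definition rcont (F : R -> R[i]) (t : R) := forall e : R, 0 < e ->
  exists2 r, 0 < r & forall h : R, `|h| < r -> cn (F (t + h) - F t) <= e.

Let Re_lin (w A B v : R[i]) (h : R) : complex.Re (w * A) - complex.Re (w * B) - h * complex.Re (w * v)
  = complex.Re (w * (A - B - h%:C * v)).
Proof. by case: w A B v => ? ? [? ?] [? ?] [? ?] /=; ring. Qed.

Lemma rderiv_proj F t v (w : R[i]) : rderiv F t v ->
  eps_deriv (fun s => complex.Re (w * F s)) t (complex.Re (w * v)).
Proof.
move=> H e e0; have w0 : 0 < cn w + 1 by rewrite ltr_wpDl ?cn_ge0.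
have [r r0 {}H] := H _ (divr_gt0 e0 w0); exists r => // h hr.
rewrite Re_lin (le_trans (Re_le_cn _)) // cnM (le_trans (ler_wpM2l (cn_ge0 _) (H _ hr))) //.
rewrite mulrA ler_wpM2r // mulrCA ler_piMr ?(ltW e0) // ler_pdivrMr // mul1r lerDl //.
Qed.

(** The mean value theorem fails for complex values; it survives multiplication by a fixed [w]
    followed by projection to the real part. *)
Lemma rderiv_MVT F f a b (w : R[i]) : a <= b ->
  (forall t, a <= t <= b -> rderiv F t (f t)) ->
  exists2 c, a <= c <= b & complex.Re (w * (F b - F a)) = complex.Re (w * f c) * (b - a).
Proof.
move=> ab H; have [t /H h|c cab E] := @eps_deriv_MVT (fun s => complex.Re (w * F s)) (fun s => complex.Re (w * f s)) _ _ ab.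
  exact: rderiv_proj.
by exists c => //; rewrite -E mulrBr ReD ReN.
Qed.

(** With [D = F b - F a], multiplication by the conjugate of [D] turns the increment into the real
    number [cn D ^+ 2], which the projected mean value theorem bounds by [cn D * K * (b - a)]. *)
Lemma rderiv_bound F f a b K : a <= b ->
  (forall t, a <= t <= b -> rderiv F t (f t)) ->
  (forall t, a <= t <= b -> cn (f t) <= K) -> cn (F b - F a) <= K * (b - a).
Proof.
move=> ab H fK; set D := F b - F a.
have [->|D0] := eqVneq D 0.
  by rewrite cn0 mulr_ge0 ?subr_ge0 // (le_trans (cn_ge0 _) (fK a _)) // lexx.
have [c cab E] := rderiv_MVT (conjc D) ab H; rewrite -/D in E.
have Dp : 0 < cn D by rewrite cn_gt0.
have DD : complex.Re (conjc D * D) = cn D ^+ 2.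
  by rewrite cn_sqr; case: (D) => x y /=; ring.
rewrite DD in E; rewrite -(ler_pM2l Dp) -expr2 E mulrA ler_wpM2r ?subr_ge0 //.
rewrite (le_trans (ler_norm _)) // (le_trans (Re_le_cn _)) // cnM.
have -> : cn (conjc D) = cn D by case: (D) => x y /=; rewrite sqrrN.
by rewrite ler_wpM2l ?cn_ge0 // fK.
Qed.

Lemma rderivD F G t u v : rderiv F t u -> rderiv G t v ->
  rderiv (fun s => F s + G s) t (u + v).
Proof.
move=> HF HG e e0; have e2 : 0 < e / 2 by rewrite divr_gt0.
have [r r0 {}HF] := HF _ e2; have [s s0 {}HG] := HG _ e2.
exists (Num.min r s); first by rewrite lt_min r0.
move=> h; rewrite lt_min => /andP[/HF {}HF /HG {}HG].
rewrite [X in cn X](_ : _ = (F (t + h) - F t - h%:C * u) + (G (t + h) - G t - h%:C * v)); last by ring.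
by rewrite (le_trans (cnD _ _)) // [e]splitr mulrDl lerD.
Qed.

Lemma rderivZ F t v c : rderiv F t v -> rderiv (fun s => c * F s) t (c * v).
Proof.
move=> H e e0; have c0 : 0 < cn c + 1 by rewrite ltr_wpDl ?cn_ge0.
have [r r0 {}H] := H _ (divr_gt0 e0 c0); exists r => // h /H {}H.
rewrite [X in cn X](_ : _ = c * (F (t + h) - F t - h%:C * v)); last by ring.
rewrite cnM (le_trans (ler_wpM2l (cn_ge0 _) H)) // mulrA ler_wpM2r //.
by rewrite mulrCA ler_piMr ?(ltW e0) // ler_pdivrMr // mul1r lerDl.
Qed.

Definition has_prim (f : R -> R[i]) a b :=
  exists F, forall t, a <= t <= b -> rderiv F t (f t).

(** The integral is the increment of a primitive picked by [xget]; two primitives differ by a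
    constant, so the choice is immaterial ([cintE]). Without a primitive the value is [0]. *)
Definition cint (f : R -> R[i]) a b : R[i] :=
  xget 0 [set v | exists2 F, (forall t, a <= t <= b -> rderiv F t (f t)) & v = F b - F a].

Lemma cintE f F a b : a <= b -> (forall t, a <= t <= b -> rderiv F t (f t)) ->
  cint f a b = F b - F a.
Proof.
move=> ab H; rewrite /cint; case: xgetP => [_ -> /= [G HG ->]|/(_ (F b - F a)) []]; last by exists F.
apply/eqP; rewrite -subr_eq0; apply/eqP.
have HN : forall t, a <= t <= b -> rderiv (fun s => G s + (-1) * F s) t 0.
  move=> t tab; have := rderivD (HG _ tab) (rderivZ (-1) (H _ tab)).
  by rewrite mulN1r subrr.
have := rderiv_bound ab HN (fun t _ => eq_ind_r (fun x => x <= 0) (lexx 0) (@cn0 R)).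
rewrite mul0r => h; apply/eqP; rewrite -cn_eq0; apply/eqP/le_anti; rewrite cn_ge0 andbT.
by rewrite !mulN1r in h; rewrite (_ : _ - _ - _ = G b - F b - (G a - F a)) //; ring.
Qed.

Lemma has_prim_cont f a b : a <= b -> (forall t, a <= t <= b -> rcont f t) -> has_prim f a b.
Proof.
move=> ab H.
have [t tab|F HF] := @eps_cont_primitive (fun s => complex.Re (f s)) _ _ ab.
  move=> e /(H _ tab) [r r0 {}H]; exists r => // h /H; apply: le_trans.
  by rewrite /= -ReN -ReD Re_le_cn.
have [t tab|G HG] := @eps_cont_primitive (fun s => complex.Im (f s)) _ _ ab.
  move=> e /(H _ tab) [r r0 {}H]; exists r => // h /H; apply: le_trans.
  by rewrite /= -ImN -ImD Im_le_cn.
exists (fun t => F t +i* G t) => t tab e e0; have e2 : 0 < e / 2 by rewrite divr_gt0.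
have [r r0 {}HF] := HF _ tab _ e2; have [s s0 {}HG] := HG _ tab _ e2.
exists (Num.min r s); first by rewrite lt_min r0.
move=> h; rewrite lt_min => /andP[/HF {}HF /HG {}HG].
rewrite (le_trans (cn_le_ReIm _)) // [e]splitr mulrDl lerD //.
  by move: HF; rewrite /= !(ReD, ReN, ReM) /= mul0r subr0.
by move: HG; rewrite /= !(ImD, ImN, ImM) /= mul0r addr0.
Qed.

Lemma cint_split f a m b : a <= m -> m <= b -> has_prim f a b ->
  cint f a b = cint f a m + cint f m b.
Proof.
move=> am mb [F H]; rewrite (cintE (le_trans am mb) H) !(@cintE f F) //; first by ring.
  by move=> t /andP[mt tb]; apply: H; rewrite tb (le_trans am).
by move=> t /andP[mt tb]; apply: H; rewrite mt (le_trans tb).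
Qed.

Lemma cintD f g a b : a <= b -> has_prim f a b -> has_prim g a b ->
  cint (fun t => f t + g t) a b = cint f a b + cint g a b.
Proof.
move=> ab [F HF] [G HG]; rewrite (cintE ab HF) (cintE ab HG).
rewrite (@cintE _ (fun t => F t + G t)) //; first by ring.
by move=> t tab; apply: rderivD; [exact: HF|exact: HG].
Qed.

Lemma cintZ c f a b : a <= b -> has_prim f a b ->
  cint (fun t => c * f t) a b = c * cint f a b.
Proof.
move=> ab [F HF]; rewrite (cintE ab HF) (@cintE _ (fun t => c * F t)) //; first by ring.
by move=> t tab; apply: rderivZ; exact: HF.
Qed.

Lemma cint_le f a b K : a <= b -> has_prim f a b ->
  (forall t, a <= t <= b -> cn (f t) <= K) -> cn (cint f a b) <= K * (b - a).
Proof. by move=> ab [F HF] H; rewrite (cintE ab HF); exact: rderiv_bound HF H. Qed.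

Lemma Re_cint_ge f a b K w : a <= b -> has_prim f a b ->
  (forall t, a <= t <= b -> K <= complex.Re (w * f t)) ->
  K * (b - a) <= complex.Re (w * cint f a b).
Proof.
move=> ab [F HF] H; rewrite (cintE ab HF); have [c cab ->] := rderiv_MVT w ab HF.
by rewrite ler_wpM2r ?subr_ge0 // H.
Qed.

End RealDerivative.

(** * Goursat's theorem on rectangles *)

Section Rectangle.
Context {R : realType}.
Implicit Types f g : R[i] -> R[i].

Definition edges (x1 x2 y1 y2 : R) (P : R[i] -> Prop) :=
  (forall t, x1 <= t <= x2 -> P (t +i* y1) /\ P (t +i* y2)) /\
  (forall t, y1 <= t <= y2 -> P (x1 +i* t) /\ P (x2 +i* t)).

(** The counterclockwise contour integral along the rectangle: [dz] is [dt] on horizontal sides and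
    ['i dt] on vertical ones. *)
Definition bd f (x1 x2 y1 y2 : R) : R[i] :=
  cint (fun t => f (t +i* y1)) x1 x2 - cint (fun t => f (t +i* y2)) x1 x2 +
  'i * (cint (fun t => f (x2 +i* t)) y1 y2 - cint (fun t => f (x1 +i* t)) y1 y2).

Lemma edgesW x1 x2 y1 y2 (P Q : R[i] -> Prop) :
  edges x1 x2 y1 y2 P -> (forall z, P z -> Q z) -> edges x1 x2 y1 y2 Q.
Proof.
move=> [H1 H2] PQ; split=> t tI.
  by have [? ?] := H1 t tI; split; apply: PQ.
by have [? ?] := H2 t tI; split; apply: PQ.
Qed.

Lemma edgesI x1 x2 y1 y2 (P Q : R[i] -> Prop) :
  edges x1 x2 y1 y2 P -> edges x1 x2 y1 y2 Q -> edges x1 x2 y1 y2 (fun z => P z /\ Q z).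
Proof.
move=> [H1 H2] [G1 G2]; split=> t tI.
  by have [? ?] := H1 t tI; have [? ?] := G1 t tI.
by have [? ?] := H2 t tI; have [? ?] := G2 t tI.
Qed.

Lemma ccontD f g z : ccont f z -> ccont g z -> ccont (fun z => f z + g z) z.
Proof.
move=> F G e e0; have e2 : 0 < e / 2 by rewrite divr_gt0.
have [r r0 {}F] := F _ e2; have [s s0 {}G] := G _ e2.
exists (Num.min r s); first by rewrite lt_min r0.
move=> h; rewrite lt_min => /andP[/F {}F /G {}G].
rewrite [X in cn X](_ : _ = (f (z + h) - f z) + (g (z + h) - g z)); last by ring.
by rewrite (le_trans (cnD _ _)) // [e]splitr lerD.
Qed.

Lemma addhC (t h y : R) : (t + h) +i* y = (t +i* y) + h%:C.
Proof. by rewrite /GRing.add /= addr0. Qed.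

Lemma addvC (t h x : R) : x +i* (t + h) = (x +i* t) + 'i * h%:C.
Proof. by apply/eqP; rewrite eq_complex /=; apply/andP; split; apply/eqP; ring. Qed.

Lemma hprim f y a b : a <= b -> (forall t, a <= t <= b -> ccont f (t +i* y)) ->
  has_prim (fun t => f (t +i* y)) a b.
Proof.
move=> ab H; apply: has_prim_cont => // t /H {}H e /H [r r0 {}H].
by exists r => // h hr; rewrite addhC H // cn_real.
Qed.

Lemma vprim f x a b : a <= b -> (forall t, a <= t <= b -> ccont f (x +i* t)) ->
  has_prim (fun t => f (x +i* t)) a b.
Proof.
move=> ab H; apply: has_prim_cont => // t /H {}H e /H [r r0 {}H].
by exists r => // h hr; rewrite addvC H // cnM cn_i mul1r cn_real.
Qed.

Lemma edges_prim f x1 x2 y1 y2 : x1 <= x2 -> y1 <= y2 -> edges x1 x2 y1 y2 (ccont f) ->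
  [/\ has_prim (fun t => f (t +i* y1)) x1 x2, has_prim (fun t => f (t +i* y2)) x1 x2,
      has_prim (fun t => f (x1 +i* t)) y1 y2 & has_prim (fun t => f (x2 +i* t)) y1 y2].
Proof.
move=> x12 y12 [H1 H2]; split; (apply: hprim || apply: vprim) => // t.
- by case/H1.
- by case/H1.
- by case/H2.
- by case/H2.
Qed.

Lemma bd_le f x1 x2 y1 y2 K : x1 <= x2 -> y1 <= y2 ->
  edges x1 x2 y1 y2 (fun z => ccont f z /\ cn (f z) <= K) ->
  cn (bd f x1 x2 y1 y2) <= K * (2 * ((x2 - x1) + (y2 - y1))).
Proof.
move=> x12 y12 H.
have [p1 p2 p3 p4] := edges_prim x12 y12 (edgesW H (fun z => @proj1 _ _)).
have [H1 H2] := edgesW H (fun z => @proj2 _ _).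
have E1 := cint_le x12 p1 (fun t tI => proj1 (H1 t tI)).
have E2 := cint_le x12 p2 (fun t tI => proj2 (H1 t tI)).
have E3 := cint_le y12 p3 (fun t tI => proj1 (H2 t tI)).
have E4 := cint_le y12 p4 (fun t tI => proj2 (H2 t tI)).
rewrite /bd (le_trans (cnD _ _)) // cnM cn_i mul1r.
have := cnB (cint (fun t => f (t +i* y1)) x1 x2) (cint (fun t => f (t +i* y2)) x1 x2).
have := cnB (cint (fun t => f (x2 +i* t)) y1 y2) (cint (fun t => f (x1 +i* t)) y1 y2).
lra.
Qed.

Lemma bdD f g x1 x2 y1 y2 : x1 <= x2 -> y1 <= y2 ->
  edges x1 x2 y1 y2 (ccont f) -> edges x1 x2 y1 y2 (ccont g) ->
  bd (fun z => f z + g z) x1 x2 y1 y2 = bd f x1 x2 y1 y2 + bd g x1 x2 y1 y2.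
Proof.
move=> x12 y12 /(edges_prim x12 y12) [p1 p2 p3 p4] /(edges_prim x12 y12) [q1 q2 q3 q4].
by rewrite /bd !cintD //; ring.
Qed.

Lemma bdZ c f x1 x2 y1 y2 : x1 <= x2 -> y1 <= y2 -> edges x1 x2 y1 y2 (ccont f) ->
  bd (fun z => c * f z) x1 x2 y1 y2 = c * bd f x1 x2 y1 y2.
Proof.
by move=> x12 y12 /(edges_prim x12 y12) [p1 p2 p3 p4]; rewrite /bd !cintZ //; ring.
Qed.

Lemma cint_ext (f g : R -> R[i]) a b : a <= b ->
  (forall t, a <= t <= b -> f t = g t) -> has_prim f a b -> cint f a b = cint g a b.
Proof.
move=> ab H [F HF]; rewrite (cintE ab HF) (@cintE _ g F) // => t tI.
by rewrite -H //; exact: HF.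
Qed.

Lemma bd_ext f g x1 x2 y1 y2 : x1 <= x2 -> y1 <= y2 -> edges x1 x2 y1 y2 (ccont f) ->
  edges x1 x2 y1 y2 (fun z => f z = g z) -> bd f x1 x2 y1 y2 = bd g x1 x2 y1 y2.
Proof.
move=> x12 y12 /(edges_prim x12 y12) [p1 p2 p3 p4] [H1 H2].
rewrite /bd; congr (_ - _ + 'i * (_ - _)); apply: cint_ext => // t tI.
- by have [] := H1 t tI.
- by have [] := H1 t tI.
- by have [] := H2 t tI.
- by have [] := H2 t tI.
Qed.

Lemma bd_primitive f G x1 x2 y1 y2 : x1 <= x2 -> y1 <= y2 ->
  edges x1 x2 y1 y2 (fun z => cderiv G z (f z)) -> bd f x1 x2 y1 y2 = 0.
Proof.
move=> x12 y12 [H1 H2].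
have hd y t : cderiv G (t +i* y) (f (t +i* y)) -> rderiv (fun s => G (s +i* y)) t (f (t +i* y)).
  move=> H e /H [r r0 {}H]; exists r => // h hr; rewrite addhC mulrC.
  by rewrite -(cn_real h) H // cn_real.
have vd x t : cderiv G (x +i* t) (f (x +i* t)) ->
    rderiv (fun s => (- 'i) * G (x +i* s)) t (f (x +i* t)).
  move=> H e /H [r r0 {}H]; exists r => // h hr; rewrite addvC.
  rewrite [X in cn X](_ : _ = - 'i * (G (x +i* t + 'i * h%:C) - G (x +i* t) - f (x +i* t) * ('i * h%:C))); last first.
    have i2 : ('i : R[i]) * 'i = -1 by rewrite -expr2 sqr_i.
    by ring: i2.
  have ih : cn ('i * h%:C) = `|h| by rewrite cnM cn_i mul1r cn_real.
  by rewrite cnM cnN cn_i mul1r -ih H // ih.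
rewrite /bd (@cintE _ _ (fun s => G (s +i* y1))) //; last by move=> t /H1 [? ?]; exact: hd.
rewrite (@cintE _ _ (fun s => G (s +i* y2))) //; last by move=> t /H1 [? ?]; exact: hd.
rewrite (@cintE _ _ (fun s => - 'i * G (x2 +i* s))) //; last by move=> t /H2 [? ?]; exact: vd.
rewrite (@cintE _ _ (fun s => - 'i * G (x1 +i* s))) //; last by move=> t /H2 [? ?]; exact: vd.
have i2 : ('i : R[i]) * 'i = -1 by rewrite -expr2 sqr_i.
ring: i2.
Qed.

Lemma bd_splitv f x1 m x2 y1 y2 : x1 <= m -> m <= x2 ->
  (forall t, x1 <= t <= x2 -> ccont f (t +i* y1) /\ ccont f (t +i* y2)) ->
  bd f x1 x2 y1 y2 = bd f x1 m y1 y2 + bd f m x2 y1 y2.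
Proof.
move=> a b H; have x12 := le_trans a b.
have p1 : has_prim (fun t => f (t +i* y1)) x1 x2 by apply: hprim => // t /H [].
have p2 : has_prim (fun t => f (t +i* y2)) x1 x2 by apply: hprim => // t /H [].
by rewrite /bd (cint_split a b p1) (cint_split a b p2); ring.
Qed.

Lemma bd_splith f x1 x2 y1 m y2 : y1 <= m -> m <= y2 ->
  (forall t, y1 <= t <= y2 -> ccont f (x1 +i* t) /\ ccont f (x2 +i* t)) ->
  bd f x1 x2 y1 y2 = bd f x1 x2 y1 m + bd f x1 x2 m y2.
Proof.
move=> a b H; have y12 := le_trans a b.
have p1 : has_prim (fun t => f (x1 +i* t)) y1 y2 by apply: vprim => // t /H [].
have p2 : has_prim (fun t => f (x2 +i* t)) y1 y2 by apply: vprim => // t /H [].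
by rewrite /bd (cint_split a b p1) (cint_split a b p2); ring.
Qed.

Lemma bd_quarter f a m b c n d (e : R) : a <= m -> m <= b -> c <= n -> n <= d ->
  (forall x y, a <= x <= b -> c <= y <= d -> ccont f (x +i* y)) ->
  4 * e <= cn (bd f a b c d) ->
  [\/ e <= cn (bd f a m c n), e <= cn (bd f a m n d),
      e <= cn (bd f m b c n) | e <= cn (bd f m b n d)].
Proof.
move=> am mb cn' nd H; have ab := le_trans am mb; have cd := le_trans cn' nd.
rewrite (bd_splitv am mb); last by move=> t tI; split; apply: H => //; rewrite ?lexx ?cd.
rewrite (bd_splith cn' nd (f := f) (x1 := a) (x2 := m)); last first.
  by move=> t tI; split; apply: H => //; rewrite ?lexx ?am ?mb ?ab.
rewrite (bd_splith cn' nd (f := f) (x1 := m) (x2 := b)); last first.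
  by move=> t tI; split; apply: H => //; rewrite ?lexx ?am ?mb ?ab.
move=> E.
have [?|h1] := leP e (cn (bd f a m c n)); first by constructor 1.
have [?|h2] := leP e (cn (bd f a m n d)); first by constructor 2.
have [?|h3] := leP e (cn (bd f m b c n)); first by constructor 3.
have [?|h4] := leP e (cn (bd f m b n d)); first by constructor 4.
have := cnD (bd f a m c n + bd f a m n d) (bd f m b c n + bd f m b n d).
have := cnD (bd f a m c n) (bd f a m n d).
have := cnD (bd f m b c n) (bd f m b n d).
lra.
Qed.

Lemma nested_intervals (a b : nat -> R) : (forall n, a n <= a n.+1) ->
  (forall n, b n.+1 <= b n) -> (forall n, a n <= b n) -> exists x, forall n, a n <= x <= b n.
Proof.
move=> ai bd ab.
have am m n : (m <= n)%N -> a m <= a n.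
  by move=> /subnK <-; elim: (n - m)%N => // k IH; rewrite addSn (le_trans IH).
have bm m n : (m <= n)%N -> b n <= b m.
  by move=> /subnK <-; elim: (n - m)%N => // k IH; rewrite addSn (le_trans _ IH).
have amb m n : a m <= b n.
  have [mn|nm] := leqP m n; first by rewrite (le_trans (am _ _ mn)).
  by rewrite (le_trans (ab m)) // bm // ltnW.
have nz : range a !=set0 by exists (a 0%N), 0%N.
exists (sup (range a)) => n; apply/andP; split.
  by apply: ub_le_sup; [exists (b n) => _ [m _ <-]|exists n].
by apply: ge_sup => // _ [m _ <-].
Qed.

Lemma exp2_large (x r : R) : 0 < r -> exists n, x / 2 ^+ n < r.
Proof.
move=> r0; exists (Num.truncn (x / r)).+1.
rewrite ltr_pdivrMr ?exprn_gt0 // mulrC -ltr_pdivrMr //.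
rewrite (lt_le_trans (truncnS_gt _)) // -natrX ler_nat ltnW // ltn_expl //.
Qed.

Let itv_dist (a u x X : R) : a <= x -> x <= a + u -> a <= X -> X <= a + u -> - u <= x - X <= u.
Proof. by move=> *; lra. Qed.

(** Bisection: a nonzero integral of modulus [eta] selects at each step a quarter carrying at least
    a fourth of it. Around the limit point [f] is affine up to [e] times the distance, and an affine
    function has a primitive; the [n]-th integral is thus at most [e * 2 (w + h)^2 / 4 ^+ n], which
    the choice of [e] makes smaller than [eta / 4 ^+ n]. *)
Theorem goursat f x1 x2 y1 y2 : x1 <= x2 -> y1 <= y2 ->
  (forall x y, x1 <= x <= x2 -> y1 <= y <= y2 -> hol f (x +i* y)) ->
  bd f x1 x2 y1 y2 = 0.
Proof.
move=> x12 y12 H; apply: contrapT => /eqP; rewrite -cn_gt0.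
set eta := cn _ => eta0; pose w := x2 - x1; pose h := y2 - y1.
have w0 : 0 <= w by rewrite subr_ge0.
have h0 : 0 <= h by rewrite subr_ge0.
have hc x y : x1 <= x <= x2 -> y1 <= y <= y2 -> ccont f (x +i* y).
  by move=> xI yI; apply: hol_cont; exact: H.
(* Only the lower left corner [p] has to be recorded: the [n]-th rectangle measures [w / 2 ^+ n] by
   [h / 2 ^+ n]. *)
pose P n (p : R * R) := [/\ x1 <= p.1 /\ p.1 + w / 2 ^+ n <= x2,
  y1 <= p.2 /\ p.2 + h / 2 ^+ n <= y2 &
  eta / 4 ^+ n <= cn (bd f p.1 (p.1 + w / 2 ^+ n) p.2 (p.2 + h / 2 ^+ n))].
pose Q n (p q : R * R) := [/\ p.1 <= q.1 /\ q.1 + w / 2 ^+ n.+1 <= p.1 + w / 2 ^+ n,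
   p.2 <= q.2 & q.2 + h / 2 ^+ n.+1 <= p.2 + h / 2 ^+ n].
have half (v : R) n : v / 2 ^+ n = v / 2 ^+ n.+1 + v / 2 ^+ n.+1.
  by rewrite exprS; field; rewrite expf_neq0 // pnatr_eq0.
have step (x : nat * (R * R)) : exists q, P x.1 x.2 -> P x.1.+1 q /\ Q x.1 x.2 q.
  case: x => n [a c] /=.
  have [PP|] := pselect (P n (a, c)); last by exists (a, c).
  case: PP => /= -[xa ax] [yc cy] E.
  have wn0 : 0 <= w / 2 ^+ n.+1 by rewrite divr_ge0 // exprn_ge0.
  have hn0 : 0 <= h / 2 ^+ n.+1 by rewrite divr_ge0 // exprn_ge0.
  rewrite (half w) in ax E; rewrite (half h) in cy E; rewrite !addrA in ax cy E.
  have E4 : 4 * (eta / 4 ^+ n.+1) <= cn (bd f a (a + w / 2 ^+ n.+1 + w / 2 ^+ n.+1) c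
       (c + h / 2 ^+ n.+1 + h / 2 ^+ n.+1)).
    apply: le_trans E; rewrite exprS le_eqVlt; apply/orP; left; apply/eqP; field.
    by rewrite expf_neq0.
  set u := w / 2 ^+ n.+1 in wn0 ax E E4 *; set v := h / 2 ^+ n.+1 in hn0 cy E E4 *.
  have [||||x y xI yI|e|e|e|e] := @bd_quarter f a (a + u) (a + u + u) c (c + v) (c + v + v) _ _ _ _ _ _ E4.
  - by rewrite lerDl; exact: wn0.
  - by rewrite lerDl.
  - by rewrite lerDl; exact: hn0.
  - by rewrite lerDl.
  - by apply: hc; lra.
  - exists (a, c) => _; rewrite /P /Q /= (half w n) (half h n) !addrA -?/u -?/v; do 2?split=> //; lra.
  - exists (a, c + v) => _; rewrite /P /Q /= (half w n) (half h n) !addrA -?/u -?/v; do 2?split=> //; lra.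
  - exists (a + u, c) => _; rewrite /P /Q /= (half w n) (half h n) !addrA -?/u -?/v; do 2?split=> //; lra.
  - exists (a + u, c + v) => _; rewrite /P /Q /= (half w n) (half h n) !addrA -?/u -?/v; do 2?split=> //; lra.
have [nx Hnx] := choice step.
pose s := fix s n := if n is m.+1 then nx (m, s m) else (x1, y1).
have Ps n : P n (s n).
  elim: n => [|n IH]; last by have [] := Hnx (n, s n) IH.
  by rewrite /P /= !expr0 !divr1 /w /h !subrKC; do !split.
have Qs n : Q n (s n) (s n.+1) by have [] := Hnx (n, s n) (Ps n).
have [X HX] : exists x, forall n, (s n).1 <= x <= (s n).1 + w / 2 ^+ n.
  apply: nested_intervals => n; [by have [[]] := Qs n|by have [[]] := Qs n|].
  by rewrite lerDl divr_ge0 // exprn_ge0.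
have [Y HY] : exists y, forall n, (s n).2 <= y <= (s n).2 + h / 2 ^+ n.
  apply: nested_intervals => n; [by have [] := Qs n|by have [] := Qs n|].
  by rewrite lerDl divr_ge0 // exprn_ge0.
have [d D] : hol f (X +i* Y).
  have := HX 0%N; have := HY 0%N; rewrite /= expr0 !divr1 /w /h !subrKC => YI XI; exact: H.
set z0 := X +i* Y in D.
pose e := eta / (2 * (w + h) ^+ 2 + 1).
have den : 0 < 2 * (w + h) ^+ 2 + 1 by rewrite ltr_wpDl // mulr_ge0 // sqr_ge0.
have e0 : 0 < e by rewrite divr_gt0.
have [r r0 {}D] := D _ e0; have [n nr] := exp2_large (w + h) r0.
have [[xa ax] [yc cy] E] := Ps n.
set a := (s n).1 in xa ax E; set c := (s n).2 in yc cy E.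
have wn0 : 0 <= w / 2 ^+ n by rewrite divr_ge0 // exprn_ge0.
have hn0 : 0 <= h / 2 ^+ n by rewrite divr_ge0 // exprn_ge0.
set u := w / 2 ^+ n in wn0 ax E; set v := h / 2 ^+ n in hn0 cy E.
have HXn : a <= X <= a + u by have := HX n.
have HYn : c <= Y <= c + v by have := HY n.
have uv : u + v = (w + h) / 2 ^+ n by rewrite /u /v -mulrDl.
pose lin (z : R[i]) : R[i] := f z0 + d * (z - z0).
pose G (z : R[i]) : R[i] := f z0 * z + d * ((z - z0) ^+ 2 / 2).
have linG z : cderiv G z (lin z).
  have c1 := cderivM (cderiv_cst (f z0) z) (cderiv_id z).
  have c2 := cderivD (cderiv_id z) (cderiv_cst (- z0) z).
  have c3 := cderivM c2 c2.
  have c4 := cderivM (cderiv_cst (d / 2) z) c3.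
  have c5 := cderivD c1 c4.
  have -> : G = fun x => f z0 * id x + d / 2 * ((id x - z0) * (id x - z0)).
    by apply/funext => x; rewrite /G expr2 /=; field.
  rewrite (_ : lin z = 0 * id z + f z0 * 1 +
    (0 * ((id z - z0) * (id z - z0)) + d / 2 * ((1 + 0) * (id z - z0) + (id z - z0) * (1 + 0)))) //.
  by rewrite /lin /=; field.
have inE x y : a <= x <= a + u -> c <= y <= c + v -> cn ((x +i* y) - z0) <= u + v.
  move=> xI yI; rewrite (le_trans (cn_le_ReIm _)) //= lerD // ler_norml.
    by move: xI HXn => /andP[? ?] /andP[? ?]; exact: (@itv_dist a).
  by move: yI HYn => /andP[? ?] /andP[? ?]; exact: (@itv_dist c).
have hlin z : hol lin z.
  apply: holD; first exact: hol_cst.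
  by apply: holM; [exact: hol_cst|apply: holB; [exact: hol_id|exact: hol_cst]].
have cont_rem z : ccont f z -> ccont (fun z => f z + (-1) * lin z) z.
  move=> fc; apply: ccontD => //; apply: hol_cont.
  by apply: holM; [exact: hol_cst|exact: hlin].
have au : a <= a + u by rewrite lerDl.
have cv : c <= c + v by rewrite lerDl.
have fin x y : a <= x <= a + u -> c <= y <= c + v -> ccont f (x +i* y).
  move=> /andP[x1I x2I] /andP[y1I y2I]; apply: hc.
    by rewrite (le_trans xa x1I) (le_trans x2I ax).
  by rewrite (le_trans yc y1I) (le_trans y2I cy).
have remb x y : a <= x <= a + u -> c <= y <= c + v ->
    ccont (fun z => f z + (-1) * lin z) (x +i* y) /\
    cn (f (x +i* y) + (-1) * lin (x +i* y)) <= e * (u + v).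
  move=> xI yI; split; first by apply: cont_rem; exact: fin.
  have I := inE _ _ xI yI.
  have := D (x +i* y - z0); rewrite subrKC mulN1r opprD addrA => /(_ _)/le_trans; apply.
    by rewrite (le_lt_trans I) // uv.
  by rewrite ler_wpM2l // ltW.
have eE : edges a (a + u) c (c + v) (fun z => ccont (fun z => f z + (-1) * lin z) z /\
    cn (f z + (-1) * lin z) <= e * (u + v)).
  by split=> t tI; split; apply: remb => //; rewrite ?lexx ?au ?cv.
have eL : edges a (a + u) c (c + v) (ccont lin).
  by split=> t tI; split; apply: hol_cont; exact: hlin.
have lin0 : bd lin a (a + u) c (c + v) = 0.
  by apply: (@bd_primitive _ G) => //; split=> t tI; split; exact: linG.
have key := bd_le au cv eE.
have fE : f = fun z => (f z + (-1) * lin z) + lin z.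
  by apply/funext => z; ring.
rewrite fE (bdD au cv (edgesW eE (fun z => @proj1 _ _)) eL) lin0 addr0 in E.
have au' : a + u - a = u by rewrite addrAC subrr add0r.
have cv' : c + v - c = v by rewrite addrAC subrr add0r.
have := le_trans E key; rewrite au' cv' uv.
rewrite (_ : e * _ * _ = (e * (2 * (w + h) ^+ 2)) / 4 ^+ n); last first.
  rewrite (_ : 4 ^+ n = 2 ^+ n * 2 ^+ n); last by rewrite -exprMn; congr (_ ^+ _); ring.
  by field; rewrite expf_neq0 // pnatr_eq0.
rewrite ler_pM2r ?invr_gt0 ?exprn_gt0 // leNgt => /negP; apply.
by rewrite /e mulrAC ltr_pdivrMr // ltr_pM2l // ltrDl.
Qed.

End Rectangle.

(** * Taylor expansion *)

Section Taylor.
Context {R : realType}.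
Implicit Types f g : R[i] -> R[i].

Notation bdsq f r := (bd f (- r) r (- r) r).
Notation sqedges r := (edges (- r) r (- r) r).
Definition hol_sq f (r : R) := forall x y : R, `|x| <= r -> `|y| <= r -> hol f (x +i* y).

Lemma sqedgesE (r : R) (P : R[i] -> Prop) : 0 <= r ->
  (forall x y : R, `|x| <= r -> `|y| <= r -> r <= cn (x +i* y) -> P (x +i* y)) -> sqedges r P.
Proof.
move=> r0 H; have nr : `|r| = r by rewrite ger0_norm.
split=> t; rewrite -ler_norml => tI; split; apply: H; rewrite ?normrN ?nr //.
- by rewrite (le_trans _ (Im_le_cn _)) //= normrN nr.
- by rewrite (le_trans _ (Im_le_cn _)) //= nr.
- by rewrite (le_trans _ (Re_le_cn _)) //= normrN nr.
- by rewrite (le_trans _ (Re_le_cn _)) //= nr.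
Qed.

Lemma bdsq_le f r K : 0 < r ->
  sqedges r (fun z => ccont f z /\ cn (f z) <= K) -> cn (bdsq f r) <= 8 * r * K.
Proof.
move=> r0 H; have rr : - r <= r by rewrite (@le_trans _ _ 0) ?oppr_le0 ?ltW.
by rewrite (le_trans (bd_le rr rr H)) // le_eqVlt; apply/orP; left; apply/eqP; ring.
Qed.

Lemma cn_geB (z a : R[i]) : cn z - cn a <= cn (z - a :> R[i]).
Proof. by rewrite lerBlDr -{1}(subrK a z) cnD. Qed.

Lemma cn_dist (z w : R[i]) : `|cn z - cn w| <= cn (z - w).
Proof. by rewrite ler_norml cn_geB lerNl opprB cnBC cn_geB. Qed.

(** The quotient [q z = (f z - f a) / (z - a)] is holomorphic off [a] and bounded by some [K] near
    [a]. The square is cut into four rectangles that miss [a], killed by [goursat], and a small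
    square around [a] with integral at most [8 K dl]. The factor on the right is kept as an integral
    in place of [2 pi i]. *)
Lemma cauchy_square f r a : 0 < r -> cn a < r -> hol_sq f r ->
  bdsq (fun z => f z / (z - a)) r = f a * bdsq (fun z => (z - a)^-1) r.
Proof.
case: a => p s r0 ar H; set a := p +i* s.
have pr : `|p| < r by apply: le_lt_trans ar; exact: (Re_le_cn a).
have sr : `|s| < r by apply: le_lt_trans ar; exact: (Im_le_cn a).
have rr : - r <= r by rewrite (@le_trans _ _ 0) ?oppr_le0 ?ltW.
have hV z : z != a -> hol (fun z => (z - a)^-1) z.
  move=> za; apply: holV; first by apply: holB; [exact: hol_id|exact: hol_cst].
  by rewrite subr_eq0.
pose q z := (f z - f a) / (z - a).
have hq x y : `|x| <= r -> `|y| <= r -> x +i* y != a -> hol q (x +i* y).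
  move=> xr yr za; apply: holM; last exact: hV.
  by apply: holB; [exact: H|exact: hol_cst].
suff q0 : bdsq q r = 0.
  have edge z : r <= cn z -> z != a by apply: contraTneq => ->; rewrite -ltNge.
  have -> : (fun z => f z / (z - a)) = (fun z => q z + f a * (z - a)^-1).
    by apply/funext => z; rewrite /q mulrBl subrK.
  rewrite bdD //.
  - rewrite q0 add0r bdZ //; apply: sqedgesE => [|x y _ _ /edge zr]; first exact: ltW.
    by apply: hol_cont; exact: hV.
  - by apply: sqedgesE => [|x y xr yr /edge zr]; [exact: ltW|apply: hol_cont; exact: hq].
  - apply: sqedgesE => [|x y xr yr /edge zr]; first exact: ltW.
    by apply: hol_cont; apply: holM; [exact: hol_cst|exact: hV].
have [d /cderiv_lip [t t0 L]] := H p s (ltW pr) (ltW sr).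
rewrite -/a in L; set K := cn d + 1 in L; have K0 : 0 < K by rewrite ltr_wpDl ?cn_ge0.
have qK h : cn h < t -> cn (q (a + h)) <= K.
  move=> /L {}L; rewrite /q addrAC subrr add0r cnM cnV.
  have [->|h0] := eqVneq h 0; first by rewrite addr0 subrr cn0 mul0r ltW.
  by rewrite ler_pdivrMr // cn_gt0.
apply: cn_eq0_le => e e0.
(* The small square must fit into the ball where [q] is bounded, satisfy [8 K dl <= e], and stay
   inside the large square. *)
pose dl := Num.min (Num.min (t / 4) (e / (8 * K))) (Num.min (r - `|p|) (r - `|s|)).
have dl0 : 0 < dl by rewrite !lt_min !subr_gt0 pr sr !divr_gt0 // mulr_gt0.
have dlt : dl <= t / 4 by rewrite /dl !ge_min lexx.
have dle : dl <= e / (8 * K) by rewrite /dl !ge_min lexx !orbT.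
have dlp : dl <= r - `|p| by rewrite /dl !ge_min lexx !orbT.
have dls : dl <= r - `|s| by rewrite /dl !ge_min lexx !orbT.
have pI : - r <= p - dl /\ p + dl <= r.
  by clear -dlp; have := ler_norm p; have := ler_norm (- p); rewrite normrN; lra.
have sI : - r <= s - dl /\ s + dl <= r.
  by clear -dls; have := ler_norm s; have := ler_norm (- s); rewrite normrN; lra.
have pd : p - dl <= p + dl by clear -dl0; lra.
have sd : s - dl <= s + dl by clear -dl0; lra.
have neqa x y : (x != p) || (y != s) -> x +i* y != a.
  by rewrite eq_complex /= negb_and.
have inr (x u v : R) : - r <= u -> v <= r -> u <= x <= v -> `|x| <= r.
  by move=> ru vr /andP[ux xv]; rewrite ler_norml (le_trans ru ux) (le_trans xv vr).
have nr : `|r| <= r by rewrite ger0_norm // ltW.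
have nNr : `|- r| <= r by rewrite normrN.
have nu (u : R) : `|u| < r -> (- r != u) && (r != u).
  by move=> ur; apply/andP; split; apply: contraTneq ur => <-; rewrite ?normrN (ger0_norm (ltW r0)) ltxx.
have rs := nu _ sr; have rp := nu _ pr.
have [rs1 rs2] := andP rs; have [rp1 rp2] := andP rp.
have dn (u : R) : (u - dl != u) && (u + dl != u).
  by rewrite lt_eqF ?gt_eqF ?ltrDl ?gtrDl ?oppr_lt0.
have [[p1 p2] [s1 s2]] := (pI, sI).
have [dp1 dp2] := andP (dn p); have [ds1 ds2] := andP (dn s).
have np1 : `|p - dl| <= r by apply: (inr _ _ _ p1 p2); rewrite lexx pd.
have np2 : `|p + dl| <= r by apply: (inr _ _ _ p1 p2); rewrite lexx pd.
have ns1 : `|s - dl| <= r by apply: (inr _ _ _ s1 s2); rewrite lexx sd.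
have ns2 : `|s + dl| <= r by apply: (inr _ _ _ s1 s2); rewrite lexx sd.
rewrite (bd_splitv (m := p - dl)) ?p1 ?(le_trans pd p2) //; last first.
  by move=> x xI; split; apply: hol_cont; apply: hq => //; rewrite ?(inr x _ _ _ _ xI) ?lexx //;
    apply: neqa; rewrite ?rs1 ?rs2 orbT.
rewrite (bd_splitv (x1 := p - dl) (m := p + dl)) //; last first.
  by move=> x xI; split; apply: hol_cont; apply: hq => //; rewrite ?(inr x _ _ _ _ xI) ?lexx //;
    apply: neqa; rewrite ?rs1 ?rs2 orbT.
rewrite (bd_splith (x1 := p - dl) (x2 := p + dl) (m := s - dl)) ?s1 ?(le_trans sd s2) //; last first.
  by move=> x xI; split; apply: hol_cont; apply: hq => //; rewrite ?(inr x _ _ _ _ xI) ?lexx //;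
    apply: neqa; rewrite ?dp1 ?dp2.
rewrite (bd_splith (x1 := p - dl) (x2 := p + dl) (y1 := s - dl) (m := s + dl)) //; last first.
  by move=> x xI; split; apply: hol_cont; apply: hq => //; rewrite ?(inr x _ _ _ _ xI) ?lexx //;
    apply: neqa; rewrite ?dp1 ?dp2.
have pdl : p - dl < p by clear -dl0; lra.
have pdr : p < p + dl by clear -dl0; lra.
have sdl : s - dl < s by clear -dl0; lra.
have sdr : s < s + dl by clear -dl0; lra.
rewrite (@goursat _ q (- r) (p - dl)) //; last first.
  move=> x y xI yI; apply: hq; rewrite ?(inr _ _ _ _ _ xI) ?(inr _ _ _ _ _ yI) ?lexx //.
    by have := np1; rewrite ler_norml => /andP[].
  by apply: neqa; rewrite lt_eqF //; case/andP: xI => _ /le_lt_trans; apply.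
rewrite (@goursat _ q (p + dl) r) //; last first.
  move=> x y xI yI; apply: hq; rewrite ?(inr _ _ _ _ _ xI) ?(inr _ _ _ _ _ yI) ?lexx //.
    by have := np2; rewrite ler_norml => /andP[].
  by apply: neqa; rewrite gt_eqF //; case/andP: xI => /(lt_le_trans pdr).
rewrite (@goursat _ q (p - dl) (p + dl) (- r)) //; last first.
  move=> x y xI yI; apply: hq; rewrite ?(inr _ _ _ _ _ xI) ?(inr _ _ _ _ _ yI) ?lexx //.
    by have := ns1; rewrite ler_norml => /andP[].
  by apply: neqa; rewrite [y == s]lt_eqF ?orbT //; case/andP: yI => _ /le_lt_trans; apply.
rewrite (@goursat _ q (p - dl) (p + dl) (s + dl)) //; last first.
  move=> x y xI yI; apply: hq; rewrite ?(inr _ _ _ _ _ xI) ?(inr _ _ _ _ _ yI) ?lexx //.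
    by have := ns2; rewrite ler_norml => /andP[].
  by apply: neqa; rewrite [y == s]gt_eqF ?orbT //; case/andP: yI => /(lt_le_trans sdr).
rewrite !addr0 !add0r.
have small x y : `|x - p| <= dl -> `|y - s| <= dl -> cn (q (x +i* y)) <= K.
  move=> xp ys; have := qK (x +i* y - a); rewrite subrKC; apply.
  rewrite (le_lt_trans (cn_le_ReIm _)) //=; clear -xp ys dlt t0; lra.
have nd : `|dl| <= dl by rewrite ger0_norm // ltW.
have Np : `|p - dl - p| <= dl by rewrite addrAC subrr add0r normrN.
have Pp : `|p + dl - p| <= dl by rewrite addrAC subrr add0r.
have Ns : `|s - dl - s| <= dl by rewrite addrAC subrr add0r normrN.
have Ps : `|s + dl - s| <= dl by rewrite addrAC subrr add0r.
rewrite (le_trans (@bd_le _ q _ _ _ _ K pd sd _)) //; last first.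
  rewrite (_ : _ - _ + _ = 4 * dl); last by ring.
  rewrite ler_pdivlMr ?mulr_gt0 // in dle.
  by apply: le_trans dle; rewrite le_eqVlt; apply/orP; left; apply/eqP; ring.
have mid (u x : R) : u - dl <= x <= u + dl -> `|x - u| <= dl.
  by move=> /andP[? ?]; rewrite ler_norml lerBrDr lerBlDr [- dl + u]addrC [dl + u]addrC; apply/andP.
split=> x xI; split; split.
- apply: hol_cont; apply: hq; rewrite ?(inr _ _ _ _ _ xI) //; apply: neqa; rewrite ds1 orbT //.
- by apply: small => //; exact: mid.
- apply: hol_cont; apply: hq; rewrite ?(inr _ _ _ _ _ xI) //; apply: neqa; rewrite ds2 orbT //.
- by apply: small => //; exact: mid.
- apply: hol_cont; apply: hq; rewrite ?(inr _ _ _ _ _ xI) //; apply: neqa; rewrite dp1 //.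
- by apply: small => //; exact: mid.
- apply: hol_cont; apply: hq; rewrite ?(inr _ _ _ _ _ xI) //; apply: neqa; rewrite dp2 //.
- by apply: small => //; exact: mid.
Qed.

Lemma hol_expV n (z : R[i]) : z != 0 -> hol (fun z => z ^- n) z.
Proof.
by move=> z0; apply: (@holV _ (fun z : R[i] => z ^+ n)); [apply: (@holX _ id); exact: hol_id|rewrite expf_neq0].
Qed.

(** Geometric expansion [1 / (z - a) = sum_(k < n) a^k / z^(k+1) + a^n / (z^n (z - a))] on the
    contour, where [cn z >= r] bounds the last term. *)
Lemma cauchy_expand f r a n K : 0 < r -> cn a < r ->
  sqedges r (fun z => hol f z /\ cn (f z) <= K) ->
  cn (bdsq (fun z => f z / (z - a)) r - \sum_(k < n) a ^+ k * bdsq (fun z => f z / z ^+ k.+1) r)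
  <= 8 * r * (K * (cn a / r) ^+ n / (r - cn a)).
Proof.
move=> r0 ar H; have rr : - r <= r by rewrite (@le_trans _ _ 0) ?oppr_le0 ?ltW.
have ra0 : 0 < r - cn a by rewrite subr_gt0.
have H' : sqedges r (fun z => (hol f z /\ cn (f z) <= K) /\ r <= cn z).
  by apply: edgesI => //; apply: sqedgesE => //; exact: ltW.
have z0 z : r <= cn z -> z != 0 by rewrite -cn_gt0; exact: lt_le_trans.
have za z : r <= cn z -> z != a by apply: contraTneq => ->; rewrite -ltNge.
pose h m z := f z * (a ^+ m / z ^+ m / (z - a)).
have hh m z : r <= cn z -> hol f z -> hol (h m) z.
  move=> zr hf; apply: holM => //; apply: holM; last first.
    apply: holV; first by apply: holB; [exact: hol_id|exact: hol_cst].
    by rewrite subr_eq0 za.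
  by apply: holM; [exact: hol_cst|exact: (hol_expV _ (z0 _ zr))].
have -> : bdsq (fun z => f z / (z - a)) r - \sum_(k < n) a ^+ k * bdsq (fun z => f z / z ^+ k.+1) r
   = bdsq (h n) r.
  elim: n => [|n IH].
    rewrite big_ord0 subr0; congr (bdsq _ r); apply/funext => z.
    by rewrite /h !expr0 divr1 mul1r.
  rewrite big_ord_recr /= opprD addrA IH; apply/eqP; rewrite subr_eq; apply/eqP.
  rewrite addrC -bdZ //; last first.
    by apply: edgesW H' _ => z [[hf _] zr]; apply: hol_cont; apply: holM => //; exact: (hol_expV _ (z0 _ zr)).
  rewrite -bdD //.
  - apply: bd_ext => //.
      by apply: edgesW H' _ => z [[hf _] zr]; apply: hol_cont; exact: hh.
    apply: edgesW H' _ => z [[hf _] zr].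
    have := z0 _ zr; have := za _ zr; rewrite -subr_eq0 => h1 h2.
    by rewrite /h !exprS; field; rewrite h1 h2 /= ?expf_neq0.
  - apply: edgesW H' _ => z [[hf _] zr]; apply: hol_cont; apply: holM; first exact: hol_cst.
    by apply: holM => //; exact: (hol_expV _ (z0 _ zr)).
  - by apply: edgesW H' _ => z [[hf _] zr]; apply: hol_cont; exact: hh.
apply: bdsq_le => //; apply: edgesW H' _ => z [[hf fK] zr]; split; first by apply: hol_cont; exact: hh.
have K0 : 0 <= K by apply: le_trans fK; exact: cn_ge0.
rewrite /h !cnM !cnV -[X in _ <= X]mulrA ler_pM ?cn_ge0 //.
  by rewrite !mulr_ge0 ?invr_ge0 ?cn_ge0.
rewrite ler_pM ?invr_ge0 ?cn_ge0 ?mulr_ge0 ?invr_ge0 ?cn_ge0 //.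
  rewrite !cnX expr_div_n ler_wpM2l ?exprn_ge0 ?cn_ge0 // lef_pV2 ?posrE ?exprn_gt0 //.
    by rewrite lerXn2r // nnegrE ?cn_ge0 // ltW.
  by rewrite (lt_le_trans r0).
rewrite lef_pV2 ?posrE //; first by rewrite (le_trans _ (cn_geB _ _)) // lerD2r.
by rewrite cn_gt0 subr_eq0 za.
Qed.

Lemma cderivX n (z : R[i]) : cderiv (fun z => z ^+ n) z (n%:R * z ^+ n.-1).
Proof.
elim: n => [|n IH]; first by rewrite mul0r; exact: cderiv_cst.
have := cderivM (cderiv_id z) IH; congr cderiv; first by apply/funext => x; rewrite exprS.
case: n {IH} => [|n] /=; first by rewrite !expr0 mul0r mulr0 addr0.
by rewrite mulrCA -exprS mul1r -[n.+2%:R]natr1 mulrDl mul1r addrC.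
Qed.

Lemma bd_expV (r : R) k : 0 < r -> bdsq (fun z : R[i] => z ^- k.+2) r = 0.
Proof.
move=> r0; have rr : - r <= r by rewrite (@le_trans _ _ 0) ?oppr_le0 ?ltW.
apply: (@bd_primitive _ _ (fun z : R[i] => - (k.+1%:R)^-1 * (z ^+ k.+1)^-1)) => //.
apply: sqedgesE => [|x y _ _]; first exact: ltW.
move: (x +i* y) => z zr; have z0 : z != 0 by rewrite -cn_gt0 (lt_le_trans r0).
have := cderivM (cderiv_cst (- (k.+1%:R)^-1) z)
  (cderiv_comp (cderivX k.+1 z) (cderivV (expf_neq0 k.+1 z0))).
congr cderiv; rewrite /= !exprS; field.
by rewrite z0 expf_neq0 //= addrC natr1 pnatr_eq0.
Qed.

(** Each of the four sides contributes at least [1] to the imaginary part, as the integral of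
    [r / (t ^+ 2 + r ^+ 2) >= 1 / (2 r)] over a length [2 r]. This lower bound is what allows
    division by the winding integral. *)
Lemma bd_inv (r : R) : 0 < r -> 4 <= cn (bdsq (fun z : R[i] => z^-1) r).
Proof.
move=> r0; have rr : - r <= r by rewrite (@le_trans _ _ 0) ?oppr_le0 ?ltW.
rewrite (le_trans _ (Im_le_cn _)) // (le_trans _ (ler_norm _)) //.
have [|p1 p2 p3 p4] := @edges_prim _ (fun z : R[i] => z^-1) _ _ _ _ rr rr.
  apply: sqedgesE => [|x y _ _ zr]; first exact: ltW.
  by apply: hol_cont; apply: (@holV _ id); [exact: hol_id|rewrite -cn_gt0 (lt_le_trans r0)].
have r2 : 0 < r ^+ 2 by rewrite exprn_gt0.
have le t : - r <= t <= r -> (2 * r)^-1 <= r / (t ^+ 2 + r ^+ 2).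
  rewrite -ler_norml => tI; have t2 : t ^+ 2 <= r ^+ 2 by rewrite -real_normK ?num_real // lerXn2r ?nnegrE // ltW.
  rewrite ler_pdivlMr ?ltr_wpDl ?sqr_ge0 // ler_pdivrMl ?mulr_gt0 //.
  by rewrite -mulrA -expr2; lra.
have B1 : (2 * r)^-1 * (r - - r) <= complex.Re (- 'i * cint (fun t => (t +i* - r)^-1) (- r) r).
  apply: Re_cint_ge => // t tI; rewrite (le_trans (le _ tI)) //=.
  by rewrite !sqrrN; lra.
have B2 : (2 * r)^-1 * (r - - r) <= complex.Re ('i * cint (fun t => (t +i* r)^-1) (- r) r).
  apply: Re_cint_ge => // t tI; rewrite (le_trans (le _ tI)) //=; lra.
have B3 : (2 * r)^-1 * (r - - r) <= complex.Re (1 * cint (fun t => (r +i* t)^-1) (- r) r).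
  by apply: Re_cint_ge => // t tI; rewrite (le_trans (le _ tI)) //= [t ^+ 2 + _]addrC; lra.
have B4 : (2 * r)^-1 * (r - - r) <= complex.Re ((-1) * cint (fun t => (- r +i* t)^-1) (- r) r).
  by apply: Re_cint_ge => // t tI; rewrite (le_trans (le _ tI)) //= [t ^+ 2 + _]addrC !sqrrN; lra.
have E : (2 * r)^-1 * (r - - r) = 1 by field; rewrite gt_eqF.
rewrite E in B1 B2 B3 B4; move: B1 B2 B3 B4.
rewrite /bd; set A := cint _ _ _; set B := cint _ _ _; set C := cint _ _ _; set D := cint _ _ _.
by clear; case: A B C D => ? ? [? ?] [? ?] [? ?] /=; lra.
Qed.

Lemma le_geometric0 (x C q : R) : 0 <= q -> q < 1 -> (forall n, x <= C * q ^+ n.+1) -> x <= 0.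
Proof.
move=> q0 q1 H; apply/ler_addgt0Pl => e e0; rewrite addr0.
have cv : (fun n => C * q ^+ n) @ \oo --> C * 0.
  by apply: cvgMr; apply: cvg_expr; rewrite ger0_norm.
move: cv; rewrite mulr0 => /cvgrPdist_le/(_ _ e0) [N _ HN].
have := HN N.+1 (leqnSn N); rewrite sub0r normrN => h.
by rewrite (le_trans (H N)) // (le_trans (ler_norm _)).
Qed.

(** The coefficients are Cauchy's, normalised by the integral [N] of [1 / z] in place of [2 pi i].
    The factor [2] in both bounds is [8 / 4]: perimeter [8 r] against [4 <= cn N]. *)
Theorem taylor f r K : 0 < r -> hol_sq f r -> sqedges r (fun z => cn (f z) <= K) ->
  exists c : nat -> R[i], (forall k, cn (c k) <= 2 * K / r ^+ k) /\
  (forall a n, cn a < r ->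
    cn (f a - \sum_(k < n) c k * a ^+ k) <= 2 * r * (K * (cn a / r) ^+ n / (r - cn a))).
Proof.
move=> r0 H fK; have rr : - r <= r by rewrite (@le_trans _ _ 0) ?oppr_le0 ?ltW.
pose N := bdsq (fun z : R[i] => z^-1) r; have N4 : 4 <= cn N by exact: bd_inv.
have N0 : 0 < cn N by rewrite (lt_le_trans _ N4).
have e1 : sqedges r (fun z : R[i] => hol (fun=> 1) z /\ cn (1 : R[i]) <= (1 : R)).
  by apply: sqedgesE => [|*]; [exact: ltW|split; [exact: hol_cst|rewrite cn1]].
(* Expansion of the kernel itself: all powers beyond the first have primitives, and the remainder is
   geometric. *)
have eN a : cn a < r -> bdsq (fun z => (z - a)^-1) r = N.
  move=> ar; apply/eqP; rewrite -subr_eq0 -cn_eq0; apply/eqP/le_anti; rewrite cn_ge0 andbT.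
  have ra0 : 0 < r - cn a by rewrite subr_gt0.
  apply: (@le_geometric0 _ (8 * r / (r - cn a)) (cn a / r)).
  - by rewrite divr_ge0 ?cn_ge0 ?ltW.
  - by rewrite ltr_pdivrMr // mul1r.
  move=> n; have := @cauchy_expand (fun=> 1) r a n.+1 1 r0 ar e1.
  rewrite big_ord_recl /= big1 ?addr0; last first.
    move=> i _; rewrite (_ : (fun z => 1 / _) = (fun z => z ^- i.+2)) ?bd_expV ?mulr0 //.
    by apply/funext => z; rewrite div1r /bump /= add1n.
  rewrite expr0 mul1r (_ : (fun z => 1 / (z - a)) = (fun z => (z - a)^-1)); last first.
    by apply/funext => z; rewrite div1r.
  rewrite (_ : (fun z => 1 / z ^+ 1) = (fun z => z^-1)); last first.
    by apply/funext => z; rewrite div1r expr1.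
  move=> /le_trans; apply; rewrite mul1r le_eqVlt; apply/orP; left; apply/eqP; ring.
have ef : sqedges r (fun z => hol f z /\ cn (f z) <= K).
  by apply: edgesI => //; apply: sqedgesE => [|x y xr yr _]; [exact: ltW|exact: H].
exists (fun k => bdsq (fun z => f z / z ^+ k.+1) r / N); split.
  move=> k; rewrite cnM cnV ler_pdivrMr //.
  have K0 : 0 <= K by have [+ _] := fK => /(_ 0); rewrite oppr_le0 ltW //= => /(_ isT) [+ _]; apply: le_trans; exact: cn_ge0.
  have Z : cn (bdsq (fun z => f z / z ^+ k.+1) r) <= 8 * r * (K / r ^+ k.+1).
    apply: bdsq_le => //; have := edgesI ef (@sqedgesE r (fun z => r <= cn z) (ltW r0) (fun x y _ _ => id)).
    move/edgesW; apply => z [[hf zK] zr]; have z0 : z != 0 by rewrite -cn_gt0 (lt_le_trans r0).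
    split; first by apply: hol_cont; apply: holM => //; exact: hol_expV.
    rewrite cnM cnV cnX ler_pM ?invr_ge0 ?exprn_ge0 ?cn_ge0 //.
    by rewrite lef_pV2 ?posrE ?exprn_gt0 // ?lerXn2r ?nnegrE ?cn_ge0 ?(ltW r0) // (lt_le_trans r0).
  rewrite (le_trans Z) // (_ : 8 * r * _ = 2 * K / r ^+ k * 4); last first.
    by rewrite exprS; field; rewrite ?expf_neq0 ?gt_eqF.
  by rewrite ler_wpM2l // divr_ge0 ?mulr_ge0 ?exprn_ge0 // ltW.
move=> a n ar; have Nn0 : N != 0 by rewrite -cn_gt0.
rewrite -(ler_pM2l N0) -cnM.
rewrite (_ : N * _ = bdsq (fun z => f z / (z - a)) r - \sum_(k < n) a ^+ k * bdsq (fun z => f z / z ^+ k.+1) r); last first.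
  rewrite cauchy_square // eN // mulrBr mulrC mulr_sumr; congr (_ - _).
  by apply: eq_bigr => i _; field.
rewrite (le_trans (cauchy_expand n r0 ar ef)) //.
have ra0 : 0 < r - cn a by rewrite subr_gt0.
have K0 : 0 <= K by have [+ _] := fK => /(_ 0); rewrite oppr_le0 ltW //= => /(_ isT) [+ _]; apply: le_trans; exact: cn_ge0.
set X := K * _ / _; rewrite (_ : 8 * r * X = 4 * (2 * r * X)); last by ring.
by rewrite ler_wpM2r // !mulr_ge0 ?invr_ge0 ?exprn_ge0 ?divr_ge0 ?cn_ge0 // ltW.
Qed.

Lemma hol_bounded f r : 0 < r -> hol_sq f r -> exists K, sqedges r (fun z => cn (f z) <= K).
Proof.
move=> r0 H; have rr : - r <= r by rewrite (@le_trans _ _ 0) ?oppr_le0 ?ltW.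
have nr : `|r| <= r by rewrite ger0_norm // ltW.
have nNr : `|- r| <= r by rewrite normrN.
have ev (g : R -> R[i]) : (forall t, - r <= t <= r -> rcont g t) ->
    exists K, forall t, - r <= t <= r -> cn (g t) <= K.
  move=> gc; have [|c cI Hc] := @EVT_max _ (fun t => cn (g t)) _ _ rr; last first.
    by exists (cn (g c)) => t tI; apply: Hc; rewrite in_itv.
  apply: continuous_in_subspaceT => t; rewrite inE /= in_itv => /gc H1.
  apply: eps_contP => e /H1 [s s0 {}H1]; exists s => // h /H1; apply: le_trans.
  exact: cn_dist.
have hc y t : `|y| <= r -> - r <= t <= r -> rcont (fun t => f (t +i* y)) t.
  move=> yr; rewrite -ler_norml => tr e /(hol_cont (H t y tr yr)) [s s0 Hs].
  by exists s => // h hs; rewrite addhC Hs // cn_real.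
have vc x t : `|x| <= r -> - r <= t <= r -> rcont (fun t => f (x +i* t)) t.
  move=> xr; rewrite -ler_norml => tr e /(hol_cont (H x t xr tr)) [s s0 Hs].
  by exists s => // h hs; rewrite addvC Hs // cnM cn_i mul1r cn_real.
have [K1 H1] := ev _ (fun t => hc _ t nNr); have [K2 H2] := ev _ (fun t => hc _ t nr).
have [K3 H3] := ev _ (fun t => vc _ t nNr); have [K4 H4] := ev _ (fun t => vc _ t nr).
exists (Num.max (Num.max K1 K2) (Num.max K3 K4)); split=> t tI; rewrite !le_max.
  by rewrite H1 // H2 // orbT.
by rewrite H3 // H4 // !orbT.
Qed.

End Taylor.

(** * Identity theorem and series of holomorphic functions *)

Section IdentityTheorem.
Context {R : realType}.
Implicit Types f : R[i] -> R[i].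

Lemma hol_translate f (c w : R[i]) : hol f (c + w) -> hol (fun z => f (c + z)) w.
Proof.
by move=> H; apply: (@hol_comp _ f (fun z => c + z)) => //; apply: holD; [exact: hol_cst|exact: hol_id].
Qed.

Definition hol_around f (c : R[i]) (r : R) := forall z,
  `|complex.Re (z - c)| <= r -> `|complex.Im (z - c)| <= r -> hol f z.

Lemma hol_around_sq f c r : hol_around f c r -> hol_sq (fun z => f (c + z)) r.
Proof.
by move=> H x y xr yr; apply: hol_translate; apply: H; rewrite addrAC subrr add0r.
Qed.

Definition zero_accum f (c : R[i]) := forall d : R, 0 < d ->
  exists h, [/\ h != 0, cn h < d & f (c + h) = 0].

(** If the earlier coefficients vanish, a zero [c + h] gives [cn (u n) <= C * cn h] with [h]
    arbitrarily small; so every Taylor coefficient is [0]. *)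
Lemma taylor_zero f c r : 0 < r -> hol_around f c r -> zero_accum f c ->
  forall h, cn h < r -> f (c + h) = 0.
Proof.
move=> r0 /hol_around_sq H Z; have [K HK] := hol_bounded r0 H.
have [u [_ T]] := taylor r0 H HK; move: T => /= T.
have u0 n : u n = 0.
  elim/ltn_ind: n => n IH; apply: cn_eq0_le => e e0.
  pose C := 2 * r * (K / r ^+ n.+1 / (r / 2)).
  have C0 : 0 < `|C| + 1 by rewrite ltr_wpDl.
  have [|h [h0]] := Z (Num.min (r / 2) (e / (`|C| + 1))).
    by rewrite lt_min !divr_gt0.
  rewrite lt_min => /andP[h1 h2] fh.
  have hr : cn h < r by rewrite (lt_trans h1) // ltr_pdivrMr // ltr_pMr // ltr1n.
  have hp : 0 < cn h by rewrite cn_gt0.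
  have := T h n.+1 hr; rewrite fh big_ord_recr /= big1 ?add0r; last first.
    by move=> i _; rewrite IH ?mul0r.
  rewrite cnN cnM cnX => T1.
  have K0 : 0 <= K by have [+ _] := HK => /(_ 0); rewrite oppr_le0 ltW //= => /(_ isT) [+ _]; apply: le_trans; exact: cn_ge0.
  have T2 : cn (u n) * cn h ^+ n <= C * cn h ^+ n.+1.
    apply: (le_trans T1); rewrite /C expr_div_n.
    rewrite (_ : 2 * r * (K / r ^+ n.+1 / (r / 2)) * _ = 2 * r * (K * (cn h ^+ n.+1 / r ^+ n.+1) / (r / 2))); last by ring.
    apply: ler_wpM2l; first by rewrite mulr_ge0 // ltW.
    apply: ler_wpM2l; first by rewrite mulr_ge0 // divr_ge0 // exprn_ge0 ?cn_ge0 // ltW.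
    rewrite lef_pV2 ?posrE ?subr_gt0 ?divr_gt0 //.
    by move: h1; clear; lra.
  rewrite exprSr mulrA mulrAC ler_pM2r ?exprn_gt0 // in T2.
  rewrite (le_trans T2) // (le_trans (ler_wpM2r (ltW hp) (ler_norm _))) //.
  rewrite mulrC; apply: ltW; apply: (@le_lt_trans _ _ (cn h * (`|C| + 1))).
    by rewrite ler_wpM2l ?ltW // ltrDl.
  by rewrite -ltr_pdivlMr.
move=> h hr; have rh : 0 < r - cn h by rewrite subr_gt0.
apply/eqP; rewrite -cn_eq0; apply/eqP/le_anti; rewrite cn_ge0 andbT.
apply: (@le_geometric0 _ _ (2 * r * (K / (r - cn h))) (cn h / r)).
- by rewrite divr_ge0 ?cn_ge0 ?ltW.
- by rewrite ltr_pdivrMr // mul1r.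
move=> n; have := T h n.+1 hr; rewrite big1 ?subr0; last by move=> i _; rewrite u0 mul0r.
move=> /le_trans; apply; rewrite le_eqVlt; apply/orP; left; apply/eqP; ring.
Qed.

(** The segment is walked in [N] steps shorter than [r]: vanishing on the disc around one point
    makes the next point an accumulation point of zeros. *)
Theorem identity_segment f a b r : 0 < r ->
  (forall t : R, 0 <= t <= 1 -> hol_around f (a + t%:C * (b - a)) r) ->
  zero_accum f a -> forall h, cn h < r -> f (b + h) = 0.
Proof.
move=> r0 H Z.
pose N := (Num.truncn (cn (b - a) / r)).+1.
have N0 : 0 < N%:R :> R by rewrite ltr0n.
have Nr : cn (b - a) / N%:R < r.
  by rewrite ltr_pdivrMr // mulrC -ltr_pdivrMr // truncnS_gt.
pose g k := a + (k%:R / N%:R)%:C * (b - a).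
have hg k : (k <= N)%N -> hol_around f (g k) r.
  by move=> kN; apply: H; rewrite divr_ge0 ?ler0n //= ler_pdivrMr // mul1r ler_nat.
have zg k : (k <= N)%N -> forall h, cn h < r -> f (g k + h) = 0.
  elim: k => [_|k IH kN]; apply: taylor_zero => //.
  - exact: hg.
  - by rewrite /g mul0r mul0r addr0.
  - exact: hg.
  move=> d d0; have gg : g k.+1 - g k = (N%:R^-1)%:C * (b - a).
    rewrite /g -natr1 mulrDl rmorphD /= mul1r; ring.
  have gr : cn (g k.+1 - g k) < r.
    by rewrite gg cnM cn_real ger0_norm ?invr_ge0 ?ler0n // mulrC.
  pose s := Num.min (d / 2) ((r - cn (g k.+1 - g k)) / 2).
  have s0 : 0 < s by rewrite lt_min !divr_gt0 // subr_gt0.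
  exists s%:C; split.
  - by rewrite -cn_gt0 cn_real normr_gt0 gt_eqF.
  - by rewrite cn_real gtr0_norm // gt_min ltr_pdivrMr // ltr_pMr // ltr1n.
  rewrite -[g k.+1](subrKC (g k)) -addrA; apply: (IH (ltnW kN)).
  rewrite (le_lt_trans (cnD _ _)) // cn_real gtr0_norm //.
  have : s <= (r - cn (g k.+1 - g k)) / 2 by rewrite ge_min lexx orbT.
  by move: gr; clear; lra.
have -> : b = g N by rewrite /g divff ?gt_eqF // mul1r addrC subrK.
exact: zg.
Qed.

End IdentityTheorem.

Section ComplexSeries.
Context {R : realType}.
Implicit Types u v : nat -> R[i].

Definition csum u (l : R[i]) := forall e : R, 0 < e ->
  exists N, forall n, (N <= n)%N -> cn (\sum_(k < n) u k - l) <= e.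

Lemma csumD u v l m : csum u l -> csum v m -> csum (fun n => u n + v n) (l + m).
Proof.
move=> L M e e0; have e2 : 0 < e / 2 by rewrite divr_gt0.
have [N1 H1] := L _ e2; have [N2 H2] := M _ e2.
exists (maxn N1 N2) => n; rewrite geq_max => /andP[/H1 {}H1 /H2 {}H2].
by rewrite big_split /= opprD addrACA (le_trans (cnD _ _)) // [e]splitr lerD.
Qed.

Lemma csumZ c u l : csum u l -> csum (fun n => c * u n) (c * l).
Proof.
move=> L e e0; have c0 : 0 < cn c + 1 by rewrite ltr_wpDl ?cn_ge0.
have [N H] := L _ (divr_gt0 e0 c0); exists N => n /H {}H.
rewrite -mulr_sumr -mulrBr cnM (le_trans (ler_wpM2l (cn_ge0 _) H)) //.
by rewrite mulrCA ler_piMr ?(ltW e0) // ler_pdivrMr // mul1r lerDl.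
Qed.

Lemma csum_le u l K : csum u l -> (forall n, cn (\sum_(k < n) u k) <= K) -> cn l <= K.
Proof.
move=> L H; apply/ler_addgt0Pr => e /L [N /(_ _ (leqnn N))].
set S := \sum_(k < _) _ => h; rewrite -(subrKC S l) (le_trans (cnD _ _)) // lerD ?H //.
by rewrite cnBC.
Qed.

Lemma real_bounded_series_cauchy (B : nat -> R) K : (forall n, 0 <= B n) ->
  (forall n, \sum_(k < n) B k <= K) -> forall e, 0 < e -> exists N, forall m n,
  (N <= m)%N -> (m <= n)%N -> \sum_(m <= k < n) B k <= e.
Proof.
move=> B0 HK e e0; pose S := [set x | exists n, x = \sum_(k < n) B k].
have nS : S !=set0 by exists 0, 0%N; rewrite big_ord0.
have bS : has_ubound S by exists K => _ [n ->].
have [_ [N ->] HN] := sup_adherent e0 (conj nS bS).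
exists N => m n Nm mn.
have h1 : \sum_(k < n) B k <= sup S by apply: ub_le_sup => //; exists n.
have h2 : \sum_(k < N) B k <= \sum_(k < m) B k.
  rewrite -!(big_mkord xpredT) (big_cat_nat _ Nm) //= lerDl sumr_ge0 //.
rewrite -(big_mkord xpredT) (big_cat_nat _ mn) //= big_mkord in h1.
by move: h1 h2 HN; clear; lra.
Qed.

Lemma real_series_cvg (u : nat -> R) (B : nat -> R) K : (forall n, `|u n| <= B n) ->
  (forall n, \sum_(k < n) B k <= K) -> exists l, forall e, 0 < e ->
  exists N, forall n, (N <= n)%N -> `|\sum_(k < n) u k - l| <= e.
Proof.
move=> uB HK.
have B0 n : 0 <= B n by rewrite (le_trans _ (uB n)).
have : cvgn (fun n => \sum_(k < n) u k).
  apply: cauchy_cvg; apply/cauchyP => e e0.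
  have [N HN] := real_bounded_series_cauchy B0 HK (divr_gt0 e0 (ltr0n R 2)).
  exists (\sum_(k < N) u k); exists N => // n /= Nn; rewrite /ball /=.
  rewrite -!(big_mkord xpredT) (big_cat_nat _ Nn) //= opprD addrA subrr sub0r normrN.
  rewrite (le_lt_trans (ler_norm_sum _ _ _)) // (le_lt_trans (ler_sum _ (fun i _ => uB i))) //.
  by rewrite (le_lt_trans (HN _ _ (leqnn N) Nn)) // ltr_pdivrMr // ltr_pMr // ltr1n.
move=> /cvg_ex[l /cvgrPdist_le Hl]; exists l => e /Hl [N _ HN]; exists N => n /HN.
by rewrite distrC.
Qed.

Lemma csum_exists u (B : nat -> R) K : (forall n, cn (u n) <= B n) ->
  (forall n, \sum_(k < n) B k <= K) -> exists l, csum u l.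
Proof.
move=> uB HK.
have [a Ha] := real_series_cvg (fun n => le_trans (Re_le_cn (u n)) (uB n)) HK.
have [b Hb] := real_series_cvg (fun n => le_trans (Im_le_cn (u n)) (uB n)) HK.
exists (a +i* b) => e e0; have e2 : 0 < e / 2 by rewrite divr_gt0.
have [N1 H1] := Ha _ e2; have [N2 H2] := Hb _ e2.
exists (maxn N1 N2) => n; rewrite geq_max => /andP[/H1 {}H1 /H2 {}H2].
rewrite (le_trans (cn_le_ReIm _)) // [e]splitr lerD // !(ReD, ImD, ReN, ImN) /=.
  by move: H1; rewrite (big_morph _ (@ReD R) (erefl _)).
by move: H2; rewrite (big_morph _ (@ImD R) (erefl _)).
Qed.

(** By [taylor] each term has a second-order estimate with constant [B n * 4 / r ^+ 2]. These errors
    add up to [K * 4 / r ^+ 2 * cn h ^+ 2], so [F] is differentiable at [c] with derivative the sum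
    of the derivatives. *)
Theorem weierstrass (f : nat -> R[i] -> R[i]) (F : R[i] -> R[i]) c r (B : nat -> R) K : 0 < r ->
  (forall n, hol_around (f n) c r) ->
  (forall n z, `|complex.Re (z - c)| <= r -> `|complex.Im (z - c)| <= r -> cn (f n z) <= B n) ->
  (forall n, \sum_(k < n) B k <= K) ->
  (forall z, `|complex.Re (z - c)| <= r -> `|complex.Im (z - c)| <= r -> csum (f^~ z) (F z)) ->
  hol F c.
Proof.
move=> r0 H HB HK HF.
have B0 n : 0 <= B n.
  by apply: le_trans (HB n c _ _); rewrite ?cn_ge0 // subrr normr0 ltW.
have /choice[d Hd] : forall n, exists d, cn d <= 2 * B n / r /\
    forall h, cn h <= r / 2 -> cn (f n (c + h) - f n c - d * h) <= B n * (4 / r ^+ 2 * cn h ^+ 2).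
  move=> n; have /taylor := hol_around_sq (H n).
  have e : edges (- r) r (- r) r (fun z => cn (f n (c + z)) <= B n).
    by apply: sqedgesE => [|x y xr yr _]; [exact: ltW|apply: HB; rewrite addrAC subrr add0r].
  move=> /(_ _ r0 e) [u [u1 u2]].
  have u0 : u 0%N = f n c.
    apply/esym/eqP; rewrite -subr_eq0 -cn_eq0; apply/eqP/le_anti; rewrite cn_ge0 andbT.
    have := u2 0 1%N; rewrite cn0 mul0r expr0n mulr0 mul0r mulr0 big_ord1 expr0 mulr1 addr0.
    exact.
  exists (u 1%N); split; first by have := u1 1%N; rewrite expr1.
  move=> h hr; have hr' : cn h < r by move: hr r0; clear; lra.
  have := u2 h 2%N hr'; rewrite !big_ord_recr big_ord0 /= expr0 mulr1 expr1 add0r u0 opprD addrA.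
  move=> /le_trans; apply; rewrite expr_div_n.
  rewrite (_ : 2 * r * _ = B n * (2 / r * cn h ^+ 2 * (r - cn h)^-1)); last first.
    by field; rewrite ?subr_eq0 ?(gt_eqF hr') ?(gt_eqF r0).
  apply: ler_wpM2l => //.
  rewrite (_ : 4 / r ^+ 2 * _ = 2 / r * cn h ^+ 2 * (r / 2)^-1); last by field; rewrite gt_eqF.
  apply: ler_wpM2l; first by rewrite mulr_ge0 ?divr_ge0 ?exprn_ge0 ?cn_ge0 // ltW.
  by rewrite lef_pV2 ?posrE ?subr_gt0 ?divr_gt0 //; move: hr; clear; lra.
have [D HD] : exists D, csum d D.
  apply: (@csum_exists _ (fun n => 2 * B n / r) (2 * K / r)) => [n|n]; first by have [] := Hd n.
  by rewrite -mulr_suml -mulr_sumr ler_wpM2r ?invr_ge0 ?(ltW r0) // ler_wpM2l.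
have est h : cn h <= r / 2 -> cn (F (c + h) - F c - D * h) <= K * (4 / r ^+ 2 * cn h ^+ 2).
  move=> hr; have hr' : cn h <= r by move: hr r0; clear; lra.
  have s1 : csum (f^~ (c + h)) (F (c + h)).
    by apply: HF; rewrite addrAC subrr add0r (le_trans _ hr') // ?Re_le_cn ?Im_le_cn.
  have s2 : csum (f^~ c) (F c) by apply: HF; rewrite subrr normr0 ltW.
  have := csumD (csumD s1 (csumZ (-1) s2)) (csumZ (- h) HD).
  rewrite mulN1r mulNr [h * D]mulrC => /csum_le; apply => n.
  rewrite (le_trans (cn_sum _ _ _)) //.
  apply: (@le_trans _ _ (\sum_(k < n) B k * (4 / r ^+ 2 * cn h ^+ 2))).
    apply: ler_sum => k _; have [_ /(_ h hr)] := Hd k.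
    by rewrite mulN1r mulNr [h * _]mulrC.
  rewrite -mulr_suml; apply: ler_wpM2r; last exact: HK.
  by rewrite mulr_ge0 ?exprn_ge0 ?cn_ge0 // divr_ge0 // exprn_ge0 // ltW.
have K0 : 0 <= K by have := HK 0%N; rewrite big_ord0.
exists D => e e0; pose A := K * (4 / r ^+ 2) + 1.
have A0 : 0 < A by rewrite ltr_wpDl // mulr_ge0 // divr_ge0 // exprn_ge0 // ltW.
exists (Num.min (r / 2) (e / A)); first by rewrite lt_min !divr_gt0.
move=> h; rewrite lt_min => /andP[/ltW h1 /ltW h2].
rewrite (le_trans (est h h1)) // expr2 !mulrA ler_wpM2r ?cn_ge0 //.
rewrite ler_pdivlMr // in h2; apply: le_trans h2.
by rewrite mulrC ler_wpM2l ?cn_ge0 // /A mulrA lerDl.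
Qed.

End ComplexSeries.

(** * The complex exponential *)

Section ComplexExp.
Context {R : realType}.
Implicit Types z w : R[i].

Lemma cexpD z w : cexp (z + w) = cexp z * cexp w.
Proof.
case: z w => a b [c d]; rewrite /cexp /= expRD cosD sinD.
by apply/eqP; rewrite eq_complex /=; apply/andP; split; apply/eqP; ring.
Qed.

Lemma cexp0 : cexp (0 : R[i]) = 1.
Proof. by rewrite /cexp /= expR0 cos0 sin0 mul1r. Qed.

Lemma cn_cexp z : cn (cexp z) = expR (complex.Re z).
Proof.
rewrite /cexp cnM cn_real (ger0_norm (expR_ge0 _)) [X in _ * X]/=.
by rewrite cos2Dsin2 sqrtr1 mulr1.
Qed.

Lemma cexp_real (x : R) : cexp x%:C = (expR x)%:C.
Proof. by rewrite /cexp /= cos0 sin0 [1 +i* 0](_ : _ = 1) // mulr1. Qed.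

Lemma cderiv_cexp z : cderiv cexp z (cexp z).
Proof.
move=> e e0; have c0 : 0 < expR (complex.Re z) :> R by exact: expR_gt0.
pose f := e / (8 * expR (complex.Re z)).
have f0 : 0 < f by rewrite divr_gt0 // mulr_gt0.
have [r1 r10 H1] := is_derive_eps_deriv (is_derive_expR (0 : R)) f0.
have [r2 r20 H2] := is_derive_eps_deriv (is_derive_cos (0 : R)) f0.
have [r3 r30 H3] := is_derive_eps_deriv (is_derive_sin (0 : R)) f0.
exists (Num.min (Num.min r1 r2) (Num.min (Num.min r3 1) f)); first by rewrite !lt_min r10 r20 r30 f0 ltr01.
move=> h; rewrite !lt_min => /andP[/andP[h1 h2] /andP[/andP[h3 h4] h5]].
have := H1 _ (le_lt_trans (Re_le_cn h) h1); have := H2 _ (le_lt_trans (Im_le_cn h) h2).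
have := H3 _ (le_lt_trans (Im_le_cn h) h3).
rewrite !add0r expR0 cos0 sin0 oppr0 mulr0 mulr1 mulr1 !subr0.
set x := complex.Re h; set y := complex.Im h => S3 S2 S1.
have hx := Re_le_cn h; have hy := Im_le_cn h; rewrite -/x -/y in hx hy.
rewrite cexpD [X in cn X](_ : _ = cexp z * (cexp h - 1 - h)); last by ring.
rewrite cnM cn_cexp.
suff : cn (cexp h - 1 - h) <= 8 * f * cn h.
  move=> /(ler_wpM2l (ltW c0))/le_trans; apply.
  by rewrite mulrA ler_wpM2r ?cn_ge0 // /f le_eqVlt; apply/orP; left; apply/eqP; field; rewrite gt_eqF.
set T := cos y +i* sin y.
have T1 : cn T = 1 by rewrite /= cos2Dsin2 sqrtr1.
(* The summands isolate the first-order errors of [expR], of [cos] and [sin], and the product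
   [x * y]; they are at most [f], [4 f] and [f] times [cn h], within the claimed [8 f]. *)
have -> : cexp h - 1 - h = (expR x - 1 - x)%:C * T + (1 + x)%:C * ((cos y - 1) +i* (sin y - y)) + 'i * (x * y)%:C.
  rewrite [h in _ - h]complexE -/x -/y /cexp -/x -/y /T.
  by apply/eqP; rewrite eq_complex /=; apply/andP; split; apply/eqP; ring.
have n3 : cn ((cos y - 1) +i* (sin y - y)) <= 2 * f * cn h.
  rewrite (le_trans (cn_le_ReIm _)) //=.
  have l2 := le_trans S2 (ler_wpM2l (ltW f0) hy); have l3 := le_trans S3 (ler_wpM2l (ltW f0) hy).
  by move: l2 l3; clear; rewrite addr0; lra.
have n1 := le_trans S1 (ler_wpM2l (ltW f0) hx).
have n2 : `|1 + x| <= 2 by rewrite (le_trans (ler_normD _ _)) // normr1 -[2]/(1 + 1) lerD2l (le_trans hx) // ltW.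
have n4 : `|x * y| <= f * cn h by rewrite normrM ler_pM // (le_trans hx) // ltW.
rewrite (le_trans (cnD _ _)) // (le_trans (lerD (cnD _ _) (lexx _))) // !cnM T1 cn_i !cn_real mulr1 mul1r.
have n5 := ler_pM (normr_ge0 _) (cn_ge0 _) n2 n3.
have fh : 0 <= f * cn h by rewrite mulr_ge0 ?cn_ge0 // ltW.
by move: n1 n4 n5 fh; clear; lra.
Qed.

Lemma hol_cexp z : hol cexp z.
Proof. by exists (cexp z); exact: cderiv_cexp. Qed.

Lemma natcpowM (m n : nat) z : (0 < m)%N -> (0 < n)%N ->
  natcpow (m * n) z = natcpow m z * natcpow n z.
Proof.
by move=> m0 n0; rewrite /natcpow natrM lnM ?posrE ?ltr0n // rmorphD /= mulrDr cexpD.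
Qed.

Lemma cn_natcpow n z : cn (natcpow n z) = expR (complex.Re z * ln n%:R).
Proof. by rewrite /natcpow cn_cexp ReM /= mulr0 subr0. Qed.

Lemma hol_natcpow n z (g : R[i] -> R[i]) : hol g z -> hol (fun s => natcpow n (g s)) z.
Proof.
move=> H; apply: (@hol_comp _ cexp); last exact: hol_cexp.
by apply: holM => //; exact: hol_cst.
Qed.

End ComplexExp.

(** * Arithmetic of the Moebius function *)

Section Moebius.

Lemma moebius_mul_prime p n : prime p -> (0 < n)%N -> ~~ (p %| n)%N ->
  moebius (p * n) = - moebius n.
Proof.
move=> pp n0 pn; have p0 := prime_gt0 pp.
have pq : perm_eq (primes (p * n)) (p :: primes n).
  apply: uniq_perm; first exact: primes_uniq.
    by rewrite /= primes_uniq andbT mem_primes pp n0 /= pn.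
  by move=> q; rewrite primesM // primes_prime // !inE.
rewrite /moebius (perm_size pq) (perm_all _ pq) /=.
have -> : logn p (p * n) == 1%N.
  by rewrite lognM // logn_prime // eqxx lognE pp n0 (negPf pn).
have -> : all (fun q => logn q (p * n) == 1%N) (primes n) =
          all (fun q => logn q n == 1%N) (primes n).
  apply: eq_in_all => q; rewrite mem_primes => /and3P[pq' _ qn].
  rewrite lognM // logn_prime // [(q == p)%B](_ : _ = false) //.
  by apply: contraNF pn => /eqP <-.
by rewrite /=; case: ifP => _; rewrite ?oppr0 // exprS mulN1r.
Qed.

Lemma moebius_sqr_dvd p n : prime p -> (0 < n)%N -> (p * p %| n)%N -> moebius n = 0.
Proof.
move=> pp n0 pn; rewrite /moebius; case: ifP => // /allP/(_ p).
rewrite mem_primes pp n0 (dvdn_trans (dvdn_mulr _ (dvdnn _)) pn) => /(_ isT)/eqP l1.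
by move: pn; rewrite mulnn (pfactor_dvdn 2 pp n0) l1.
Qed.

Lemma moebius_norm n : `|moebius n| <= 1.
Proof. by rewrite /moebius; case: ifP => _; rewrite ?normr0 // normrX normrN1 expr1n. Qed.

(** For [p] the least prime factor of [k > 1], divisors divisible by [p^2] contribute nothing, and
    [b -> p * b] matches the divisors prime to [p] with those divisible by [p] once, with opposite
    signs. *)
Lemma sum_moebius_dvd n k : (0 < k < n)%N ->
  \sum_(1 <= a < n | (a %| k)%N) moebius a = (k == 1%N)%:R.
Proof.
move=> /andP[k0 kn]; have [->|k1] := eqVneq k 1%N.
  rewrite (eq_bigl (fun a => a == 1%N)) => [|a]; last by rewrite dvdn1.
  rewrite -big_filter (_ : [seq _ <- _ | _] = [:: 1%N]) ?big_seq1 //.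
  apply: perm_small_eq => //; apply: uniq_perm; rewrite ?filter_uniq ?iota_uniq //.
  move=> a; rewrite mem_filter mem_index_iota inE; case: eqP => // -> /=.
  by rewrite (leq_ltn_trans k0).
have pp : prime (pdiv k) by rewrite pdiv_prime // ltn_neqAle eq_sym k1.
set p := pdiv k in pp; have pk : (p %| k)%N := pdiv_dvd k; have p0 := prime_gt0 pp.
rewrite (bigID (fun a => p %| a)%N) /= [X in X + _](_ : _ = - \sum_(1 <= a < n | (a %| k)%N && ~~ (p %| a)%N) moebius a).
  by rewrite addNr.
rewrite (bigID (fun a => p * p %| a)%N) /= [X in X + _]big1_seq ?add0r; last first.
  move=> a /andP[/andP[_ pa]]; rewrite mem_index_iota => /andP[a0 _].
  exact: (moebius_sqr_dvd pp).
rewrite -sumrN -[LHS]big_filter -[RHS]big_filter.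
have pe : perm_eq [seq a <- index_iota 1 n | ((a %| k) && (p %| a) && ~~ (p * p %| a))%N]
   (map (muln p) [seq b <- index_iota 1 n | ((b %| k) && ~~ (p %| b))%N]).
  apply: uniq_perm; rewrite ?filter_uniq ?iota_uniq //.
    rewrite map_inj_uniq ?filter_uniq ?iota_uniq // => x y /eqP.
    by rewrite eqn_pmul2l // => /eqP.
  move=> a; rewrite mem_filter mem_index_iota; apply/idP/mapP.
    move=> /andP[/andP[/andP[ak /dvdnP[b ab]] nd] /andP[a0 an]]; exists b; last by rewrite ab mulnC.
    rewrite mem_filter mem_index_iota; move: a0 ak nd an; rewrite ab => a0 ak nd an.
    have b0 : (0 < b)%N by move: a0; rewrite muln_gt0 => /andP[].
    rewrite b0 (dvdn_trans (dvdn_mulr _ (dvdnn _)) ak) /=.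
    rewrite dvdn_pmul2r // in nd; rewrite nd /=.
    by rewrite (leq_ltn_trans _ an) // leq_pmulr.
  move=> [b]; rewrite mem_filter mem_index_iota => /andP[/andP[bk pb] /andP[b0 bn]] ->.
  have pbk : (p * b %| k)%N by rewrite Gauss_dvd ?pk ?bk // prime_coprime.
  rewrite pbk dvdn_mulr //= dvdn_pmul2l // pb /= muln_gt0 p0 b0 /=.
  by rewrite (leq_ltn_trans _ kn) // dvdn_leq.
rewrite (perm_big _ pe) /= big_map !big_filter [LHS]big_seq_cond [RHS]big_seq_cond.
apply: eq_bigr => b /andP[]; rewrite mem_index_iota => /andP[b0 _] /andP[_ pb].
by rewrite moebius_mul_prime.
Qed.

(** Regrouping by [k = a * m] leaves [F k] times the divisor sum of [moebius] at [k]; vanishing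
    beyond [A] keeps the regrouping finite. *)
Lemma moebius_inversion (K : comNzRingType) (F : nat -> K) A : (0 < A)%N ->
  (forall n, (A < n)%N -> F n = 0) ->
  \sum_(1 <= a < A.+1) (moebius a)%:~R * (\sum_(1 <= m < A.+1) F (a * m)%N) = F 1%N.
Proof.
move=> A0 F0.
have E a : (0 < a)%N -> \sum_(1 <= m < A.+1) F (a * m)%N = \sum_(1 <= k < A.+1 | (a %| k)%N) F k.
  move=> a0; rewrite (bigID (fun m => a * m <= A)%N) /= [X in _ + X]big1 ?addr0; last first.
    by move=> m; rewrite -ltnNge => /F0.
  rewrite -[LHS]big_filter -[RHS]big_filter.
  have pe : perm_eq [seq k <- index_iota 1 A.+1 | (a %| k)%N]
     (map (muln a) [seq m <- index_iota 1 A.+1 | (a * m <= A)%N]).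
    apply: uniq_perm; rewrite ?filter_uniq ?iota_uniq //.
      rewrite map_inj_uniq ?filter_uniq ?iota_uniq // => x y /eqP.
      by rewrite eqn_pmul2l // => /eqP.
    move=> k; rewrite mem_filter mem_index_iota; apply/idP/mapP.
      move=> /andP[/dvdnP[m ->] /andP[m0 mA]]; exists m; last by rewrite mulnC.
      rewrite mem_filter mem_index_iota mulnC -ltnS mA /=; move: m0; rewrite muln_gt0 => /andP[-> _] /=.
      by rewrite (leq_ltn_trans _ mA) // leq_pmulr.
    move=> [m]; rewrite mem_filter mem_index_iota => /andP[amA /andP[m0 mA]] ->.
    by rewrite dvdn_mulr // muln_gt0 a0 m0 ltnS.
  by rewrite (perm_big _ pe) /= big_map.
rewrite [LHS]big_seq_cond (eq_bigr (fun a => \sum_(1 <= k < A.+1) ((if (a %| k)%N then moebius a else 0)%:~R * F k))); last first.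
  move=> a; rewrite mem_index_iota => /andP[/andP[a0 _] _]; rewrite E // mulr_sumr big_mkcond /=.
  by apply: eq_bigr => k _; case: ifP => _; rewrite ?mul0r.
rewrite -big_seq_cond exchange_big /= big_nat_recl //= [X in _ + X]big1_seq ?addr0.
  rewrite -mulr_suml -rmorph_sum -big_mkcond /= sum_moebius_dvd ?mul1r //.
move=> k /andP[_]; rewrite mem_index_iota => /andP[k0 kA].
rewrite -mulr_suml -rmorph_sum -big_mkcond /= sum_moebius_dvd ?mul0r //.
by case: k k0 {kA} => // k _; rewrite /= mul0r.
Qed.

(** Since [T 0 = 0], the lower end leaves only the term in [T 1], and [h 0] stays out of the
    formula: for [h n = n^(1-s)] it would be a junk value. *)
Lemma second_summation (K : comNzRingType) (T w h : nat -> K) N : T 0%N = 0 ->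
  (forall n, T n.+2 - 2 * T n.+1 + T n = w n.+1) ->
  \sum_(1 <= n < N.+2) w n * h n = T 1%N * (h 2%N - 2 * h 1%N) +
   \sum_(2 <= n < N.+2) T n * (h n.+1 - 2 * h n + h n.-1) +
   (T N.+2 * h N.+1 - T N.+1 * h N.+2).
Proof.
move=> T0 Tw; elim: N => [|N IH].
  by rewrite big_nat1 big_geq // -Tw T0; ring.
rewrite big_nat_recr //= IH [in RHS]big_nat_recr //= -Tw; ring.
Qed.

End Moebius.

(** * Majorants by sums of inverse powers *)

Section RealSums.
Context {R : realType}.

Lemma sum_invsq_le N : \sum_(1 <= n < N.+1) (n%:R ^+ 2)^-1 <= 2 :> R.
Proof.
case: N => [|N]; first by rewrite big_geq.
suff H : \sum_(1 <= n < N.+2) (n%:R ^+ 2)^-1 <= 2 - N.+1%:R^-1 :> R.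
  by rewrite (le_trans H) // gerBl invr_ge0.
elim: N => [|N IH]; first by rewrite big_nat1 invr1 expr1n invr1; lra.
rewrite big_nat_recr //= (le_trans (lerD IH (lexx _))) // -addrA lerD2l.
have n0 : 0 < N.+1%:R :> R by rewrite ltr0n.
rewrite -[N.+2%:R]natr1; set x := N.+1%:R in n0 *.
have x1 : 0 < x + 1 by rewrite ltr_wpDl // ltW.
rewrite -subr_ge0 (_ : _ - _ = (x * (x + 1) ^+ 2)^-1); last by field; rewrite !gt_eqF.
by rewrite invr_ge0 mulr_ge0 ?exprn_ge0 // ltW.
Qed.

Lemma powR_expR (x a : R) : 0 < x -> x `^ a = expR (a * ln x).
Proof. by move=> x0; rewrite /powR gt_eqF. Qed.

(** Telescoping form of the bound on [sum n^(-1-e)]. With [l = ln (x + 1)] it reduces to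
    [expR u >= 1 + u] and [ln (1 - 1 / (x + 1)) <= - 1 / (x + 1)]. *)
Lemma powR_inv_le (e x : R) : 0 < e -> 1 <= x ->
  (x + 1) `^ (- (1 + e)) <= e^-1 * (x `^ (- e) - (x + 1) `^ (- e)).
Proof.
move=> e0 x1; have x0 : 0 < x by rewrite (lt_le_trans _ x1).
have x10 : 0 < x + 1 by rewrite addr_gt0.
rewrite ler_pdivlMl // !powR_expR //.
set l := ln (x + 1); have -> : - (1 + e) * l = - e * l + (- l) by ring.
have -> : - e * ln x = - e * l + (- e * (ln x - l)) by ring.
rewrite !expRD mulrCA -[X in _ - X]mulr1 -mulrBr ler_wpM2l ?expR_ge0 //.
rewrite [expR (- l)]expRN lnK ?posrE // lerBrDl (le_trans _ (expR_ge1Dx _)) // lerD2l.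
rewrite mulNr -mulrN ler_wpM2l ?(ltW e0) // opprB -lerN2 opprB -ln_div ?posrE //.
have -> : x / (x + 1) = 1 + (- (x + 1)^-1) by field; rewrite gt_eqF.
by apply: le_ln1Dx; rewrite ltrNr opprK invf_lt1 // ltrDr.
Qed.

Lemma sum_powR_le (e : R) N : 0 < e ->
  \sum_(1 <= n < N.+1) n%:R `^ (- (1 + e)) <= 1 + e^-1.
Proof.
move=> e0; case: N => [|N]; first by rewrite big_geq // addr_ge0 // invr_ge0 ltW.
suff H : \sum_(1 <= n < N.+2) n%:R `^ (- (1 + e)) <= 1 + e^-1 * (1 - N.+1%:R `^ (- e)).
  rewrite (le_trans H) // lerD2l ler_piMr ?invr_ge0 ?(ltW e0) // gerBl powR_ge0 //.
elim: N => [|N IH]; first by rewrite big_nat1 !powR1 subrr mulr0 addr0.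
rewrite big_nat_recr //= (le_trans (lerD IH (lexx _))) // -addrA lerD2l.
have h := @powR_inv_le e N.+1%:R e0; rewrite natr1 in h.
have := h _; rewrite ler1n => /(_ isT).
by clear; lra.
Qed.

End RealSums.

(** * Consequence of convergence in L_p *)

Section Partial_sums.
Context {R : realType}.

(** The integral of [M1] over [[1/n, 1]]: between [1/(k + 1)] and [1/k] the function is constant,
    equal to [M k]. *)
Definition Msum (n : nat) : R := \sum_(1 <= k < n) M k%:R / (k%:R * k.+1%:R).

Lemma M_nat (k : nat) (x : R) : k%:R <= x < k.+1%:R -> M x = \sum_(1 <= j < k.+1) (moebius j)%:~R.
Proof.
by move=> kx; rewrite /M (_ : Num.truncn x = k) //; exact: truncn_def.
Qed.

Lemma M_nat1 (k : nat) : M (k%:R : R) = \sum_(1 <= j < k.+1) (moebius j)%:~R.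
Proof. by apply: M_nat; rewrite lexx ltr_nat ltnSn. Qed.

Lemma M1_eq0 (t : R) : 1 < t -> M1 t = 0.
Proof.
move=> t1; rewrite /M1 (@M_nat 0) ?big_geq // invr_ge0 ltW ?(lt_trans _ t1) //=.
by rewrite invf_lt1 // (lt_trans _ t1).
Qed.

Lemma M1_eq (k : nat) (t : R) : (0 < k)%N -> k.+1%:R^-1 < t < k%:R^-1 -> M1 t = M k%:R.
Proof.
move=> k0 /andP[t1 t2]; have t0 : 0 < t by rewrite (lt_trans _ t1) // invr_gt0.
have kp : 0 < k%:R :> R by rewrite ltr0n.
rewrite /M1 M_nat1; apply: M_nat.
by rewrite -[X in X <= _]invrK lef_pV2 ?posrE ?invr_gt0 // (ltW t2) -[X in _ < X]invrK ltf_pV2 ?posrE ?invr_gt0.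
Qed.

Lemma rho_lt1 (u : R) : 0 <= u < 1 -> rho u = u.
Proof. by move=> u01; rewrite /rho (@floor_def _ _ 0) ?subr0 // add0r. Qed.

Lemma rho_bound (u : R) : `|rho u| <= 1.
Proof.
have := floor_itv u; rewrite /rho intrD => /andP[h1 h2].
by rewrite ler_norml; apply/andP; split; move: h1 h2; clear; lra.
Qed.

Lemma M_bound (x : R) N : x < N%:R -> `|M x| <= N%:R.
Proof.
move=> xN; rewrite /M (le_trans (ler_norm_sum _ _ _)) //.
apply: (@le_trans _ _ (\sum_(1 <= k < (Num.truncn x).+1) 1)).
  by apply: ler_sum => k _; rewrite -intr_norm -[1]/(1%:~R) ler_int moebius_norm.
rewrite sumr_const_nat subSS subn0.
have [x0|x0] := leP 0 x; last first.
  by rewrite (_ : Num.truncn x = 0%N) //; apply/trunc0Pn; rewrite -ltNge (lt_trans x0).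
have := truncn_itv x0 => /andP[h _].
by rewrite ltW // (le_lt_trans h).
Qed.

Lemma measurable_floorR : measurable_fun [set: R] (fun x : R => (Num.floor x)%:~R : R).
Proof.
apply: nondecreasing_measurable => // x y xy; rewrite ler_int.
by rewrite floor_ge_int (le_trans _ xy) // ge_floor.
Qed.

Lemma measurable_rho : measurable_fun [set: R] (@rho R).
Proof. by apply: measurable_funB => //; exact: measurable_floorR. Qed.

Lemma measurable_truncn_comp (F : nat -> R) : measurable_fun [set: R] (fun x : R => F (Num.truncn x)).
Proof.
have mt : measurable_fun [set: R] (fun x : R => (Num.truncn x)%:R : R).
  by apply: nondecreasing_measurable => // x y xy; rewrite ler_nat le_truncn.
move=> _ Y mY; rewrite setTI.
rewrite (_ : _ @^-1` _ = \bigcup_(n in F @^-1` Y) ((fun x : R => (Num.truncn x)%:R : R) @^-1` [set n%:R])).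
  apply: bigcup_measurable => n _; rewrite -[X in measurable X]setTI; apply: mt => //.
apply/seteqP; split=> [x /= Fx|x [n /= Fn] /eqP]; first by exists (Num.truncn x).
by rewrite eqr_nat => /eqP ->.
Qed.

Lemma measurable_invR : measurable_fun [set: R] (fun x : R => x^-1).
Proof.
rewrite -(setUv [set 0]); apply/measurable_funU => //; first exact: measurableC.
split; first exact: measurable_fun_set1.
apply: open_continuous_measurable_fun; first by rewrite openC; exact: closed_eq.
by move=> x; rewrite inE /= => /eqP x0; exact: inv_continuous.
Qed.

Definition kern (x : R) (t : R) : R := M1 t * rho (t / x) / t.

Lemma measurable_kern2 : measurable_fun [set: R * R] (fun z : R * R => kern z.1 z.2).
Proof.
have m1 := @measurable_fst _ _ R R; have m2 := @measurable_snd _ _ R R.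
apply: measurable_funM; last exact: (measurableT_comp measurable_invR m2).
apply: measurable_funM.
  apply: (@measurableT_comp _ _ _ _ _ _ (@M1 R)) => //.
  apply: (@measurableT_comp _ _ _ R _ _ (@M R)); last exact: measurable_invR.
  exact: (measurable_truncn_comp (fun n => \sum_(1 <= k < n.+1) (moebius k)%:~R)).
apply: (measurableT_comp measurable_rho); apply: measurable_funM => //.
exact: (measurableT_comp measurable_invR m1).
Qed.

Lemma measurable_kern x : measurable_fun [set: R] (kern x).
Proof.
apply: (@measurableT_comp _ _ _ _ _ _ (fun z : R * R => kern z.1 z.2) _ (pair x)).
  exact: measurable_kern2.
exact: measurable_pair1.
Qed.

(** The integral is a difference of two parameter integrals of nonnegative jointly measurable
    functions, which are measurable by the Tonelli theorem. Minkowski's inequality for [G n - G m]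
    asks for this. *)
Lemma measurable_G n : measurable_fun [set: R] (@G R n).
Proof.
pose D : set R := [set` `[n%:R^-1, +oo[].
have mD : measurable D by exact: measurable_itv.
pose f (z : R * R) : \bar R := (kern z.1 z.2 * \1_D z.2)%:E.
have mf : measurable_fun [set: R * R] f.
  apply/measurable_EFinP; apply: measurable_funM; first exact: measurable_kern2.
  exact: (measurableT_comp (measurable_indic mD) (@measurable_snd _ _ R R)).
have -> : @G R n = fun x => fine (fubini_F lebesgue_measure f^\+ x - fubini_F lebesgue_measure f^\- x)%E.
  apply/funext => x; rewrite /G /Rintegral; congr fine.
  rewrite integral_mkcond integralE /fubini_F.
  congr (_ - _)%E; apply: eq_integral => t _;
    by rewrite ?funeposE ?funenegE /f /= patchE indicE; case: ifPn => _; rewrite ?mulr1 ?mulr0.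
apply: (measurableT_comp (fine_measurable measurableT)).
apply: emeasurable_funB; apply: measurable_fun_fubini_tonelli_F => //.
- exact: measurable_funepos.
- exact: measurable_funeneg.
Qed.

(** [M1] vanishes beyond [1], so the half-line reduces to [[a, 1]], where the kernel is bounded by
    [N * a^-1]. *)
Lemma integrable_kern (x a : R) : 0 < a -> lebesgue_measure.-integrable `[a, +oo[ (EFin \o kern x).
Proof.
move=> a0.
have E : (EFin \o kern x) \_ `[a, +oo[ = (EFin \o kern x) \_ `[a, 1].
  apply/funext => t; rewrite !patchE !mem_setE !in_itv /= andbT.
  have [t1|t1] := leP t 1; first by rewrite andbT.
  by rewrite andbF; case: ifP => // _; rewrite /kern M1_eq0 // !mul0r.
suff I1 : lebesgue_measure.-integrable `[a, 1] (EFin \o kern x).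
  have I2 : lebesgue_measure.-integrable setT ((EFin \o kern x) \_ `[a, 1]).
    by apply: (iffLR (@integrable_mkcond _ _ _ lebesgue_measure `[a, 1] (EFin \o kern x) _)).
  by apply: (iffRL (@integrable_mkcond _ _ _ lebesgue_measure `[a, +oo[ (EFin \o kern x) _)); rewrite ?E.
apply: measurable_bounded_integrable; first exact: measurable_itv.
- have H : (lebesgue_measure ([set` `[a, 1%R]] : set R) < +oo)%E.
    by rewrite lebesgue_measure_itv /=; case: ifP => // _; rewrite -EFinB ltry.
  exact: H.
- exact: measurable_funTS (measurable_kern x).
pose N := (Num.truncn a^-1).+1.
have aN : a^-1 < N%:R by rewrite truncnS_gt.
exists (N%:R * a^-1); split; first exact: num_real.
move=> B NB t /=; rewrite in_itv /= => /andP[at' _]; apply: le_trans (ltW NB).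
have t0 : 0 < t by exact: lt_le_trans at'.
rewrite /kern !normrM normfV (gtr0_norm t0).
apply: ler_pM; rewrite ?invr_ge0 ?(ltW t0) ?mulr_ge0 //; last by rewrite lef_pV2.
rewrite -[N%:R]mulr1; apply: ler_pM => //; last exact: rho_bound.
by apply: M_bound; rewrite (le_lt_trans _ aN) // lef_pV2.
Qed.

(** On the strip gained, [theta < 1/n <= x] makes [rho (theta / x)] equal to [theta / x], and the
    integrand is the constant [M n / x]. *)
Lemma G_step n (x : R) : (0 < n)%N -> n%:R^-1 <= x ->
  G n.+1 x = G n x + M n%:R / (n%:R * n.+1%:R) / x.
Proof.
move=> n0 nx; have np : 0 < n%:R :> R by rewrite ltr0n.
have np1 : 0 < n.+1%:R :> R by rewrite ltr0n.
have x0 : 0 < x by rewrite (lt_le_trans _ nx) // invr_gt0.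
have nn1 : n.+1%:R^-1 < n%:R^-1 :> R by rewrite ltf_pV2 ?posrE // ltr_nat.
set a := n.+1%:R^-1 in nn1 *; set b := n%:R^-1 in nx nn1 *.
have a0 : 0 < a by rewrite invr_gt0.
have U : `[a, +oo[%classic = `[a, b[ `|` `[b, +oo[ :> set R.
  apply/seteqP; split=> t /=; rewrite !in_itv /= !andbT.
    by move=> at'; have [tb|tb] := ltP t b; [left; rewrite at'|right].
  by move=> [/andP[]//|bt]; rewrite (le_trans (ltW nn1)).
rewrite /G -/a -/b -!/(kern _ _) [in LHS]U Rintegral_setU; last first.
- by rewrite disj_set2E; apply/eqP/seteqP; split=> // t [] /=; rewrite !in_itv /= andbT => /andP[_ /lt_le_trans h] /h; rewrite ltxx.
- by rewrite -U; exact: integrable_kern.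
- exact: measurable_itv.
- exact: measurable_itv.
rewrite addrC; congr (_ + _).
have iI : lebesgue_measure.-integrable `]a, b[ (EFin \o kern x).
  apply: (integrableS _ _ _ (integrable_kern x a0)); [exact: measurable_itv|exact: measurable_itv|].
  by move=> t /=; rewrite !in_itv /= andbT => /andP[/ltW].
rewrite -Rintegral_itv_obnd_cbnd //.
transitivity (\int[lebesgue_measure]_(t in `]a, b[) (M n%:R / x)).
  apply: eq_Rintegral => t; rewrite inE /= in_itv /= => /andP[at' tb].
  have t0 : 0 < t by rewrite (lt_trans a0).
  rewrite /kern (@M1_eq n) ?at' // rho_lt1; last first.
    by rewrite divr_ge0 ?(ltW t0) ?(ltW x0) //= ltr_pdivrMr // mul1r (lt_le_trans tb).
  by field; rewrite !gt_eqF.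
rewrite Rintegral_cst; last exact: measurable_itv.
have H : fine (lebesgue_measure ([set` `]a, b[] : set R)) = b - a.
  by rewrite lebesgue_measure_itv /= lte_fin nn1.
rewrite (_ : fine _ = b - a); last exact: H.
by rewrite /a /b -natr1; field; rewrite !gt_eqF // natr1.
Qed.

Lemma G_diff m n (x : R) : (0 < m)%N -> (m <= n)%N -> m%:R^-1 <= x ->
  G n x - G m x = (Msum n - Msum m) / x.
Proof.
move=> m0 /subnK <- mx; elim: (n - m)%N => [|k IH]; first by rewrite add0n !subrr mul0r.
have km0 : (0 < k + m)%N by rewrite addn_gt0 m0 orbT.
rewrite addSn G_step //; last first.
  by rewrite (le_trans _ mx) // lef_pV2 ?posrE ?ltr0n // ler_nat leq_addl.
rewrite addrAC IH /Msum big_nat_recr //=; ring.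
Qed.

(** Comparison with the constant [K] on []a, b[], which [0 < a] places inside the half-line carrying
    [leb0y]. *)
Lemma Lnorm_lower (p K a b : R) (w : R -> R) : 1 < p -> 0 <= K -> 0 < a -> a < b ->
  measurable_fun [set: R] w -> (forall x, a < x < b -> K <= `|w x|) ->
  ((K * (b - a) `^ p^-1)%:E <= Lnorm (leb0y R) p%:E (EFin \o w))%E.
Proof.
move=> p1 K0 a0 ab mw H; have p0 : 0 < p by rewrite (lt_trans _ p1).
have ba : 0 <= b - a by rewrite subr_ge0 ltW.
rewrite unlock /Lnorm.
have mf : measurable_fun [set: R] (fun x => (`|(EFin \o w) x| `^ p)%E).
  apply: (measurableT_comp (measurable_poweR _)) => //.
  by apply: measurableT_comp => //; exact/measurable_EFinP.
have le1 : ((K `^ p * (b - a))%:E <= \int[leb0y R]_x (`|(EFin \o w) x| `^ p))%E.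
  have mI : measurable ([set` `]a, b[] : set R) by exact: measurable_itv.
  apply: (@le_trans _ _ (\int[leb0y R]_(x in `]a, b[) (`|(EFin \o w) x| `^ p))%E); last first.
    by apply: ge0_subset_integral => // x _; exact: poweR_ge0.
  apply: (@le_trans _ _ (\int[leb0y R]_(x in `]a, b[) (cst (K `^ p)%:E) x)%E).
    rewrite integral_cst //= /leb0y /mrestr /=.
    rewrite (_ : `]a, b[ `&` `]0, +oo[ = `]a, b[)%classic; last first.
      apply/setIidl => x /=; rewrite !in_itv /= andbT => /andP[/(lt_trans a0)] //.
    by rewrite lebesgue_measure_itv /= lte_fin ab -EFinB -EFinM.
  apply: ge0_le_integral => //.
  - by move=> x _; rewrite lee_fin powR_ge0.
  - exact: measurable_funTS.
  move=> x /=; rewrite in_itv /= => xI; rewrite lee_fin ge0_ler_powR ?nnegrE ?(ltW p0) //.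
  exact: H.
have -> : (K * (b - a) `^ p^-1)%:E = ((K `^ p * (b - a))%:E `^ p^-1)%E.
  rewrite poweR_EFin powRM ?powR_ge0 // -powRrM mulfV ?gt_eqF // powRr1 //.
apply: gt0_ler_poweR => //; first by rewrite invr_ge0 ltW.
- by rewrite in_itv /= leey andbT lee_fin mulr_ge0 // powR_ge0.
- by rewrite in_itv /= leey andbT integral_ge0 // => x _; exact: poweR_ge0.
Qed.

Theorem converges_Lp_Msum (p : R) : 1 < p -> converges_Lp p (@G R) ->
  forall e : R, 0 < e -> exists N, forall m n, (0 < m)%N -> (N <= m)%N -> (m <= n)%N ->
    `|Msum n - Msum m| <= e * m%:R `^ (p^-1 - 1).
Proof.
move=> p1 [f fL cv] e e0.
have mf : measurable_fun [set: R] f by have := sub_Lfun_mfun fL; rewrite inE.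
have /fine_cvgP[[N1 _ HN1] /cvgrPdist_le/(_ (e / 4)) [|N2 _ HN2]] := cv; first by rewrite divr_gt0.
have HN n : (maxn N1 N2 <= n)%N -> (Lnorm (leb0y R) p%:E (EFin \o (@G R n \- f)%R) <= (e / 4)%:E)%E.
  rewrite geq_max => /andP[/HN1 h1 /HN2]; rewrite /= sub0r normrN => h2.
  by rewrite -(fineK h1) lee_fin (le_trans (ler_norm _)).
exists (maxn N1 N2) => m n m0 Nm mn; have mp : 0 < m%:R :> R by rewrite ltr0n.
have E : EFin \o (@G R n \- @G R m)%R = EFin \o ((@G R n \- f) \+ (f \- @G R m)).
  by apply/funext => x /=; rewrite subrKA.
have Mk : (Lnorm (leb0y R) p%:E (EFin \o (@G R n \- @G R m)%R) <= (e / 2)%:E)%E.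
  rewrite E; apply: (le_trans (minkowski_EFin _ _ _ _)).
  - by apply: measurable_funB => //; exact: measurable_G.
  - by apply: measurable_funB => //; exact: measurable_G.
  - exact: ltW.
  rewrite (_ : (e / 2)%:E = (e / 4)%:E + (e / 4)%:E)%E; last by rewrite -EFinD; congr EFin; field.
  apply: leeD; first by apply: HN; exact: leq_trans mn.
  rewrite (_ : EFin \o _ = \- (EFin \o (@G R m \- f)%R))%E; last first.
    by apply/funext => x /=; rewrite opprB.
  by rewrite oppe_Lnorm HN.
pose c := `|Msum n - Msum m|.
(* On [(1/m, 2/m)] one has [1 / x >= m / 2], and the interval has length [1/m]; this one dyadic
   window already yields the exponent [1/p - 1]. *)
have lo := @Lnorm_lower p (c * (m%:R / 2)) m%:R^-1 (2 / m%:R) (@G R n \- @G R m) p1.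
have : ((c * (m%:R / 2) * (2 / m%:R - m%:R^-1) `^ p^-1)%:E <= (e / 2)%:E)%E.
  apply: le_trans Mk; apply: lo.
  - by apply: mulr_ge0; [exact: normr_ge0|rewrite divr_ge0].
  - by rewrite invr_gt0.
  - by rewrite -[X in X < _]mul1r ltr_pM2r ?invr_gt0 // ltr1n.
  - by apply: measurable_funB; exact: measurable_G.
  move=> x /andP[mx xm]; have x0 : 0 < x by rewrite (lt_trans _ mx) // invr_gt0.
  rewrite /= G_diff // ?(ltW mx) // normrM -/c; apply: ler_wpM2l; first exact: normr_ge0.
  rewrite normfV (gtr0_norm x0).
  by rewrite -[X in X <= _]invrK lef_pV2 ?posrE ?invr_gt0 ?divr_gt0 // invf_div ltW.
rewrite lee_fin (_ : 2 / m%:R - m%:R^-1 = m%:R^-1); last by field; rewrite gt_eqF.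
rewrite powRB; last by rewrite (gt_eqF mp) implybT.
rewrite (powRr1 (ltW mp)) -/c.
rewrite (_ : m%:R^-1 `^ p^-1 = (m%:R `^ p^-1)^-1); last first.
  by rewrite !powR_expR ?invr_gt0 // lnV ?posrE // mulrN expRN.
have q0 : 0 < m%:R `^ p^-1 :> R by rewrite powR_gt0.
rewrite ler_pdivrMr // => h; rewrite mulrA ler_pdivlMr //.
by move: h; set q := m%:R `^ _; clear; lra.
Qed.

End Partial_sums.

(** * The reciprocal of zeta *)

Section SmallDifferences.
Context {R : realType}.

(* [T n = n (Msum n - lim Msum)] is a second primitive of [mu(n)/n]: summing twice by parts
   only uses the averaged information on the Mertens function provided by L_p convergence. *)
Definition moebius_primitive (s0 : R) (T : nat -> R) := [/\ T 0%N = 0,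
  forall n, T n.+2 - 2 * T n.+1 + T n = (moebius n.+1)%:~R / n.+1%:R &
  forall e, 0 < e -> exists N, forall n, (N <= n)%N -> `|T n| <= e * n%:R `^ s0].

Lemma powRM_exp (n : nat) (a b : R) : (0 < n)%N -> n%:R `^ a * n%:R `^ b = n%:R `^ (a + b).
Proof. by move=> n0; rewrite powRD // pnatr_eq0 -lt0n n0 implybT. Qed.

Lemma powR_mono (n : nat) (a b : R) : (0 < n)%N -> a <= b -> n%:R `^ a <= n%:R `^ b.
Proof.
move=> n0 ab; by rewrite !powR_expR ?ltr0n // ler_expR ler_wpM2r // ln_ge0 // ler1n.
Qed.

(** [Msum] is a Cauchy sequence because [m^(1/p - 1) <= 1]. Subtracting its limit [S] makes
    [n (Msum n - S)] as small as [o(n^(1/p))] and alters it only by a linear term, which second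
    differences ignore. *)
Lemma converges_Lp_primitive (p : R) : 1 < p -> converges_Lp p (@G R) ->
  exists T, moebius_primitive p^-1 T.
Proof.
move=> p1 /(converges_Lp_Msum p1) H; have p0 : 0 < p by rewrite (lt_trans _ p1).
have pm : p^-1 - 1 <= 0 by rewrite subr_le0 invf_le1 // ltW.
have le1 m : (0 < m)%N -> m%:R `^ (p^-1 - 1) <= 1 :> R.
  move=> m0; rewrite powR_expR ?ltr0n // -[X in _ <= X]expR0 ler_expR.
  by rewrite mulr_le0_ge0 // ln_ge0 // ler1n.
have /cvg_ex[S /cvgrPdist_le HS] : cvgn (Msum : nat -> R).
  apply: cauchy_cvg; apply/cauchyP => e e0.
  have [N HN] := H _ (divr_gt0 e0 (ltr0n R 2)).
  exists (Msum N.+1); exists N.+1 => // n /= Nn; rewrite /ball /= distrC.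
  rewrite (le_lt_trans (HN _ _ _ (leqnSn N) Nn)) //.
  apply: (@le_lt_trans _ _ (e / 2)); first by rewrite ler_piMr ?divr_ge0 ?(ltW e0) // le1.
  by rewrite ltr_pdivrMr // ltr_pMr // ltr1n.
have HT m e : 0 < e -> (exists N, forall n, (N <= n)%N -> `|Msum n - Msum m| <= e) -> `|S - Msum m| <= e.
  move=> e0 [N HN]; apply/ler_addgt0Pr => d /HS [N2 _ HN2].
  have h1 := HN _ (leq_maxl N N2); have h2 := HN2 (maxn N N2) (leq_maxr N N2).
  rewrite -(subrKA (Msum (maxn N N2))) (le_trans (ler_normD _ _)) // addrC lerD //.
exists (fun n => n%:R * (Msum n - S)); split; first by rewrite mul0r.
  move=> n; have s1 : Msum n.+2 = Msum n.+1 + M n.+1%:R / (n.+1%:R * n.+2%:R) :> R.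
    by rewrite /Msum big_nat_recr.
  have s0 : n%:R * Msum n = n%:R * Msum n.+1 - M n%:R / n.+1%:R :> R.
    case: n {s1} => [|n]; first by rewrite !mul0r M_nat1 big_geq // mul0r subr0.
    rewrite /Msum [in RHS]big_nat_recr //= mulrDr.
    by rewrite invfM (mulrCA n.+1%:R (M _)) mulVKf ?pnatr_eq0 // addrK.
  rewrite !mulrBr s0 s1 !M_nat1 [in X in X + _]big_nat_recr //= -[n.+2%:R]natr1 -[n.+1%:R]natr1.
  have n0 : 0 <= n%:R :> R := ler0n _ n.
  by field; rewrite !gt_eqF //; move: n0; clear=> ?; lra.
move=> e e0; have [N HN] := H _ e0; exists N.+1 => n Nn.
have n0 : (0 < n)%N by rewrite (leq_trans _ Nn).
have np : 0 < n%:R :> R by rewrite ltr0n.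
rewrite normrM distrC (ger0_norm (ltW np)).
have : `|S - Msum n| <= e * n%:R `^ (p^-1 - 1).
  apply: HT; first by rewrite mulr_gt0 // powR_gt0.
  by exists n => k nk; apply: HN => //; exact: ltnW.
move=> /(ler_wpM2l (ltW np))/le_trans; apply.
rewrite mulrCA ler_wpM2l ?(ltW e0) // powRB; last by rewrite (gt_eqF np) implybT.
by rewrite (powRr1 (ltW np)) mulrC divfK // gt_eqF.
Qed.

Lemma moebius_primitive_bound s0 T : moebius_primitive s0 T ->
  exists2 K, 0 <= K & forall n, `|T n| <= K * n%:R `^ s0.
Proof.
move=> [T0 _ /(_ 1 ltr01) [N HN]].
have q0 k : 0 <= `|T k| / k%:R `^ s0 by apply: divr_ge0; [exact: normr_ge0|exact: powR_ge0].
have K0 : 0 <= 1 + \sum_(k < N) `|T k| / k%:R `^ s0 by rewrite addr_ge0 // sumr_ge0.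
exists (1 + \sum_(k < N) `|T k| / k%:R `^ s0) => // n.
have [->|n0] := eqVneq n 0%N; first by rewrite T0 normr0 mulr_ge0 ?powR_ge0.
have np : 0 < n%:R `^ s0 :> R by rewrite powR_gt0 // ltr0n lt0n.
have [nN|Nn] := ltnP n N; last first.
  by rewrite (le_trans (HN n Nn)) // ler_wpM2r ?(ltW np) // lerDl sumr_ge0.
by rewrite -ler_pdivrMr // (bigD1 (Ordinal nN)) //= addrCA lerDl addr_ge0 // sumr_ge0.
Qed.

End SmallDifferences.

Section ReciprocalZeta.
Context {R : realType}.
Implicit Types s z : R[i].

(** Read off [taylor] on the square of half-side [2 B]. One coefficient [c1] serves all [w], so that
    linear parts at different points can be added. *)
Lemma cexp_linear_bound (B : R) : 0 < B -> exists c1 : R[i], exists2 C : R, 0 <= C &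
  forall w, cn w <= B -> cn (cexp w - 1 - c1 * w) <= C * cn w ^+ 2.
Proof.
move=> B0; have r0 : 0 < 2 * B by rewrite mulr_gt0.
have H : hol_sq (@cexp R) (2 * B) by move=> x y _ _; exact: hol_cexp.
have [K HK] := hol_bounded r0 H; have [c [_ Hc]] := taylor r0 H HK.
have K0 : 0 <= K.
  have h0 : - (2 * B) <= 0 <= 2 * B by rewrite oppr_le0 !(ltW r0).
  have [/(_ _ h0) [h _] _] := HK.
  by rewrite (le_trans (cn_ge0 _) h).
have c0 : c 0%N = 1.
  apply/eqP; rewrite eq_sym -subr_eq0 -cn_eq0; apply/eqP/le_anti; rewrite cn_ge0 andbT.
  have := Hc 0 1%N; rewrite cn0 mul0r expr0n mulr0 mul0r mulr0 big_ord1 expr0 mulr1 cexp0.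
  exact.
exists (c 1%N); exists (2 * (2 * B) * (K / (2 * B) ^+ 2 / B)).
  by rewrite !mulr_ge0 ?invr_ge0 ?exprn_ge0 ?mulr_ge0 // ltW.
move=> w wB; have wr : cn w < 2 * B by move: wB B0; clear; lra.
have := Hc w 2%N wr; rewrite !big_ord_recr big_ord0 /= add0r c0 expr0 mulr1 expr1 opprD addrA.
move=> /le_trans; apply; rewrite -[X in _ <= X]mulrA; apply: ler_wpM2l; first by rewrite mulr_ge0 // ltW.
have P0 : 0 <= K * (cn w ^+ 2 / (2 * B) ^+ 2) by rewrite mulr_ge0 // divr_ge0 // exprn_ge0 ?cn_ge0 // ltW.
rewrite expr_div_n (_ : K / (2 * B) ^+ 2 / B * cn w ^+ 2 = K * (cn w ^+ 2 / (2 * B) ^+ 2) / B); last by ring.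
apply: ler_wpM2l => //.
rewrite lef_pV2 ?posrE ?subr_gt0 //; move: wB; clear; lra.
Qed.

Lemma ln_ratio_bound (n : nat) : (1 < n)%N ->
  [/\ `|ln (n.+1%:R / n%:R)| <= 2 / n%:R :> R, `|ln (n.-1%:R / n%:R)| <= 2 / n%:R :> R &
     `|ln (n.+1%:R / n%:R) + ln (n.-1%:R / n%:R)| <= 2 / n%:R ^+ 2 :> R].
Proof.
case: n => // n n1; rewrite /= -[n.+2%:R]natr1 -[n.+1%:R]natr1 in n1 *.
have : 1 <= n%:R :> R by rewrite ler1n.
set x := n%:R => x1; have x0 : 0 < x by rewrite (lt_le_trans _ x1).
have y0 : 0 < x + 1 by rewrite addr_gt0.
have z0 : 0 < x + 1 + 1 by rewrite addr_gt0.
have e1 : (x + 1 + 1) / (x + 1) = 1 + (x + 1)^-1 by field; rewrite gt_eqF.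
have e2 : ((x / (x + 1))^-1 : R) = 1 + x^-1 by rewrite invf_div; field; rewrite gt_eqF.
have l1 : 0 <= ln ((x + 1 + 1) / (x + 1)) <= 1 / (x + 1).
  rewrite e1 ln_ge0 ?lerDl ?invr_ge0 ?(ltW y0) //= div1r le_ln1Dx //.
  by rewrite (@lt_trans _ _ 0) ?ltrN10 ?invr_gt0.
have l2 : 0 <= - ln (x / (x + 1)) <= 1 / x.
  rewrite -lnV ?posrE ?divr_gt0 // e2 ln_ge0 ?lerDl ?invr_ge0 ?(ltW x0) //= div1r le_ln1Dx //.
  by rewrite (@lt_trans _ _ 0) ?ltrN10 ?invr_gt0.
have i1 : 1 / (x + 1) <= 2 / (x + 1) by rewrite ler_pM2r ?invr_gt0 // ler1n.
have i2 : 1 / x <= 2 / (x + 1).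
  by rewrite ler_pdivrMr // mulrAC ler_pdivlMr //; move: x1; clear; lra.
move: l1 l2 => /andP[l1 l1'] /andP[l2 l2']; split.
- by rewrite ger0_norm // (le_trans l1').
- by rewrite ler0_norm -1?oppr_ge0 // (le_trans l2').
rewrite -lnM ?posrE ?divr_gt0 //.
set q := _ * _; have qE : q^-1 = 1 + (x * (x + 1 + 1))^-1.
  by rewrite /q; field; rewrite !gt_eqF.
have q0 : 0 < q by rewrite !mulr_gt0 ?invr_gt0.
have xz : 0 < (x * (x + 1 + 1))^-1 by rewrite invr_gt0 mulr_gt0.
have lq : 0 <= - ln q <= (x * (x + 1 + 1))^-1.
  rewrite -lnV ?posrE // qE ln_ge0 ?lerDl ?(ltW xz) //= le_ln1Dx //.
  by rewrite (@lt_trans _ _ 0) ?ltrN10.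
move: lq => /andP[h1 h2]; rewrite ler0_norm -1?oppr_ge0 // (le_trans h2) //.
rewrite -[X in X <= _]mul1r ler_pdivrMr ?mulr_gt0 // mulrAC ler_pdivlMr ?exprn_gt0 //.
have : x <= x ^+ 2 by rewrite expr2 ler_peMl // ltW.
by clear -x1; rewrite !expr2; nra.
Qed.

Definition d2pow (n : nat) s : R[i] :=
  natcpow n.+1 (1 - s) - 2 * natcpow n (1 - s) + natcpow n.-1 (1 - s).

(** Factoring out [n^(1-s)] leaves exponentials at [(1 - s) p] and [(1 - s) m] with [p] and [m] of
    order [1/n]. Their quadratic remainders are [O(n^-2)], and so is the sum of the linear parts,
    because [p + m] is the logarithm of [1 - n^-2]. *)
Lemma d2pow_bound (B : R) : 0 < B -> exists2 C, 0 <= C & forall n s, (1 < n)%N ->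
  cn (1 - s) <= B -> cn (d2pow n s) <= C * n%:R `^ (- (1 + complex.Re s)).
Proof.
move=> B0; have [c1 [C C0 HC]] := cexp_linear_bound B0.
exists (C * (2 * B) ^+ 2 * 2 + cn c1 * B * 2).
  by rewrite addr_ge0 ?mulr_ge0 ?exprn_ge0 ?cn_ge0 ?mulr_ge0 // ltW.
move=> n s n1 sB; have [lp lm lpm] := ln_ratio_bound n1.
have n0 : 0 < n%:R :> R by rewrite ltr0n ltnW.
set p := ln (n.+1%:R / n%:R) in lp lpm; set m := ln (n.-1%:R / n%:R) in lm lpm.
have nm0 : 0 < n.-1%:R :> R by rewrite ltr0n; case: (n) n1 => [|[]].
have pE : natcpow n.+1 (1 - s) = natcpow n (1 - s) * cexp ((1 - s) * p%:C).
  rewrite /natcpow -cexpD -mulrDr -rmorphD /p -lnM ?posrE ?divr_gt0 ?ltr0n ?(ltnW n1) //.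
  by rewrite [_ * (_ / _)]mulrC divfK ?[_ + ln _]addrC ?gt_eqF // addrC.
have mE : natcpow n.-1 (1 - s) = natcpow n (1 - s) * cexp ((1 - s) * m%:C).
  rewrite /natcpow -cexpD -mulrDr -rmorphD /m -lnM ?posrE ?divr_gt0 //.
  by rewrite [_ * (_ / _)]mulrC divfK ?[_ + ln _]addrC ?gt_eqF // addrC.
rewrite /d2pow pE mE; set v := natcpow n (1 - s).
set wp := (1 - s) * p%:C; set wm := (1 - s) * m%:C.
have -> : v * cexp wp - 2 * v + v * cexp wm = v * ((cexp wp - 1 - c1 * wp) +
   (cexp wm - 1 - c1 * wm) + c1 * ((1 - s) * (p + m)%:C)).
  by rewrite rmorphD /= /wp /wm; ring.
have n2 : 2 / n%:R <= 1 :> R by rewrite ler_pdivrMr // mul1r ler_nat.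
have cw (l : R) : `|l| <= 2 / n%:R -> cn ((1 - s) * l%:C) <= B * (2 / n%:R).
  by move=> h; rewrite cnM cn_real ler_pM ?cn_ge0.
have cB (l : R) : `|l| <= 2 / n%:R -> cn ((1 - s) * l%:C) <= B.
  by move=> /cw/le_trans; apply; rewrite ler_piMr // ltW.
have hv (l : R) : `|l| <= 2 / n%:R -> cn (cexp ((1 - s) * l%:C) - 1 - c1 * ((1 - s) * l%:C)) <= C * (B * (2 / n%:R)) ^+ 2.
  move=> h; rewrite (le_trans (HC _ (cB _ h))) // ler_wpM2l //.
  by rewrite lerXn2r ?nnegrE ?cn_ge0 ?cw // mulr_ge0 ?divr_ge0 // ltW.
have h3 : cn (c1 * ((1 - s) * (p + m)%:C)) <= cn c1 * (B * (2 / n%:R ^+ 2)).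
  by rewrite !cnM cn_real ler_wpM2l ?cn_ge0 // ler_pM ?cn_ge0.
rewrite cnM cn_natcpow ReD ReN /=.
have -> : (C * (2 * B) ^+ 2 * 2 + cn c1 * B * 2) * n%:R `^ (- (1 + complex.Re s)) =
   expR ((1 - complex.Re s) * ln n%:R) * (C * (B * (2 / n%:R)) ^+ 2 + C * (B * (2 / n%:R)) ^+ 2 +
    cn c1 * (B * (2 / n%:R ^+ 2))).
  rewrite powR_expR // (_ : - (1 + complex.Re s) * ln n%:R = (1 - complex.Re s) * ln n%:R + - (ln n%:R) + - ln n%:R); last by ring.
  by rewrite !expRD expRN lnK ?posrE //; field; rewrite gt_eqF.
apply: ler_wpM2l; first exact: expR_ge0.
by rewrite (le_trans (cnD _ _)) // lerD // (le_trans (cnD _ _)) // lerD // hv.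
Qed.

Section PrimitiveSeries.
Variables (s0 : R) (T : nat -> R).
Hypothesis (HT : moebius_primitive s0 T) (s01 : s0 < 1).

(** The series [sum mu(n) n^(-s)] after summation by parts twice, with [mu(n) / n] as weight and
    [n^(1-s)] as test sequence; index [0] holds the boundary term at [n = 1]. *)
Definition Lterm (k : nat) s : R[i] :=
  if k is 0%N then (T 1%N)%:C * (natcpow 2 (1 - s) - 2 * natcpow 1 (1 - s))
  else (T k.+1)%:C * d2pow k.+1 s.

Lemma hol_Lterm k z : hol (Lterm k) z.
Proof.
have h n : hol (fun s => natcpow n (1 - s)) z.
  by apply: (@hol_natcpow _ n z (fun s => 1 - s)); apply: holB; [exact: hol_cst|exact: hol_id].
case: k => [|k] /=; (apply: holM; first exact: hol_cst).
  by apply: holB => //; apply: holM => //; exact: hol_cst.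
by apply: holD => //; apply: holB => //; apply: holM => //; exact: hol_cst.
Qed.

Lemma Lterm_bound (B : R) : 0 < B -> exists2 C, 0 <= C & forall k s, cn (1 - s) <= B ->
  cn (Lterm k s) <= C * (k.+1%:R `^ (- (1 + complex.Re s)) * `|T k.+1|).
Proof.
move=> B0; have [C C0 HC] := d2pow_bound B0.
exists (C + (expR (B * ln 2) + 2)) => [|k s sB].
  by rewrite addr_ge0 // addr_ge0 // expR_ge0.
case: k => [|k].
  rewrite powR1 mul1r [Lterm _ _]/Lterm cnM cn_real mulrC ler_wpM2r //.
  rewrite (le_trans (cnB _ _)) // [cn (2 * _)]cnM !cn_natcpow ln1 mulr0 expR0 mulr1.
  rewrite -[cn 2](_ : cn (2%:C : R[i]) = _); last by rewrite rmorphMn rmorph1.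
  rewrite cn_real normr_nat.
  have : complex.Re (1 - s) * ln 2 <= B * ln 2.
    by rewrite ler_wpM2r ?ln_ge0 ?ler1n // (le_trans (ler_norm _)) // (le_trans (Re_le_cn _)).
  by rewrite -ler_expR; move: C0; clear; lra.
rewrite /Lterm cnM cn_real mulrA mulrC ler_wpM2r //.
rewrite (le_trans (HC _ _ _ sB)) // ler_wpM2r ?powR_ge0 // lerDl addr_ge0 // expR_ge0.
Qed.

Lemma L_exists : exists L : R[i] -> R[i], forall s, s0 < complex.Re s ->
  csum (Lterm^~ s) (L s) /\ hol L s.
Proof.
have [K K0 HK] := moebius_primitive_bound HT.
(* One majorant for [Re s >= s0 + d] within a disc about [1]. It serves at a single point with
   [d = Re s - s0] and on a neighbourhood with half of that. *)
have bnd (B d : R) : 0 < B -> 0 < d -> exists C, (forall n, \sum_(k < n) (C * k.+1%:R `^ (- (1 + d))) <= C * (1 + d^-1)) /\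
    forall k s, cn (1 - s) <= B -> s0 + d <= complex.Re s ->
    cn (Lterm k s) <= C * k.+1%:R `^ (- (1 + d)).
  move=> B0 d0; have [C C0 HC] := Lterm_bound B0; exists (C * K); split.
    move=> n; rewrite -mulr_sumr ler_wpM2l ?mulr_ge0 //.
    by have := sum_powR_le n d0; rewrite big_add1 big_mkord.
  move=> k s sB sd; rewrite (le_trans (HC k s sB)) // -mulrA ler_wpM2l //.
  rewrite (le_trans (ler_wpM2l (powR_ge0 _ _) (HK _))) // mulrCA ler_wpM2l //.
  by rewrite powRM_exp // powR_mono //; move: sd; clear; lra.
have /choice[L HL] : forall s, exists l, s0 < complex.Re s -> csum (Lterm^~ s) l.
  move=> s; have [sp|sp] := ltP s0 (complex.Re s); last by exists 0.
  have B0 : 0 < cn (1 - s) + 1 by rewrite ltr_wpDl ?cn_ge0.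
  have d0 : 0 < complex.Re s - s0 by rewrite subr_gt0.
  have [C [C1 C2]] := bnd _ _ B0 d0.
  have [|l Hl] := csum_exists (u := Lterm^~ s) (B := fun k => C * k.+1%:R `^ (- (1 + (complex.Re s - s0)))) _ C1; last by exists l.
  by move=> n; apply: C2; [rewrite lerDl|rewrite subrKC].
exists L => s sp; split; first exact: HL.
pose r := (complex.Re s - s0) / 2; have r0 : 0 < r by rewrite divr_gt0 // subr_gt0.
have B0 : 0 < cn (1 - s) + 2 * r by rewrite ltr_wpDl ?cn_ge0 // mulr_gt0.
have [C [C1 C2]] := bnd _ _ B0 r0.
have reE z : `|complex.Re (z - s)| <= r -> s0 + r <= complex.Re z.
  rewrite ReD ReN ler_norml /r => /andP[h _]; move: h; clear; lra.
apply: (@weierstrass _ Lterm L s r _ _ r0 _ _ C1).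
- by move=> n z _ _; exact: hol_Lterm.
- move=> n z zr zi; apply: C2; last exact: reE.
  rewrite (_ : 1 - z = (1 - s) - (z - s)); last by ring.
  rewrite (le_trans (cnB _ _)) // lerD2l (le_trans (cn_le_ReIm _)) //.
  by move: zr zi; clear; lra.
- by move=> z zr _; apply: HL; rewrite (lt_le_trans _ (reE _ zr)) // ltrDl.
Qed.

(** For [Re s >= 3] the boundary terms at the upper end are at most [3 K / (n + 1)], as
    [|T k| <= K k] and [|k^(1-s)| <= k^-2]. *)
Lemma csum_moebius L s : 3 <= complex.Re s -> csum (Lterm^~ s) L ->
  csum (fun n => (moebius n.+1)%:~R * natcpow n.+1 (- s)) L.
Proof.
move=> s3 HL e e0; have [T0 Tw _] := HT.
have [K K0 HK] := moebius_primitive_bound HT.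
have e2 : 0 < e / 2 by rewrite divr_gt0.
have [N HN] := HL _ e2.
pose N' := (Num.truncn (6 * K / e)).+1.
exists (maxn N N').+1 => [[//|n]]; rewrite ltnS geq_max => /andP[Nn N'n].
have sE : \sum_(k < n.+1) (moebius k.+1)%:~R * natcpow k.+1 (- s) =
   \sum_(k < n.+1) Lterm k s + ((T n.+2)%:C * natcpow n.+1 (1 - s) - (T n.+1)%:C * natcpow n.+2 (1 - s)).
  pose w k : R[i] := (moebius k)%:~R / k%:R.
  have := @second_summation R[i] (fun k => (T k)%:C) w (fun k => natcpow k (1 - s)) n.
  rewrite T0 => /(_ erefl) H.
  rewrite big_add1 /= big_mkord in H.
  transitivity (\sum_(i < n.+1) w i.+1 * natcpow i.+1 (1 - s)).
    apply: eq_bigr => k _; rewrite /w /natcpow mulrDl mul1r cexpD cexp_real lnK ?posrE ?ltr0n //.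
    by rewrite rmorph_nat -mulrA mulKf // pnatr_eq0.
  rewrite H; first congr (_ + _).
    by rewrite big_ord_recl /= -(big_mkord xpredT (fun i => Lterm (bump 0 i) s)) !big_add1 /= /bump.
  move=> k; rewrite /w -[in RHS](rmorph_nat (real_complex R)) -(rmorph_int (real_complex R)) -fmorphV -rmorphM /= -Tw.
  by rewrite !rmorphD rmorphN rmorphM /= rmorph_nat.
rewrite sE addrAC (le_trans (cnD _ _)) // [e]splitr lerD //; first by apply: HN; rewrite leqW.
have n1 : 0 < n.+1%:R :> R by rewrite ltr0n.
have n2 : 0 < n.+2%:R :> R by rewrite ltr0n.
have vb k : (0 < k)%N -> cn (natcpow k (1 - s)) <= (k%:R ^+ 2)^-1.
  move=> k0; rewrite cn_natcpow -powR_expR ?ltr0n // -powR_mulrn // -powRN.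
  by apply: powR_mono => //; rewrite ReD ReN /=; lra.
have tb k : (0 < k)%N -> `|T k| <= K * k%:R.
  move=> k0; rewrite (le_trans (HK k)) // ler_wpM2l //.
  by rewrite -[X in _ <= X]powRr1 // powR_mono // ltW.
have b1 : cn ((T n.+2)%:C * natcpow n.+1 (1 - s)) <= K * n.+2%:R * (n.+1%:R ^+ 2)^-1.
  by rewrite cnM cn_real ler_pM ?cn_ge0 ?tb ?vb.
have b2 : cn ((T n.+1)%:C * natcpow n.+2 (1 - s)) <= K * n.+1%:R * (n.+2%:R ^+ 2)^-1.
  by rewrite cnM cn_real ler_pM ?cn_ge0 ?tb ?vb.
have c1 : K * n.+2%:R * (n.+1%:R ^+ 2)^-1 <= 2 * K / n.+1%:R.
  rewrite ler_pdivrMr ?exprn_gt0 // expr2 mulrA divfK ?gt_eqF //.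
  by rewrite [2 * K]mulrC -mulrA ler_wpM2l // -[n.+2%:R]natr1 mulr_natl mulr2n lerD2l ler1n.
have c2 : K * n.+1%:R * (n.+2%:R ^+ 2)^-1 <= K / n.+1%:R.
  rewrite ler_pdivrMr ?exprn_gt0 // mulrAC -mulrA ler_wpM2l // ler_pdivlMr // -expr2.
  by rewrite lerXn2r ?nnegrE // ler_nat.
have c3 : 3 * K / n.+1%:R <= e / 2.
  rewrite ler_pdivrMr // [X in _ <= X]mulrC -ler_pdivrMr // (_ : 3 * K / (e / 2) = 6 * K / e); last by field; rewrite gt_eqF.
  by rewrite ltW // (lt_le_trans (truncnS_gt _)) // ler_nat leqW.
rewrite (le_trans (cnB _ _)) // (le_trans (lerD b1 b2)) // (le_trans (lerD c1 c2)) //.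
by rewrite -mulrDl (_ : 2 * K + K = 3 * K) //; ring.
Qed.

End PrimitiveSeries.

(** Inversion is exact for the truncation [F] of [G]. The neglected pairs have [i j > n + 1], where
    [(i j)^-3 <= (n + 1)^-1 (i j)^-2]; the bound [2] on [sum i^-2], used in both variables, gives
    the [4]. *)
Lemma moebius_inversion_bound (G : nat -> R[i]) n :
  (forall k, (0 < k)%N -> cn (G k) <= (k%:R ^+ 3)^-1) ->
  cn (\sum_(1 <= a < n.+2) (moebius a)%:~R * (\sum_(1 <= m < n.+2) G (a * m)%N) - G 1%N) <= 4 / n.+1%:R.
Proof.
move=> nb; pose F k : R[i] := if (k <= n.+1)%N then G k else 0.
have := @moebius_inversion R[i] F n.+1 isT; rewrite [F 1%N]/F /= => <-; last first.
  by move=> k; rewrite /F ltnNge => /negPf ->.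
rewrite !big_add1 /= !big_mkord -sumrB (le_trans (cn_sum _ _ _)) //.
have n0 : 0 < n.+1%:R :> R by rewrite ltr0n.
apply: (@le_trans _ _ (\sum_(i < n.+1) \sum_(j < n.+1) n.+1%:R^-1 * ((i.+1%:R ^+ 2)^-1 * (j.+1%:R ^+ 2)^-1))).
  apply: ler_sum => i _; rewrite -mulrBr cnM.
  have mu1 : cn ((moebius i.+1)%:~R : R[i]) <= 1.
    rewrite -(rmorph_int (real_complex R)) -[X in cn X]/(_%:C) cn_real -intr_norm -[1]/(1%:~R) ler_int moebius_norm //.
  rewrite (le_trans (ler_wpM2r (cn_ge0 _) mu1)) // mul1r.
  rewrite !big_add1 /= !big_mkord -sumrB (le_trans (cn_sum _ _ _)) //.
  apply: ler_sum => j _; rewrite /F; case: ifP => ij.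
    by rewrite subrr cn0 !mulr_ge0 ?invr_ge0 ?exprn_ge0.
  rewrite subr0 (le_trans (nb _ _)) // natrM exprMn.
  have i0 : 0 < i.+1%:R :> R by rewrite ltr0n.
  have j0 : 0 < j.+1%:R :> R by rewrite ltr0n.
  rewrite -!invfM lef_pV2 ?posrE ?mulr_gt0 ?exprn_gt0 //.
  rewrite -!exprMn [X in _ <= X]exprS ler_wpM2r ?exprn_ge0 ?mulr_ge0 //.
  by rewrite -natrM ler_nat; move/negbT: ij; rewrite -ltnNge => /ltnW.
under eq_bigr do rewrite -mulr_sumr -mulr_sumr.
rewrite -mulr_sumr -mulr_suml mulrC ler_wpM2r ?invr_ge0 ?(ltW n0) //.
have S2 := sum_invsq_le (R := R) n.+1; rewrite big_add1 big_mkord /= in S2.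
rewrite (_ : 4 = 2 * 2); last by ring.
apply: (ler_pM _ _ S2 S2); by apply: sumr_ge0 => i _; rewrite invr_ge0 exprn_ge0.
Qed.

Lemma dirichlet_inverse s L Z : 3 <= complex.Re s ->
  csum (fun n => (moebius n.+1)%:~R * natcpow n.+1 (- s)) L ->
  csum (fun n => natcpow n.+1 (- s)) Z -> L * Z = 1.
Proof.
move=> s3 HL HZ.
pose A n := \sum_(k < n) (moebius k.+1)%:~R * natcpow k.+1 (- s).
pose D n := \sum_(k < n) natcpow k.+1 (- s).
have nb k : (0 < k)%N -> cn (natcpow k (- s)) <= (k%:R ^+ 3)^-1.
  move=> k0; rewrite cn_natcpow -powR_expR ?ltr0n // -powR_mulrn // -powRN.
  by apply: powR_mono => //; rewrite ReN lerN2.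
have AD n : cn (A n.+1 * D n.+1 - 1) <= 4 / n.+1%:R.
  have := moebius_inversion_bound n nb; rewrite [natcpow 1 _](_ : _ = 1); last by rewrite /natcpow ln1 mulr0 cexp0.
  rewrite /A /D !big_add1 /= !big_mkord mulr_suml; congr (cn (_ - _) <= _).
  apply: eq_bigr => i _; rewrite -[RHS]mulrA; congr (_ * _); rewrite big_add1 big_mkord mulr_sumr.
  by apply: eq_bigr => j _; rewrite natcpowM.
apply/eqP; rewrite -subr_eq0; apply/eqP; apply: cn_eq0_le => e e0.
pose K := cn L + cn Z + 1; have K1 : 0 < K by rewrite ltr_wpDl // addr_ge0 // cn_ge0.
have d0 : 0 < Num.min 1 (e / (3 * K)) by rewrite lt_min ltr01 divr_gt0 // mulr_gt0.
set d := Num.min _ _ in d0.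
have d1 : d <= 1 by rewrite ge_min lexx.
have dK : d * K <= e / 3.
  have : d <= e / (3 * K) by rewrite ge_min lexx orbT.
  rewrite -(ler_pM2r K1) => /le_trans; apply.
  by rewrite invfM mulrA divfK // gt_eqF.
have [N1 H1] := HL _ d0; have [N2 H2] := HZ _ d0.
pose N3 := (Num.truncn (12 / e)).+1.
pose n := maxn (maxn N1 N2) N3.
have h1 := H1 n.+1 (leqW (leq_trans (leq_maxl _ _) (leq_maxl _ _))).
have h2 := H2 n.+1 (leqW (leq_trans (leq_maxr _ _) (leq_maxl _ _))).
rewrite -/(A _) in h1; rewrite -/(D _) in h2.
have h3 : cn (A n.+1 * D n.+1 - 1) <= e / 3.
  rewrite (le_trans (AD n)) // ler_pdivrMr ?ltr0n // mulrC -ler_pdivrMr ?divr_gt0 //.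
  rewrite (_ : 4 / (e / 3) = 12 / e); last by field; rewrite gt_eqF.
  by rewrite ltW // (lt_le_trans (truncnS_gt _)) // ler_nat leqW // leq_maxr.
rewrite (_ : L * Z - 1 = (A n.+1 * D n.+1 - 1) - ((A n.+1 - L) * D n.+1 + L * (D n.+1 - Z))); last by ring.
rewrite (le_trans (cnB _ _)) // (le_trans (lerD h3 (cnD _ _))) // !cnM.
have hD : cn (D n.+1) <= cn Z + 1.
  by rewrite -(subrK Z (D n.+1)) (le_trans (cnD _ _)) // addrC lerD2l (le_trans h2).
have q1 : cn (A n.+1 - L) * cn (D n.+1) <= d * (cn Z + 1) by rewrite ler_pM ?cn_ge0.
have q2 : cn L * cn (D n.+1 - Z) <= cn L * d by rewrite ler_wpM2l ?cn_ge0.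
rewrite [X in _ <= X](_ : _ = e / 3 + (e / 3 + e / 3)); last by field.
rewrite lerD2l (le_trans (lerD q1 q2)) //.
have -> : d * (cn Z + 1) + cn L * d = d * K by rewrite /K; ring.
by rewrite (le_trans dK) // lerDl divr_ge0 // ltW.
Qed.

End ReciprocalZeta.

(** * Continuation of the inverse and exclusion of zeros *)

Section RiemannZeta.
Context {R : realType}.
Implicit Types s z : R[i].

(** Balls of [R[i]] have radii in [R[i]]; a positive element there is real, so the radius passes to
    [R]. *)
Lemma riemann_zeta_hol (zeta : R[i] -> R[i]) s : is_riemann_zeta zeta -> s != 1 -> hol zeta s.
Proof.
move=> [H _] /H /cvg_ex[d /cvgrPdist_le Hd]; exists d => e e0.
have eC : 0 < e%:C :> R[i] by rewrite ltcR.
have /nbhs_ballP[r /= r0 Hr] := Hd _ eC.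
have rE : r = (complex.Re r)%:C by rewrite RRe_real // gtr0_real.
have r0' : 0 < complex.Re r by rewrite -ltcR -rE.
exists (complex.Re r) => // h hr; have [->|h0] := eqVneq h 0.
  by rewrite addr0 subrr mulr0 subr0 cn0 mulr0.
have := Hr h; rewrite /ball /= sub0r normrN => /(_ _ h0).
rewrite [X in X < _](_ : _ = (cn h)%:C) // rE ltcR => /(_ hr).
rewrite [X in X <= _](_ : _ = (cn (d - h^-1 * (zeta (h * 1 + s) - zeta s)))%:C) // lecR mulr1.
rewrite (_ : zeta (s + h) - zeta s - d * h = - h * (d - h^-1 * (zeta (h + s) - zeta s))).
  by rewrite cnM cnN => h1; rewrite mulrC ler_wpM2r ?cn_ge0.
by rewrite [s + h]addrC; field.
Qed.

Lemma riemann_zeta_csum (zeta : R[i] -> R[i]) s : is_riemann_zeta zeta -> 1 < complex.Re s ->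
  csum (fun n => natcpow n.+1 (- s)) (zeta s).
Proof.
move=> [_ H] /H /cvgrPdist_le Hs e e0.
have eC : 0 < e%:C :> R[i] by rewrite ltcR.
have [N _ HN] := Hs _ eC; exists N => n Nn.
have := HN n Nn; rewrite [X in X <= _](_ : _ = (cn (zeta s - series (fun n => natcpow n.+1 (- s) : R[i]^o) n))%:C) //.
by rewrite lecR /series /= big_mkord cnBC.
Qed.

(** [F = L * zeta - 1] vanishes for [Re z >= 3] and is continued along a path with a corner: from
    [4 + i y] horizontally to [x + i y], then vertically to [x + i t]. As [|y| >= 2] and [y] has the
    sign of [t], the first part stays away from the pole, and on the second the ordinate never drops
    below [|t|] in modulus. *)
Lemma reciprocal_zeta (zeta : R[i] -> R[i]) (s0 : R) T : is_riemann_zeta zeta -> s0 < 1 ->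
  moebius_primitive s0 T -> exists L, forall s, s0 < complex.Re s ->
    csum (Lterm T ^~ s) (L s) /\ (s != 1 -> L s * zeta s = 1).
Proof.
move=> Hz s01 HT; have [L HL] := L_exists HT.
exists L => s ss; split; [exact: (HL s ss).1|move=> s1].
pose F z := L z * zeta z - 1.
have holF z : s0 < complex.Re z -> complex.Re z != 1 \/ complex.Im z != 0 -> hol F z.
  move=> h1 h2; apply: holB; last exact: hol_cst.
  apply: holM; first exact: (HL z h1).2.
  by apply: riemann_zeta_hol => //; apply/negP => /eqP zE; case: h2; rewrite zE /= eqxx.
have F0 z : 3 <= complex.Re z -> F z = 0.
  move=> z3; rewrite /F (@dirichlet_inverse _ z _ (zeta z)) ?subrr //.
    by apply: (csum_moebius HT) => //; apply: (HL z _).1; rewrite (lt_le_trans s01) // (le_trans _ z3) // ler1n.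
  by apply: riemann_zeta_csum => //; rewrite (lt_le_trans _ z3) // ltr1n.
case: s ss s1 => x t /= ss s1.
have m0 : 0 < Num.max `|x - 1| `|t|.
  rewrite lt_max !normr_gt0 subr_eq0 -negb_and; apply: contra s1 => /andP[/eqP -> /eqP ->] //.
pose y := if 0 <= t then `|t| + 2 else - (`|t| + 2).
set m := Num.max _ _ in m0.
(* [r] keeps the neighbourhood of the path to the right of [s0] and off the pole: on the vertical
   part either the abscissa differs from [1] by [m], or the ordinate is at least [m] in modulus. *)
pose r := Num.min ((x - s0) / 2) (Num.min (1 / 2) (m / 2)).
have r0 : 0 < r by rewrite !lt_min !divr_gt0 // subr_gt0.
have rx : r <= (x - s0) / 2 by rewrite ge_min lexx.
have r1 : r <= 1 / 2 by rewrite !ge_min lexx !orbT.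
have rm : r <= m / 2 by rewrite !ge_min lexx !orbT.
have ny : 2 <= `|y| by rewrite /y; case: ifP => _; rewrite ?normrN ger0_norm ?addr_ge0 // lerDr.
have acc z : (exists2 d, 0 < d & forall u : R, 0 < u < d -> F (z + u%:C) = 0) -> zero_accum F z.
  move=> [d d0 Hd] e e0; exists (Num.min (e / 2) (d / 2))%:C.
  have u0 : 0 < Num.min (e / 2) (d / 2) by rewrite lt_min !divr_gt0.
  split; first by rewrite -cn_gt0 cn_real normr_gt0 gt_eqF.
    by rewrite cn_real gtr0_norm // gt_min ltr_pdivrMr // ltr_pMr // ltr1n.
  by apply: Hd; rewrite u0 /= gt_min [d / 2 < d]ltr_pdivrMr // ltr_pMr // ltr1n orbT.
have step1 h : cn h < r -> F ((x +i* y) + h) = 0.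
  apply: (@identity_segment _ F (4 +i* y) (x +i* y)) => //; last first.
    apply: acc; exists 1 => // u /andP[u0 _]; apply: F0; rewrite ReD /=; move: u0; clear; lra.
  move=> u /andP[u0 u1] z; rewrite !ReD !ImD !ReN !ImN !ReD !ImD !ReM !ImM /=.
  rewrite /= subrr !mulr0 !mul0r subr0 !addr0.
  rewrite !ler_norml => /andP[z1 z2] /andP[z3 z4]; apply: holF; last first.
    right; apply/negP => /eqP zE; rewrite zE sub0r in z3 z4.
    by have : `|y| <= r; [rewrite ler_norml -lerN2 opprK z4 -lerN2 z3|move: ny r1; clear; lra].
  have : 0 <= u * ((x - s0) / 2 - r) by rewrite mulr_ge0 // subr_ge0.
  have : 0 <= (1 - u) * (1 / 2 - r) by rewrite mulr_ge0 // subr_ge0.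
  move: s01 r0 u1 z1; clear=> *; nra.
suff : F ((x +i* t) + 0) = 0 by rewrite addr0 => /eqP; rewrite subr_eq0 => /eqP.
apply: (@identity_segment _ F (x +i* y) (x +i* t) r) => //; last by rewrite cn0.
  move=> u /andP[u0 u1] z; rewrite !ReD !ImD !ReN !ImN !ReD !ImD !ReM !ImM /=.
  rewrite /= subrr !mulr0 !mul0r subr0 !addr0.
  move=> z1 z2; apply: holF; first by move: z1 ss rx r0; rewrite ler_norml => /andP[z1 _]; clear -z1; lra.
  have [h|h] := leP `|t| `|x - 1|.
    left; apply/negP => /eqP zE; rewrite zE distrC in z1.
    by move: rm r0; rewrite /m max_l //; move: z1; clear; lra.
  right; apply/negP => /eqP zE; rewrite zE sub0r normrN in z2.
  have {}rm : r <= `|t| / 2 by move: rm; rewrite /m max_r // ltW.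
  have : `|t| <= `|y + u * (t - y)|.
    rewrite (_ : y + u * (t - y) = (1 - u) * y + u * t); last by ring.
    have v0 : 0 <= 1 - u by rewrite subr_ge0.
    rewrite /y; case: ifPn => ht.
      have -> : `|t| = t by exact: ger0_norm.
      rewrite ger0_norm; last by rewrite addr_ge0 // mulr_ge0 // addr_ge0.
      by have := mulr_ge0 v0 (ler0n R 2); clear; lra.
    have -> : `|t| = - t by apply: ltr0_norm; rewrite ltNge.
    rewrite -normrN ger0_norm; last first.
      by rewrite opprD -!mulrN opprK addr_ge0 // mulr_ge0 // ?addr_ge0 // oppr_ge0 ltW // ltNge.
    by have := mulr_ge0 v0 (ler0n R 2); clear; lra.
  by move: z2 rm r0; clear; lra.
apply: acc; exists r => // u /andP[u0 ur]; apply: step1; by rewrite cn_real gtr0_norm.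
Qed.

Lemma moebius_primitive_no_zero (zeta : R[i] -> R[i]) (s0 : R) T s : is_riemann_zeta zeta -> 0 < s0 -> s0 < 1 ->
  moebius_primitive s0 T -> s != 1 -> zeta s = 0 -> s0 <= complex.Re s -> False.
Proof.
move=> Hz s00 s01 HT s1 zs ss; have [L HL] := reciprocal_zeta Hz s01 HT.
have [d /cderiv_lip [r r0 Hd]] := riemann_zeta_hol Hz s1.
set D := cn d + 1 in Hd; have D0 : 0 < D by rewrite ltr_wpDl ?cn_ge0.
have B0 : 0 < cn (1 - s) + 1 by rewrite ltr_wpDl ?cn_ge0.
have [C C0 HC] := Lterm_bound T B0.
pose K := C * D; have K0 : 0 <= K by rewrite mulr_ge0 // ltW.
(* The product [L * zeta = 1] at [s + e] will be bounded by [eta K (1 + e) + K S e]. With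
   [eta K <= 1/8], [e <= 1] and [e <= 1 / (4 (K S + 1))] this is at most [1/2]. *)
pose eta := (8 * (K + 1))^-1.
have K1 : 0 < K + 1 by rewrite ltr_wpDl.
have eta0 : 0 < eta by rewrite invr_gt0 mulr_gt0.
have [_ _ /(_ _ eta0) [N HN]] := HT.
pose S := \sum_(k < N) `|T k.+1|; have S0 : 0 <= S by rewrite sumr_ge0.
pose e := Num.min (r / 2) (Num.min 1 (Num.min (cn (s - 1) / 2) (4 * (K * S + 1))^-1)).
have KS : 0 < K * S + 1 by rewrite ltr_wpDl // mulr_ge0.
have c0 : 0 < cn (s - 1) by rewrite cn_gt0 subr_eq0.
have e0 : 0 < e by rewrite !lt_min !divr_gt0 // ltr01 invr_gt0 mulr_gt0.
have er : e < r by rewrite (@le_lt_trans _ _ (r / 2)) ?ge_min ?lexx // ltr_pdivrMr // ltr_pMr // ltr1n.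
have e1 : e <= 1 by rewrite !ge_min lexx !orbT.
have es : e < cn (s - 1).
  rewrite (@le_lt_trans _ _ (cn (s - 1) / 2)) ?ge_min ?lexx ?orbT // ltr_pdivrMr // ltr_pMr ?ltr1n //.
have eS : e <= (4 * (K * S + 1))^-1 by rewrite !ge_min lexx !orbT.
have hs : s0 < complex.Re (s + e%:C) by rewrite ReD /= (le_lt_trans ss) // ltrDl.
have [H1 H2] := HL _ hs.
have sE1 : s + e%:C != 1.
  apply/negP => /eqP h; move: es; rewrite (_ : s - 1 = - e%:C) ?cnN ?cn_real ?gtr0_norm ?ltxx //.
  by rewrite -h; ring.
have {H2} H2 := H2 sE1.
have zb : cn (zeta (s + e%:C)) <= D * e.
  by have := Hd e%:C; rewrite zs subr0 cn_real gtr0_norm //; exact.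
have Lb : cn (L (s + e%:C)) <= C * (eta * (1 + e^-1) + S).
  apply: (csum_le H1) => n; rewrite (le_trans (cn_sum _ _ _)) //.
  apply: (@le_trans _ _ (\sum_(k < n) C * (eta * k.+1%:R `^ (- (1 + e)) + if (k < N)%N then `|T k.+1| else 0))).
    apply: ler_sum => k _; rewrite (le_trans (HC k _ _)) //.
      rewrite opprD addrA (le_trans (cnB _ _)) // cn_real gtr0_norm // lerD2l //.
    rewrite ler_wpM2l //; have [kN|Nk] := ltnP k N.
      rewrite -[X in X <= _]add0r lerD //; first by rewrite mulr_ge0 ?powR_ge0 // ltW.
      rewrite ler_piMl // -[X in _ <= X](powRr0 k.+1%:R) powR_mono // oppr_le0 addr_ge0 // ReD /=.
      by rewrite addr_ge0 ?(ltW e0) // (le_trans (ltW s00)).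
    rewrite addr0 (le_trans (ler_wpM2l (powR_ge0 _ _) (HN _ _))) ?(leqW Nk) // mulrCA ler_wpM2l ?(ltW eta0) //.
    rewrite powRM_exp // powR_mono // ReD /=; move: ss; clear; lra.
  rewrite -mulr_sumr ler_wpM2l // big_split /= lerD //.
    rewrite -mulr_sumr ler_wpM2l ?(ltW eta0) //.
    by have := sum_powR_le n e0; rewrite big_add1 big_mkord.
  rewrite -big_mkcond /S /=.
  have -> : \sum_(i < n | (i < N)%N) `|T i.+1| = \sum_(i < n + N | (i < N)%N && (i < n)%N) `|T i.+1|.
    by apply: (big_ord_widen_cond (n + N) (fun k => (k < N)%N) (fun k => `|T k.+1|)); rewrite leq_addr.
  rewrite (big_ord_widen (n + N) (fun k => `|T k.+1|)) ?leq_addl // big_mkcondr /=.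
  by apply: ler_sum => k _; case: ifP.
have H : cn (L (s + e%:C)) * cn (zeta (s + e%:C)) = 1 by rewrite -cnM H2 cn1.
have : 1 <= C * (eta * (1 + e^-1) + S) * (D * e) by rewrite -[X in X <= _]H ler_pM ?cn_ge0.
have -> : C * (eta * (1 + e^-1) + S) * (D * e) = eta * K * (1 + e) + K * S * e.
  by rewrite /K; field; rewrite gt_eqF.
have : eta * K <= 1 / 8.
  by rewrite /eta mulrC ler_pdivrMr ?mulr_gt0 //; clear; lra.
have : K * S * e <= 1 / 4.
  rewrite (le_trans (ler_wpM2l (mulr_ge0 K0 S0) eS)) // ler_pdivrMr ?mulr_gt0 //; clear; lra.
have : 0 <= eta * K by rewrite mulr_ge0 // ltW.
by move: e0 e1; clear => *; nra.
Qed.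

End RiemannZeta.

(** * Finite differences *)

Section RealDerivatives.
Context {R : realType}.
Implicit Types (f g : R -> R) (t v : R).

Lemma eps_deriv_ext f g t v : eps_deriv f t v ->
  (exists2 r, 0 < r & forall h, `|h| < r -> f (t + h) = g (t + h)) -> eps_deriv g t v.
Proof.
move=> F [r r0 E] e /F [s s0 {}F]; exists (Num.min r s); first by rewrite lt_min r0.
move=> h; rewrite lt_min => /andP[hr hs]; rewrite -E // -[g t](_ : f t = _); first exact: F.
by have := E 0; rewrite normr0 addr0 => ->.
Qed.

Lemma eps_deriv_cst c t : eps_deriv (fun=> c) t 0.
Proof. by apply: is_derive_eps_deriv; exact: is_derive_cst. Qed.

Lemma eps_derivD f g t v w : eps_deriv f t v -> eps_deriv g t w ->
  eps_deriv (fun s => f s + g s) t (v + w).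
Proof.
move=> /eps_deriv_is_derive F /eps_deriv_is_derive G; apply: is_derive_eps_deriv.
Qed.

Lemma eps_derivM f g t v w : eps_deriv f t v -> eps_deriv g t w ->
  eps_deriv (fun s => f s * g s) t (f t * w + g t * v).
Proof.
move=> /eps_deriv_is_derive F /eps_deriv_is_derive G; apply: is_derive_eps_deriv.
Qed.

Lemma eps_derivZ c f t v : eps_deriv f t v -> eps_deriv (fun s => c * f s) t (c * v).
Proof.
by move=> F; have := eps_derivM (eps_deriv_cst c t) F; rewrite mulr0 addr0.
Qed.

Lemma eps_derivB f g t v w : eps_deriv f t v -> eps_deriv g t w ->
  eps_deriv (fun s => f s - g s) t (v - w).
Proof.
move=> /eps_deriv_is_derive F /eps_deriv_is_derive G; apply: is_derive_eps_deriv.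
Qed.

Lemma eps_deriv_sum I (r : seq I) (F : I -> R -> R) (dF : I -> R) t :
  (forall i, eps_deriv (F i) t (dF i)) ->
  eps_deriv (fun s => \sum_(i <- r) F i s) t (\sum_(i <- r) dF i).
Proof.
move=> H; elim: r => [|i r IH].
  rewrite big_nil (_ : (fun s => _) = fun=> 0); first exact: eps_deriv_cst.
  by apply/funext => s; rewrite big_nil.
rewrite big_cons (_ : (fun s => _) = fun s => F i s + \sum_(i <- r) F i s).
  exact: eps_derivD.
by apply/funext => s; rewrite big_cons.
Qed.

Lemma eps_deriv_shift f c t v : eps_deriv f (t + c) v -> eps_deriv (fun s => f (s + c)) t v.
Proof. by move=> H e /H[r r0 {}H]; exists r => // h /H; rewrite [t + h + c]addrAC. Qed.

Lemma eps_deriv_id t : eps_deriv id t 1.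
Proof. by apply: is_derive_eps_deriv; exact: is_derive_id. Qed.

Lemma eps_derivX f n t v : eps_deriv f t v ->
  eps_deriv (fun s => f s ^+ n.+1) t (n.+1%:R * f t ^+ n * v).
Proof.
move=> F; elim: n => [|n IH]; first by rewrite expr0 !mul1r.
have := eps_derivM F IH; rewrite (_ : _ + _ = n.+2%:R * f t ^+ n.+1 * v).
  by move=> h; apply: (eps_deriv_ext h); exists 1 => // k _; rewrite [in RHS]exprS.
by rewrite -[n.+2%:R]natr1 exprS; ring.
Qed.

Lemma eps_deriv_comp f g t v w : eps_deriv g t v -> eps_deriv f (g t) w ->
  eps_deriv (fun s => f (g s)) t (w * v).
Proof.
move=> /eps_deriv_is_derive G /eps_deriv_is_derive F; apply: is_derive_eps_deriv.
Qed.

Lemma eps_deriv_cos f t v : eps_deriv f t v -> eps_deriv (fun s => cos (f s)) t (- sin (f t) * v).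
Proof. by move=> F; apply: (eps_deriv_comp F); exact: is_derive_eps_deriv. Qed.

Lemma eps_derivV t : t != 0 -> eps_deriv (fun s => s^-1) t (- t ^- 2).
Proof.
move=> t0; apply: is_derive_eps_deriv.
have := @is_deriveV R id t 1 1 t0 (is_derive_id _ _).
by rewrite /GRing.scale /= mulr1; exact.
Qed.

(** The truncated power [(s)_+^n] of spline theory. *)
Definition tpow (n : nat) (s : R) : R := Num.max s 0 ^+ n.

Lemma tpow_ge n s : 0 <= s -> tpow n s = s ^+ n.
Proof. by move=> s0; rewrite /tpow max_l. Qed.

Lemma tpow_le n s : s <= 0 -> tpow n.+1 s = 0.
Proof. by move=> s0; rewrite /tpow max_r // expr0n. Qed.

Lemma eps_deriv_tpow n t : eps_deriv (tpow n.+2) t (n.+2%:R * tpow n.+1 t).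
Proof.
have [t0|t0|->] := ltgtP t 0.
- rewrite tpow_le ?mulr0; last exact: ltW.
  apply: (eps_deriv_ext (eps_deriv_cst 0 t)); exists (- t); first by rewrite oppr_gt0.
  by move=> h ht; rewrite tpow_le // -lerBrDl sub0r (le_trans (ler_norm _)) // ltW.
- rewrite tpow_ge ?ltW //.
  have := eps_derivX n.+1 (eps_deriv_id t); rewrite mulr1 => H.
  apply: (eps_deriv_ext H); exists t => // h; rewrite ltr_norml => /andP[ht _].
  by rewrite tpow_ge // -lerBlDl sub0r ltW.
rewrite tpow_le // mulr0 => e e0; exists (Num.min 1 e); first by rewrite lt_min ltr01.
move=> h; rewrite lt_min => /andP[h1 he]; rewrite add0r mulr0 [tpow n.+2 0]tpow_le // !subr0.
have hh : `|Num.max h 0| <= `|h|.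
  by have [h0|h0] := leP h 0; rewrite ?normr0.
rewrite /tpow normrX exprS exprS mulrA.
rewrite (@le_trans _ _ (`|h| * `|h| * 1)) //.
  by rewrite ler_pM ?mulr_ge0 ?exprn_ge0 ?ler_pM // exprn_ile1 // (le_trans hh) // ltW.
by rewrite mulr1 ler_wpM2r // ltW.
Qed.

End RealDerivatives.

Section FiniteDifferences.
Context {R : realType}.

Fixpoint fdiff (V : zmodType) (h : R) k (u : R -> V) t : V :=
  if k is k'.+1 then fdiff h k' (fun s => u (s + h) - u s) t else u t.

Lemma fdiff_ext (V : zmodType) h k (u w : R -> V) t :
  (forall i, (i <= k)%N -> u (t + h *+ i) = w (t + h *+ i)) -> fdiff h k u t = fdiff h k w t.
Proof.
elim: k u w => [|k IH] u w H /=; first by have := H 0%N isT; rewrite addr0.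
by apply: IH => i ik /=; rewrite -addrA -mulrSr !H // leqW.
Qed.

Lemma fdiffD (V : zmodType) h k (u w : R -> V) t :
  fdiff h k (fun s => u s + w s) t = fdiff h k u t + fdiff h k w t.
Proof.
elim: k u w => [//|k IH] u w /=; rewrite -IH; apply: fdiff_ext => i _.
by rewrite opprD addrACA.
Qed.

Lemma fdiff0 (V : zmodType) h k t : fdiff h k (fun=> 0 : V) t = 0.
Proof. by elim: k => [//|k IH] /=; rewrite -[RHS]IH; apply: fdiff_ext => i _; rewrite subrr. Qed.

Lemma fdiffZ (V : comNzRingType) h k (c : V) u t :
  fdiff h k (fun s => c * u s) t = c * fdiff h k u t.
Proof.
elim: k u => [//|k IH] u /=; rewrite -IH; apply: fdiff_ext => i _.
by rewrite mulrBr.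
Qed.

Lemma fdiff_sum (V : zmodType) I (r : seq I) (P : pred I) h k (F : I -> R -> V) t :
  fdiff h k (fun s => \sum_(i <- r | P i) F i s) t = \sum_(i <- r | P i) fdiff h k (F i) t.
Proof.
elim: r => [|i r IH].
  by rewrite big_nil -[RHS](@fdiff0 _ h k t); apply: fdiff_ext => j _; rewrite big_nil.
rewrite big_cons; case: ifP => Pi; last first.
  by rewrite -IH; apply: fdiff_ext => j _; rewrite big_cons Pi.
by rewrite -IH -fdiffD; apply: fdiff_ext => j _; rewrite big_cons Pi.
Qed.

Lemma fdiff_shift (V : zmodType) h k (u : R -> V) c t :
  fdiff h k (fun s => u (s + c)) t = fdiff h k u (t + c).
Proof.
elim: k u => [//|k IH] u /=; rewrite -IH; apply: fdiff_ext => i _.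
by rewrite (addrAC _ h).
Qed.

Lemma fdiff_comp (V : zmodType) h k l (u : R -> V) t :
  fdiff h (k + l) u t = fdiff h k (fdiff h l u) t.
Proof.
elim: k u => [//|k IH] u; rewrite addSn /= IH; apply: fdiff_ext => i _.
have N w : fdiff h l (fun s => - w s) (t + h *+ i) = - fdiff h l w (t + h *+ i) :> V.
  apply/eqP; rewrite -addr_eq0 -fdiffD -(@fdiff0 V h l (t + h *+ i)); apply/eqP/fdiff_ext => j _.
  by rewrite addNr.
by rewrite (fdiffD h l (fun s => u (s + h)) (fun s => - u s)) N fdiff_shift.
Qed.

Lemma fdiff_scale (V : zmodType) h d k (u : R -> V) t :
  fdiff h k (fun s => u (s * d)) t = fdiff (h * d) k u (t * d).
Proof.
elim: k u => [//|k IH] u /=; rewrite -IH; apply: fdiff_ext => i _.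
by rewrite mulrDl.
Qed.

Lemma fdiff_bound h k (u : R -> R) t K :
  (forall i, (i <= k)%N -> `|u (t + h *+ i)| <= K) -> `|fdiff h k u t| <= 2 ^+ k * K.
Proof.
elim: k u K => [|k IH] u K H /=; first by have := H 0%N isT; rewrite addr0 expr0 mul1r.
rewrite exprSr -mulrA; apply: IH => i ik /=; rewrite -addrA -mulrSr.
rewrite (le_trans (ler_normB _ _)) // mulr_natl mulr2n lerD // H //; exact: leqW.
Qed.

Lemma fdiff_last (V : zmodType) h k (u : R -> V) t :
  (forall i, (i < k)%N -> u (t + h *+ i) = 0) -> fdiff h k u t = u (t + h *+ k).
Proof.
elim: k u => [|k IH] u H /=; first by rewrite addr0.
rewrite IH; first by rewrite -addrA -mulrSr (H k) // subr0.
by move=> i ik; rewrite -addrA -mulrSr !H ?subr0 // (leq_trans ik).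
Qed.

Lemma fdiff_poly h k m c t : (m < k)%N -> fdiff h k (fun s => (s + c) ^+ m) t = 0.
Proof.
elim: k m c => [//|k IH] m c /= mk.
rewrite (@fdiff_ext _ _ _ _ (fun s => \sum_(i < m) (h ^+ (m - i) *+ 'C(m, i)) * (s + c) ^+ i)).
  rewrite fdiff_sum big1 // => i _; rewrite fdiffZ IH ?mulr0 //.
  by rewrite (leq_trans (ltn_ord i)).
move=> i _; set s := t + _; rewrite addrAC [s + c + h]addrC exprDn big_ord_recr /= subnn expr0 mul1r binn mulr1n addrK.
by apply: eq_bigr => j _; rewrite mulrnAl.
Qed.

(** An exponential is an eigenfunction of the unit difference, with eigenvalue [cexp z - 1]. *)
Lemma fdiff_cexp z k t :
  fdiff 1 k (fun s => cexp (z * s%:C)) t = cexp (z * t%:C) * (cexp z - 1) ^+ k.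
Proof.
elim: k => [|k IH] /=; first by rewrite mulr1.
rewrite (@fdiff_ext _ _ _ _ (fun s => (cexp z - 1) * cexp (z * s%:C))).
  by rewrite fdiffZ IH exprS mulrCA.
by move=> i _; rewrite rmorphD mulrDr cexpD mulr1; ring.
Qed.

(** [us i] plays the [i]-th derivative. The induction is applied to the family
    [us i (s + h) - us i s], and a last mean value theorem to [us k]. *)
Lemma fdiff_MVT h k (us : nat -> R -> R) t : 0 <= h ->
  (forall i s, (i < k)%N -> t <= s <= t + h *+ k -> eps_deriv (us i) s (us i.+1 s)) ->
  exists2 x, t <= x <= t + h *+ k & fdiff h k (us 0%N) t = h ^+ k * us k x.
Proof.
move=> h0; elim: k us => [|k IH] us H /=.
  by exists t; rewrite ?addr0 ?lexx // expr0 mul1r.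
have [|x /andP[tx xt] ->] := IH (fun i s => us i (s + h) - us i s).
  move=> i s ik /andP[ts st]; apply: eps_derivB; last first.
    by apply: H; [exact: leqW|rewrite ts (le_trans st) // mulrSr addrA lerDl].
  apply: eps_deriv_shift; apply: H; first exact: leqW.
  by rewrite (le_trans ts) ?lerDl //= mulrSr addrA lerD2r.
have [|s|c /andP[xc cx] E] := @eps_deriv_MVT _ (us k) (us k.+1) x (x + h).
- by rewrite lerDl.
- move=> /andP[xs sx]; apply: H => //; rewrite (le_trans tx) //= (le_trans sx) //.
  by rewrite mulrSr addrA lerD2r.
exists c; last by rewrite E [x + h]addrC addrK exprSr mulrAC mulrA.
by rewrite (le_trans tx) //= (le_trans cx) // mulrSr addrA lerD2r.
Qed.

End FiniteDifferences.

(** * Sawtooth approximation *)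

Section Fejer.
Context {R : realType}.
Implicit Types (t x : R).

Lemma cos_addn2pi (x : R) n : cos (x + 2 * pi * n%:R) = cos x.
Proof.
elim: n => [|n IH]; first by rewrite mulr0 addr0.
rewrite (_ : x + 2 * pi * n.+1%:R = x + 2 * pi * n%:R + pi *+ 2) ?cosD2pi //.
by rewrite -[n.+1%:R]natr1 -mulr_natl; ring.
Qed.

Lemma dirichlet_kernel (x : R) n :
  sin x * (1 + 2 * \sum_(1 <= j < n.+1) cos (2 * j%:R * x)) = sin ((2 * n%:R + 1) * x).
Proof.
elim: n => [|n IH]; first by rewrite big_geq // !mulr0 addr0 add0r mulr1 mul1r.
rewrite big_nat_recr //=; set S := \sum_(_ <= _ < _) _ in IH *.
rewrite (_ : sin x * _ = sin x * (1 + 2 * S) + 2 * sin x * cos (2 * n.+1%:R * x)); last by ring.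
rewrite IH (_ : (2 * n%:R + 1) * x = 2 * n.+1%:R * x - x); last by rewrite -[n.+1%:R]natr1; ring.
rewrite (_ : (2 * n.+1%:R + 1) * x = 2 * n.+1%:R * x + x); last by ring.
by rewrite [sin (_ - _)]sinB sinD; ring.
Qed.

(** Fejer's identity multiplied by [sin x ^+ 2], so that it also holds where the sine vanishes; the
    sums for [n + 1] and [n] differ by a Dirichlet kernel. *)
Lemma fejer_kernel (x : R) n :
  sin x ^+ 2 * (n%:R + 2 * \sum_(1 <= j < n) (n%:R - j%:R) * cos (2 * j%:R * x)) = sin (n%:R * x) ^+ 2.
Proof.
elim: n => [|n IH]; first by rewrite big_geq // !mulr0 addr0 mulr0 mul0r sin0 expr0n.
have -> : \sum_(1 <= j < n.+1) (n.+1%:R - j%:R) * cos (2 * j%:R * x) =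
   \sum_(1 <= j < n) (n%:R - j%:R) * cos (2 * j%:R * x) + \sum_(1 <= j < n.+1) cos (2 * j%:R * x).
  have -> : \sum_(1 <= j < n) (n%:R - j%:R) * cos (2 * j%:R * x) =
    \sum_(1 <= j < n.+1) (n%:R - j%:R) * cos (2 * j%:R * x).
    case: n {IH} => [|n]; first by rewrite !big_geq.
    by rewrite [in RHS]big_nat_recr //= subrr mul0r addr0.
  by rewrite -big_split; apply: eq_bigr => j _; rewrite -[n.+1%:R]natr1 /=; ring.
have := dirichlet_kernel x n.
set S := \sum_(_ <= _ < _) _ in IH *; set D := \sum_(_ <= _ < _) _ => HD.
rewrite -[n.+1%:R]natr1.
rewrite (_ : sin x ^+ 2 * _ = sin x ^+ 2 * (n%:R + 2 * S) + sin x * (sin x * (1 + 2 * D))); last by ring.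
rewrite IH HD (_ : (2 * n%:R + 1) * x = n%:R * x + (n%:R * x + x)); last by ring.
rewrite mulrDl mul1r !sinD !cosD.
have : cos x ^+ 2 = 1 - sin x ^+ 2 by exact: cos2sin2.
set c := cos x; set s := sin x => h.
by rewrite sqrrD !exprMn h; ring: h.
Qed.

(** The [k]-th derivative of the Fejer mean of [sum_j cos (2 pi j t) / j^m]; each derivative of a
    cosine shifts its phase by [pi / 2]. *)
Definition wsum (n m k : nat) t : R := \sum_(1 <= j < n)
  (1 - j%:R / n%:R) * ((2 * pi * j%:R) ^+ k / j%:R ^+ m * cos (2 * pi * j%:R * t + k%:R * (pi / 2))).

Lemma eps_deriv_wave (A w phi t : R) :
  eps_deriv (fun s => A * cos (w * s + phi)) t (A * (w * cos (w * t + phi + pi / 2))).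
Proof.
apply: eps_derivZ; rewrite cosDpihalf mulrC; apply: eps_deriv_cos.
rewrite -[X in eps_deriv _ _ X]addr0; apply: eps_derivD; last exact: eps_deriv_cst.
by rewrite -[X in eps_deriv _ _ X]mulr1; apply: eps_derivZ; exact: eps_deriv_id.
Qed.

Lemma eps_deriv_wsum n m k t : eps_deriv (wsum n m k) t (wsum n m k.+1 t).
Proof.
apply: eps_deriv_sum => j; apply: eps_derivZ.
have := eps_deriv_wave ((2 * pi * j%:R) ^+ k / j%:R ^+ m) (2 * pi * j%:R) (k%:R * (pi / 2)) t.
rewrite [X in eps_deriv _ _ X -> _](_ : _ = (2 * pi * j%:R) ^+ k.+1 / j%:R ^+ m *
  cos (2 * pi * j%:R * t + k.+1%:R * (pi / 2))) //.
rewrite -[k.+1%:R]natr1 [(_ + 1) * (pi / 2)]mulrDl mul1r [2 * pi * j%:R * t + (_ + _)]addrA exprSr.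
by move: (_ ^+ k) (_ ^- m) (cos _) => a b c; ring.
Qed.

(** The series [sum_j cos (2 pi j t) / j^2] has second derivative [2 pi^2] off the integers. Its
    Fejer mean deviates from this by a multiple of the Fejer kernel, nonnegative and [O(1/n)]
    there. *)
Lemma wsum_second n t : (0 < n)%N ->
  wsum n 2 2 t = 2 * pi ^+ 2 - 2 * pi ^+ 2 / n%:R *
   (n%:R + 2 * \sum_(1 <= j < n) (n%:R - j%:R) * cos (2 * j%:R * (pi * t))).
Proof.
move=> n0; rewrite mulrDr divfK ?pnatr_eq0 -?lt0n // opprD addrA subrr add0r.
rewrite mulrA !mulr_sumr -sumrN /wsum; rewrite !big_nat; apply: eq_bigr => j /andP[j0 _].
rewrite (_ : 2 * (pi / 2) = pi); last by field.
rewrite cosDpi (_ : 2 * pi * j%:R * t = 2 * j%:R * (pi * t)); last by ring.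
by field; rewrite !pnatr_eq0 -!lt0n n0.
Qed.

Lemma wsum_second_bound n t : (0 < n)%N -> 0 < t < 1 ->
  0 <= 2 * pi ^+ 2 - wsum n 2 2 t <= 2 * pi ^+ 2 / (n%:R * sin (pi * t) ^+ 2).
Proof.
move=> n0 /andP[t0 t1]; rewrite wsum_second // opprB addrCA subrr addr0.
have np : 0 < n%:R :> R by rewrite ltr0n.
have s0 : 0 < sin (pi * t) by rewrite sin_gt0_pi // mulr_gt0 ?pi_gt0 //= gtr_pMr // pi_gt0.
have p0 : 0 < 2 * pi ^+ 2 :> R by rewrite mulr_gt0 // exprn_gt0 // pi_gt0.
have := fejer_kernel (pi * t) n; set A := _ + _ => h.
have -> : A = sin (n%:R * (pi * t)) ^+ 2 / sin (pi * t) ^+ 2.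
  by rewrite -h mulrC mulKf // expf_neq0 // gt_eqF.
apply/andP; split; first by rewrite mulr_ge0 ?divr_ge0 ?sqr_ge0 // ltW.
rewrite (invfM n%:R) [X in X <= _]mulrA [X in _ <= X]mulrA.
apply: ler_wpM2r; first by rewrite invr_ge0 sqr_ge0.
rewrite ler_piMr ?divr_ge0 ?(ltW p0) ?(ltW np) //.
Qed.

Lemma wsum_second0 n : (0 < n)%N -> wsum n 2 2 0 <= 2 * pi ^+ 2.
Proof.
move=> n0; rewrite wsum_second // gerBl mulr_ge0 //.
  by rewrite divr_ge0 // mulr_ge0 // exprn_ge0 // pi_ge0.
rewrite addr_ge0 // mulr_ge0 // big_nat sumr_ge0 // => j /andP[_ jn].
by rewrite !mulr0 cos0 mulr1 subr_ge0 ler_nat ltnW.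
Qed.

Lemma wsum_first0 n : wsum n 2 1 0 = 0.
Proof. by rewrite /wsum big1 // => j _; rewrite mulr0 add0r mul1r cos_pihalf !mulr0. Qed.

Lemma wsum_first_half n : wsum n 2 1 (2^-1) = 0.
Proof.
rewrite /wsum big1 // => j _; rewrite mul1r cosDpihalf.
rewrite (_ : 2 * pi * j%:R / 2 = pi * j%:R); last by field.
suff -> : sin (pi * j%:R) = 0 :> R by rewrite oppr0 !mulr0.
elim: j => [|j IH]; first by rewrite mulr0 sin0.
by rewrite -natr1 mulrDr mulr1 sinDpi IH oppr0.
Qed.

(* [t |-> wsum n 2 0 t - pi^2 t^2] is concave with derivative [0] at [0] and [- pi^2] at [1/2],
   and its second derivative is small away from [0]. *)
Lemma wsum_half n d t : (0 < n)%N -> 0 < d <= 2^-1 -> 0 <= t <= 2^-1 ->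
  `|wsum n 2 0 t - pi ^+ 2 * (t ^+ 2 - t) - wsum n 2 0 0| <=
  pi ^+ 2 * d + pi ^+ 2 / (n%:R * sin (pi * d) ^+ 2).
Proof.
move=> n0 /andP[d0 d2] /andP[t0 t2].
have h0 : (0 : R) <= 2^-1 by rewrite invr_ge0.
have half1 : (2^-1 : R) < 1 by rewrite invf_lt1 // ltr1n.
pose q s := wsum n 2 0 s - pi ^+ 2 * (s ^+ 2 - s).
pose q1 s := wsum n 2 1 s - pi ^+ 2 * (2 * s - 1).
pose q2 s := wsum n 2 2 s - 2 * pi ^+ 2.
have Dq s : eps_deriv q s (q1 s).
  apply: eps_derivB; first exact: eps_deriv_wsum.
  apply: eps_derivZ; apply: eps_derivB; last exact: eps_deriv_id.
  by have := eps_derivX 1 (eps_deriv_id s); rewrite expr1 mulr1.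
have Dq1 s : eps_deriv q1 s (q2 s).
  apply: eps_derivB; first exact: eps_deriv_wsum.
  rewrite mulrC; apply: eps_derivZ; rewrite -[X in eps_deriv _ _ X]subr0.
  apply: eps_derivB; last exact: eps_deriv_cst.
  by rewrite -[X in eps_deriv _ _ X]mulr1; apply: eps_derivZ; exact: eps_deriv_id.
have q2le s : 0 <= s <= 2^-1 -> q2 s <= 0.
  move=> /andP[s0 s2]; rewrite subr_le0; have [->|sn] := eqVneq s 0; first exact: wsum_second0.
  have : 0 < s < 1 by rewrite lt_def sn s0 (le_lt_trans s2).
  by move=> /(wsum_second_bound n0) /andP[]; rewrite subr_ge0.
have q10 : q1 0 = pi ^+ 2 by rewrite /q1 wsum_first0; ring.
have q1h : q1 2^-1 = 0 by rewrite /q1 wsum_first_half mulfV // subrr mulr0 subrr.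
have q1b s : 0 <= s <= 2^-1 -> 0 <= q1 s <= pi ^+ 2.
  move=> /andP[s0 s2]; apply/andP; split.
    have [//|c /andP[c1 c2]] := @eps_deriv_MVT _ q1 q2 s 2^-1 s2.
    rewrite q1h sub0r => E; rewrite -oppr_le0 E mulr_le0_ge0 ?subr_ge0 // q2le // c2 andbT.
    exact: le_trans c1.
  have [//|c /andP[c1 c2]] := @eps_deriv_MVT _ q1 q2 0 s s0.
  rewrite q10 subr0 => E; rewrite -subr_le0 E mulr_le0_ge0 // q2le // c1 /=; exact: le_trans s2.
have -> : wsum n 2 0 t - pi ^+ 2 * (t ^+ 2 - t) - wsum n 2 0 0 = q t - q 0.
  by rewrite /q expr0n /= subrr mulr0 subr0.
have np : 0 < n%:R :> R by rewrite ltr0n.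
have pd (s : R) : 0 < s -> s <= 2^-1 -> 0 < sin (pi * s).
  by move=> s0 s2; rewrite sin_gt0_pi // mulr_gt0 ?pi_gt0 //= gtr_pMr ?pi_gt0 // (le_lt_trans s2).
have e0 : 0 <= pi ^+ 2 / (n%:R * sin (pi * d) ^+ 2) :> R.
  by rewrite divr_ge0 ?exprn_ge0 ?pi_ge0 // mulr_ge0 ?exprn_ge0 // ltW // pd.
have near0 s : 0 <= s -> s <= d -> 0 <= q s - q 0 <= pi ^+ 2 * d.
  move=> s0 sd; have [//|c /andP[c1 c2] ->] := @eps_deriv_MVT _ q q1 0 s s0.
  have /andP[h1 h2] : 0 <= q1 c <= pi ^+ 2 by apply: q1b; rewrite c1 (le_trans c2) // (le_trans sd).
  by rewrite subr0 mulr_ge0 // ler_pM.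
have [td|dt] := leP t d.
  by have /andP[h1 h2] := near0 t t0 td; rewrite ger0_norm // (le_trans h2) // lerDl.
have /andP[h1 h2] := near0 d (ltW d0) (lexx d).
have [//|c /andP[c1 c2] E] := @eps_deriv_MVT _ q q1 d t (ltW dt).
have c3 : c <= 2^-1 := le_trans c2 t2.
have /andP[k1 _] : 0 <= q1 c <= pi ^+ 2 by apply: q1b; rewrite c3 (le_trans (ltW d0)).
have k2 : q1 c <= 2 * pi ^+ 2 / (n%:R * sin (pi * d) ^+ 2).
  have [//|x /andP[x1 x2]] := @eps_deriv_MVT _ q1 q2 c 2^-1 c3.
  rewrite q1h sub0r => Ex; have -> : q1 c = - q2 x * (2^-1 - c) by rewrite mulNr -Ex opprK.
  have dx : d <= x := le_trans c1 x1.
  have x0 : 0 < x := lt_le_trans d0 dx.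
  have : 0 < x < 1 by rewrite x0 (le_lt_trans x2).
  move=> /(wsum_second_bound n0)/andP[b1 b2]; rewrite -opprB -/(q2 x) in b1 b2.
  rewrite (@le_trans _ _ (- q2 x)) //.
    rewrite ler_piMr // lerBlDr (le_trans (ltW half1)) // lerDl (le_trans (ltW d0)) //.
  rewrite (le_trans b2) // ler_pM2l ?mulr_gt0 ?exprn_gt0 ?pi_gt0 //.
  rewrite lef_pV2 ?posrE ?mulr_gt0 ?exprn_gt0 ?pd // ler_pM2l // lerXn2r ?nnegrE ?(ltW (pd _ _ _)) //.
  have pi2 : 0 < pi :> R := pi_gt0 R.
  have io (s : R) : 0 < s -> s <= 2^-1 -> pi * s \in `[- (pi / 2), pi / 2].
    move=> s0 s2; rewrite in_itv /= ler_pM2l // s2 andbT.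
    by rewrite (@le_trans _ _ 0) ?mulr_ge0 ?ltW // oppr_lt0 divr_gt0.
  by rewrite leNgt ltr_sin ?io // ltr_pM2l // -leNgt.
have -> : q t - q 0 = (q d - q 0) + q1 c * (t - d) by rewrite -E; ring.
have td0 : 0 <= t - d by rewrite subr_ge0 ltW.
rewrite ger0_norm; last by rewrite addr_ge0 // mulr_ge0.
rewrite lerD // (@le_trans _ _ (q1 c * 2^-1)) //.
  by rewrite ler_wpM2l // lerBlDr (le_trans t2) // lerDl ltW.
by rewrite ler_pdivrMr // (le_trans k2) // [X in _ <= X]mulrC [X in _ <= X]mulrA.
Qed.

Lemma wsum_symmetric n t : wsum n 2 0 (1 - t) = wsum n 2 0 t.
Proof.
apply: eq_bigr => j _; rewrite mul0r !addr0 -[cos (2 * pi * j%:R * t)]cosN.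
by rewrite -[cos (- _)](cos_addn2pi _ j) (_ : 2 * pi * j%:R * (1 - t) = - (2 * pi * j%:R * t) + 2 * pi * j%:R) //; ring.
Qed.

Lemma wsum_periodic n t : wsum n 2 0 (t + 1) = wsum n 2 0 t.
Proof.
apply: eq_bigr => j _; rewrite mul0r !addr0 -[cos (2 * pi * j%:R * t)](cos_addn2pi _ j).
by rewrite (_ : 2 * pi * j%:R * (t + 1) = 2 * pi * j%:R * t + 2 * pi * j%:R) //; ring.
Qed.

Lemma wsum_unit e : 0 < e -> exists2 N, (0 < N)%N & forall n t, (N <= n)%N -> 0 <= t <= 1 ->
  `|wsum n 2 0 t - pi ^+ 2 * (t ^+ 2 - t) - wsum n 2 0 0| <= e.
Proof.
move=> e0; have pi0 : 0 < pi ^+ 2 :> R by rewrite exprn_gt0 // pi_gt0.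
pose d : R := Num.min 2^-1 (e / (2 * pi ^+ 2)).
have d0 : 0 < d by rewrite lt_min invr_gt0 ltr0n divr_gt0 // mulr_gt0.
have d2 : d <= 2^-1 by rewrite ge_min lexx.
have de : pi ^+ 2 * d <= e / 2.
  have : d <= e / (2 * pi ^+ 2) by rewrite ge_min lexx orbT.
  rewrite (ler_pdivlMr _ _ (mulr_gt0 (ltr0n _ 2) pi0)) => h; rewrite ler_pdivlMr // (_ : _ * d * 2 = d * (2 * pi ^+ 2)) //.
  by rewrite mulrAC mulrC [_ * 2]mulrC.
have s0 : 0 < sin (pi * d).
  rewrite sin_gt0_pi // mulr_gt0 ?pi_gt0 //= gtr_pMr ?pi_gt0 // (le_lt_trans d2) //.
  by rewrite invf_lt1 // ltr1n.
pose K := pi ^+ 2 / sin (pi * d) ^+ 2; have K0 : 0 < K by rewrite divr_gt0 // exprn_gt0.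
exists (Num.truncn (K * 2 / e)).+1 => // n t Nn /andP[t0 t1].
have n0 : (0 < n)%N by rewrite (leq_trans _ Nn).
have ne : pi ^+ 2 / (n%:R * sin (pi * d) ^+ 2) <= e / 2.
  rewrite invfM mulrCA -/K mulrC ler_pdivrMr ?ltr0n // mulrC -ler_pdivrMr ?divr_gt0 //.
  by rewrite invf_div mulrA ltW // (lt_le_trans (truncnS_gt _)) // ler_nat.
have bd : pi ^+ 2 * d + pi ^+ 2 / (n%:R * sin (pi * d) ^+ 2) <= e by rewrite [e]splitr lerD.
have [th|th] := leP t 2^-1; first by apply: le_trans bd; apply: wsum_half; rewrite ?d0 ?t0.
rewrite -wsum_symmetric (_ : t ^+ 2 - t = (1 - t) ^+ 2 - (1 - t)); last by ring.
apply: le_trans bd; apply: wsum_half; rewrite ?d0 // subr_ge0 t1 /= lerBlDr -lerBlDl.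
by rewrite (_ : 1 - 2^-1 = 2^-1 :> R) ?ltW //; field.
Qed.

Lemma tpow_step (t : R) M : 1 <= t -> t <= M.+1%:R ->
  \sum_(1 <= m < M.+1) tpow 1 (t - m%:R) = \sum_(1 <= m < M.+1) tpow 1 (t - 1 - m%:R) + (t - 1).
Proof.
move=> t1 tM; have E : \sum_(1 <= m < M.+2) tpow 1 (t - m%:R) =
    tpow 1 (t - 1) + \sum_(1 <= m < M.+1) tpow 1 (t - 1 - m%:R).
  rewrite big_ltn // big_add1 /=; congr (_ + _); apply: eq_bigr => m _.
  by rewrite -[m.+1%:R]natr1 opprD addrA addrAC.
have : \sum_(1 <= m < M.+2) tpow 1 (t - m%:R) = \sum_(1 <= m < M.+1) tpow 1 (t - m%:R).
  by rewrite big_nat_recr //= tpow_le ?addr0 // subr_le0.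
move=> <-; rewrite E addrC tpow_ge ?expr1 //; by rewrite subr_ge0.
Qed.

(** The periodic parabola [{t}^2 - {t}] equals [t^2 - t - 2 sum_m (t - m)_+], so the estimate on the
    unit interval passes to [[0, M]] by unit steps. The additive constant stays as [wsum n 2 0 0],
    for differences to remove. *)
Lemma wsum_sawtooth e M : 0 < e -> exists2 N, (0 < N)%N & forall n t, (N <= n)%N -> 0 <= t <= M%:R ->
  `|wsum n 2 0 t + 2 * pi ^+ 2 * \sum_(1 <= m < M.+1) tpow 1 (t - m%:R)
   - pi ^+ 2 * (t ^+ 2 - t) - wsum n 2 0 0| <= e.
Proof.
move=> e0; have [N N0 HN] := wsum_unit e0; exists N => // n t Nn tM.
suff H k s : 0 <= s <= M%:R -> s <= k.+1%:R ->
  `|wsum n 2 0 s + 2 * pi ^+ 2 * \sum_(1 <= m < M.+1) tpow 1 (s - m%:R)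
   - pi ^+ 2 * (s ^+ 2 - s) - wsum n 2 0 0| <= e.
  by apply: (H M) => //; case/andP: tM => _ /le_trans; apply; rewrite ler_nat.
elim: k s => [|k IH] s /andP[s0 sM] sk.
  rewrite big_nat big1 ?mulr0 ?addr0; first by apply: HN; rewrite ?s0.
  by move=> m /andP[m1 _]; rewrite tpow_le // subr_le0 (le_trans sk) // ler_nat.
have [s1|s1] := leP s 1.
  rewrite big_nat big1 ?mulr0 ?addr0; first by apply: HN; rewrite ?s0.
  by move=> m /andP[m1 _]; rewrite tpow_le // subr_le0 (le_trans s1) // ler1n.
have := IH (s - 1); rewrite subr_ge0 (ltW s1) /= lerBlDr => /(_ _ _)/=.
rewrite (le_trans sM) ?lerDl // => /(_ isT); rewrite lerBlDr natr1 => /(_ sk).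
rewrite (@tpow_step s M (ltW s1)) ?(le_trans sM) ?ler_nat //.
have -> : wsum n 2 0 s = wsum n 2 0 (s - 1) by rewrite -(wsum_periodic n (s - 1)) subrK.
set S := \sum_(_ <= _ < _) _; set w := wsum _ _ _ _; set w0 := wsum _ _ _ 0.
congr (_ <= _); congr Num.norm; ring.
Qed.

End Fejer.

(** * A bump and its Fourier expansion *)

Section TruncatedPowerComb.
Context {R : realType}.
Implicit Types (t y : R).

(** Four derivatives turn [kap cos (2 pi j t) / j^6] into [(60 / pi^2) cos (2 pi j t) / j^2], and
    [(60 / pi^2) * 2 pi^2 = 120] matches the fourth derivative [120 (t - m)_+] of [(t - m)_+^5]. *)
Definition kap : R := 60 / (pi ^+ 2 * (2 * pi) ^+ 4).

Lemma kap_gt0 : 0 < kap.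
Proof. by rewrite divr_gt0 // mulr_gt0 ?exprn_gt0 ?mulr_gt0 ?pi_gt0. Qed.

Lemma eps_deriv_fdiff h k (u u1 : R -> R) t : (forall s, eps_deriv u s (u1 s)) ->
  eps_deriv (fdiff h k u) t (fdiff h k u1 t).
Proof.
elim: k u u1 => [|k IH] u u1 H //=; apply: (IH _ (fun s => u1 (s + h) - u1 s)) => s.
by apply: eps_derivB => //; exact: eps_deriv_shift.
Qed.

(** Four of the eight differences become derivatives by the mean value theorem, as many as the
    truncated fifth power admits at its kinks. The fourth derivative is a quadratic polynomial up to
    a small error, and the other four differences annihilate that polynomial. *)
Lemma fejer_limit (h t : R) M e : 0 <= h -> 0 <= t -> t + h *+ 8 <= M%:R -> 0 < e ->
  exists2 N, (0 < N)%N & forall n, (N <= n)%N ->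
  `|fdiff h 8 (fun s => \sum_(1 <= m < M.+1) tpow 5 (s - m%:R) + kap * wsum n 6 0 s) t| <= e.
Proof.
move=> h0 t0 tM e0; have pi0 : 0 < pi :> R := pi_gt0 R.
have pi2 : 0 < pi ^+ 2 :> R by rewrite exprn_gt0.
have q0 : 0 < 60 / pi ^+ 2 :> R by rewrite divr_gt0.
pose C := h ^+ 4 * (2 ^+ 4 * (60 / pi ^+ 2)) + 1.
have C0 : 0 < C by rewrite ltr_wpDl // mulr_ge0 ?exprn_ge0 // mulr_ge0 // ltW.
have [N N0 HN] := wsum_sawtooth M (divr_gt0 e0 C0); exists N => // n Nn.
have n0 : (0 < n)%N := leq_trans N0 Nn.
pose us k s : R := (5 ^_ k)%:R * (\sum_(1 <= m < M.+1) tpow (5 - k) (s - m%:R)) + kap * wsum n 6 k s.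
have Dus k s : (k < 4)%N -> eps_deriv (us k) s (us k.+1 s).
  move=> k4; apply: eps_derivD; last exact/eps_derivZ/eps_deriv_wsum.
  rewrite ffactnSr natrM -mulrA; apply: eps_derivZ; rewrite mulr_sumr.
  apply: eps_deriv_sum => m; apply: eps_deriv_shift.
  by case: k k4 => [|[|[|[|]]]] // _; exact: eps_deriv_tpow.
have us4 s : us 4%N s = 60 / pi ^+ 2 * (wsum n 2 0 s + 2 * pi ^+ 2 * \sum_(1 <= m < M.+1) tpow 1 (s - m%:R)).
  rewrite /us; have -> : wsum n 6 4 s = (2 * pi) ^+ 4 * wsum n 2 0 s.
    rewrite mulr_sumr /wsum !big_nat; apply: eq_bigr => j /andP[j0 _].
    have -> : cos (2 * pi * j%:R * s + 4 * (pi / 2)) = cos (2 * pi * j%:R * s).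
      by rewrite -[RHS](cos_addn2pi _ 1) mulr1; congr cos; congr (_ + _); field.
    rewrite mul0r addr0 expr0; field; by rewrite !pnatr_eq0 -!lt0n j0 n0.
  rewrite /kap (_ : (5 ^_ 4)%:R = 120 :> R) //.
  rewrite -[(5 - 4)%N]/1%N.
  have X0 : (2 * pi) ^+ 4 != 0 :> R by rewrite expf_neq0 // mulf_neq0 // gt_eqF.
  have P0 : pi ^+ 2 != 0 :> R by rewrite gt_eqF.
  move: X0 P0 (\sum_(_ <= _ < _) _) (wsum _ _ _ _).
  by move: (pi ^+ 2) ((2 * pi) ^+ 4) => P X X0 P0 S w; field; rewrite X0 P0.
rewrite (@fdiff_ext _ _ _ _ _ (us 0%N)); last by move=> i _; rewrite /us mul1r.
rewrite -[8%N]/(4 + 4)%N fdiff_comp.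
have [|x /andP[x1 x2] ->] := @fdiff_MVT _ h 4 (fun k s => fdiff h 4 (us k) s) t h0.
  by move=> i s i4 _; apply: eps_deriv_fdiff => z; exact: Dus.
pose V (s : R) := wsum n 2 0 s + 2 * pi ^+ 2 * \sum_(1 <= m < M.+1) tpow 1 (s - m%:R)
   - pi ^+ 2 * (s ^+ 2 - s) - wsum n 2 0 0.
rewrite (@fdiff_ext _ _ _ _ _ (fun s => (60 / pi ^+ 2 * V s + 60 * (s + 0) ^+ 2) +
    (- 60 * (s + 0) ^+ 1 + (60 / pi ^+ 2 * wsum n 2 0 0) * (s + 0) ^+ 0))); last first.
  move=> i _; rewrite us4 /V !addr0; set s := x + _; set S := \sum_(_ <= _ < _) _.
  have P0 : pi ^+ 2 != 0 :> R by rewrite gt_eqF.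
  by move: P0 (wsum _ _ _ s) (wsum _ _ _ 0) S; move: (pi ^+ 2) => P P0 w w0 S; field.
set c := _ * wsum n 2 0 0.
have -> : fdiff h 4 (fun s => (60 / pi ^+ 2 * V s + 60 * (s + 0) ^+ 2) +
    (- 60 * (s + 0) ^+ 1 + c * (s + 0) ^+ 0)) x = 60 / pi ^+ 2 * fdiff h 4 V x.
  transitivity ((60 / pi ^+ 2 * fdiff h 4 V x + 60 * fdiff h 4 (fun s => (s + 0) ^+ 2) x) +
    (- 60 * fdiff h 4 (fun s => (s + 0) ^+ 1) x + c * fdiff h 4 (fun s => (s + 0) ^+ 0) x)).
    by rewrite -!fdiffZ -!fdiffD.
  by rewrite !fdiff_poly // !mulr0 !addr0.
rewrite [`|h ^+ 4 * _|]normrM (ger0_norm (exprn_ge0 _ h0)) [`|_ * fdiff _ _ _ _|]normrM (gtr0_norm q0).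
have bV : `|fdiff h 4 V x| <= 2 ^+ 4 * (e / C).
  apply: fdiff_bound => i i4; apply: HN => //.
  apply/andP; split; first by rewrite addr_ge0 ?mulrn_wge0 // (le_trans t0).
  rewrite (le_trans _ tM) //.
  rewrite (@le_trans _ _ (t + h *+ 4 + h *+ i)) ?lerD2r // -addrA lerD2l -mulrnDr.
  by rewrite -[h *+ 8]mulr_natr -[h *+ _]mulr_natr ler_wpM2l // ler_nat -[8%N]/(4 + 4)%N leq_add2l.
rewrite (@le_trans _ _ (h ^+ 4 * (60 / pi ^+ 2 * (2 ^+ 4 * (e / C))))) //.
  by rewrite ler_wpM2l ?exprn_ge0 // ler_wpM2l // ltW.
rewrite (_ : _ * _ = h ^+ 4 * (2 ^+ 4 * (60 / pi ^+ 2)) * e / C); last by ring.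
by rewrite ler_pdivrMr // mulrC ler_wpM2l ?(ltW e0) // /C lerDl.
Qed.

Definition nodes (V : zmodType) (u : R -> V) : V := fdiff 1 8 u 9.

(* A bump supported in [9, 17], equal to [(17 - v)^5] on [16, 17]. *)
Definition bump (v : R) : R := nodes (fun s => tpow 5 (s - v)).

Definition comb M y : R := \sum_(1 <= m < M.+1) bump (m%:R * y).

Definition cosum J t : R := \sum_(1 <= j < J.+1) cos (2 * pi * j%:R * t) / j%:R ^+ 6.

(** Dropping the Fejer weights costs [sum_j (j / n) j^-6] and the tail beyond [J]; both are
    controlled by [sum j^-2 <= 2]. *)
Lemma cosum_wsum n J t : (0 < J)%N -> (J < n)%N -> `|cosum J t - wsum n 6 0 t| <= 2 / n%:R + 2 / J%:R.
Proof.
move=> J0 Jn; rewrite /wsum (big_cat_nat (n := J.+1)) //= opprD addrA -sumrB.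
have n0 : 0 < n%:R :> R by rewrite ltr0n (leq_ltn_trans _ Jn).
have JJ : 0 < J%:R :> R by rewrite ltr0n.
have c1 x : `|cos x| <= 1 :> R by rewrite ler_norml cos_geN1 cos_le1.
have inv6 (j : nat) : (0 < j)%N -> (j%:R ^+ 6)^-1 <= j%:R^-1 * (j%:R ^+ 2)^-1 :> R.
  move=> j0; have j1 : 1 <= j%:R :> R by rewrite ler1n.
  have j2 : 0 < j%:R :> R by rewrite ltr0n.
  rewrite -invfM lef_pV2 ?posrE ?mulr_gt0 ?exprn_gt0 // -exprS; exact: ler_weXn2l.
rewrite (le_trans (ler_normB _ _)) // lerD //.
  rewrite (le_trans (ler_norm_sum _ _ _)) //.
  apply: (@le_trans _ _ (\sum_(1 <= j < J.+1) n%:R^-1 * (j%:R ^+ 2)^-1)).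
    rewrite !big_nat; apply: ler_sum => j /andP[j0 _]; rewrite mul0r addr0 expr0 mul1r.
    have j2 : 0 < j%:R :> R by rewrite ltr0n.
    rewrite (_ : _ - _ = cos (2 * pi * j%:R * t) * (n%:R^-1 * (j%:R * (j%:R ^+ 6)^-1))); last by ring.
    have p0 : 0 <= n%:R^-1 * (j%:R * (j%:R ^+ 6)^-1) :> R.
      by rewrite mulr_ge0 ?invr_ge0 ?(ltW n0) // mulr_ge0 ?(ltW j2) // invr_ge0 exprn_ge0 // ltW.
    rewrite normrM (ger0_norm p0) (le_trans (ler_wpM2r p0 (c1 _))) // mul1r ler_wpM2l ?invr_ge0 ?(ltW n0) //.
    by rewrite (le_trans (ler_wpM2l (ltW j2) (inv6 _ j0))) // mulrA mulfV ?mul1r // gt_eqF.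
  by rewrite -mulr_sumr mulrC ler_wpM2r ?invr_ge0 ?(ltW n0) // sum_invsq_le.
rewrite (le_trans (ler_norm_sum _ _ _)) //.
apply: (@le_trans _ _ (\sum_(J.+1 <= j < n) J%:R^-1 * (j%:R ^+ 2)^-1)).
  rewrite !big_nat; apply: ler_sum => j /andP[Jj jn]; rewrite mul0r addr0 expr0 mul1r.
  have j0 : (0 < j)%N := leq_trans (ltn0Sn _) Jj.
  have j2 : 0 < j%:R :> R by rewrite ltr0n.
  rewrite normrM normrM.
  have w1 : `|1 - j%:R / n%:R| <= 1 :> R.
    rewrite ger0_norm; last by rewrite subr_ge0 ler_pdivrMr // mul1r ler_nat ltnW.
    by rewrite gerBl divr_ge0 // ltW.
  have i0 : 0 <= (j%:R ^+ 6)^-1 :> R by rewrite invr_ge0 exprn_ge0 // ltW.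
  rewrite (@le_trans _ _ (j%:R ^+ 6)^-1) //.
    by rewrite -[X in _ <= X]mul1r ler_pM ?mulr_ge0 // (ger0_norm i0) -[X in _ <= X]mulr1 ler_pM.
  rewrite (le_trans (inv6 _ j0)) // ler_wpM2r ?invr_ge0 ?exprn_ge0 ?(ltW j2) //.
  by rewrite lef_pV2 ?posrE // ler_nat ltnW.
rewrite -mulr_sumr mulrC ler_wpM2r ?invr_ge0 ?(ltW JJ) //.
rewrite (le_trans _ (sum_invsq_le n)) // (big_cat_nat (n := J.+1) (p := n.+1)) //=; last by rewrite ltnS ltnW.
rewrite [X in _ <= _ + X]big_nat_recr //= addrCA lerDl.
by rewrite addr_ge0 ?sumr_ge0 // => [i _|]; rewrite invr_ge0 exprn_ge0.
Qed.

Lemma nodes_scale y (u : R -> R) : nodes (fun s => u (s / y)) = fdiff y^-1 8 u (9 / y).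
Proof. by rewrite /nodes fdiff_scale mul1r. Qed.

Lemma comb_scale M y : 0 < y -> comb M y = y ^+ 5 * nodes (fun s => \sum_(1 <= m < M.+1) tpow 5 (s / y - m%:R)).
Proof.
move=> y0; rewrite /comb /bump /nodes -fdiffZ -fdiff_sum; apply: fdiff_ext => i _.
set s := 9 + _; rewrite mulr_sumr; apply: eq_bigr => m _.
rewrite (_ : s / y - m%:R = (s - m%:R * y) / y); last by field; rewrite gt_eqF.
have [h|h] := leP 0 (s - m%:R * y).
  by rewrite !tpow_ge ?divr_ge0 // ?(ltW y0) // -exprMn [y * _]mulrC divfK // gt_eqF.
by rewrite !tpow_le ?mulr0 // ?(ltW h) // pmulr_lle0 ?invr_gt0 // ltW.
Qed.

(** Poisson summation without a zero frequency: after scaling by [y], the comb is an eighth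
    difference of [sum_m (t - m)_+^5], and [fejer_limit] applies with step [1 / y] at [9 / y]. The
    [512] is [2^8 * 2], from the eight differences and the tail bound [2 / J]. *)
Lemma comb_fourier M y J : 0 < y -> 17 / y <= M%:R -> (0 < J)%N ->
  `|comb M y + kap * y ^+ 5 * nodes (fun s => cosum J (s / y))| <= 512 * kap * y ^+ 5 / J%:R.
Proof.
move=> y0 yM J0; have k0 := kap_gt0; have y5 : 0 < y ^+ 5 by rewrite exprn_gt0.
have JJ : 0 < J%:R :> R by rewrite ltr0n.
apply/ler_addgt0Pr => e e0.
have e1 : 0 < e / 2 / y ^+ 5 by rewrite !divr_gt0.
have yi : 0 <= y^-1 by rewrite invr_ge0 ltW.
have [||N N0 HN] := @fejer_limit y^-1 (9 / y) M _ yi _ _ e1.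
- by rewrite divr_ge0 // ltW.
- by rewrite (_ : _ + _ = 17 / y) // -[y^-1 *+ 8]mulr_natl; ring.
pose n := maxn N (maxn J.+1 (Num.truncn (512 * kap * y ^+ 5 * 2 / e)).+1).
have Nn : (N <= n)%N by rewrite leq_maxl.
have Jn : (J < n)%N by rewrite !leq_max leqnn orbT.
have n1 : 512 * kap * y ^+ 5 / n%:R <= e / 2.
  rewrite ler_pdivrMr ?ltr0n ?(leq_ltn_trans _ Jn) // [X in _ <= X]mulrC -ler_pdivrMr ?divr_gt0 //.
  by rewrite invf_div mulrA ltW // (lt_le_trans (truncnS_gt _)) // ler_nat !leq_max leqnn !orbT.
have := HN n Nn; rewrite -(nodes_scale y) => H1.
pose D s := cosum J (s / y) - wsum n 6 0 (s / y).
have HD : `|nodes D| <= 2 ^+ 8 * (2 / n%:R + 2 / J%:R).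
  by apply: fdiff_bound => i _; exact: cosum_wsum.
rewrite comb_scale // (_ : _ + _ = y ^+ 5 * nodes (fun s => \sum_(1 <= m < M.+1) tpow 5 (s / y - m%:R) + kap * wsum n 6 0 (s / y))
   + kap * y ^+ 5 * nodes D); last first.
  rewrite /nodes fdiffD fdiffZ.
  have -> : fdiff 1 8 D 9 = fdiff 1 8 (fun s => cosum J (s / y)) 9 - fdiff 1 8 (fun s => wsum n 6 0 (s / y)) 9.
    rewrite -mulN1r -fdiffZ -fdiffD; apply: fdiff_ext => i _; by rewrite mulN1r.
  by ring.
rewrite (le_trans (ler_normD _ _)) // addrC ![`|_ * nodes _|]normrM (gtr0_norm y5) (gtr0_norm (mulr_gt0 k0 y5)).
have h1 : y ^+ 5 * `|nodes (fun s => \sum_(1 <= m < M.+1) tpow 5 (s / y - m%:R) + kap * wsum n 6 0 (s / y))| <= e / 2.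
  by rewrite mulrC -ler_pdivlMr.
have h2 : kap * y ^+ 5 * `|nodes D| <= 512 * kap * y ^+ 5 / n%:R + 512 * kap * y ^+ 5 / J%:R.
  have ky : 0 <= kap * y ^+ 5 by rewrite mulr_ge0 // ltW.
  rewrite (le_trans (ler_wpM2l ky HD)) // le_eqVlt; apply/orP; left; apply/eqP; ring.
by move: h1 h2 n1; clear; lra.
Qed.

End TruncatedPowerComb.

Opaque kap.

(** * Moebius inversion of the comb in both variables *)

Section MoebiusComb.
Context {R : realType}.
Implicit Types (v y z : R).

(** With all nodes at or above [v] the truncated power is a polynomial of degree 5, which eight
    differences annihilate. *)
Lemma bump_low v : v <= 9 -> bump v = 0.
Proof.
move=> v9; rewrite /bump /nodes -(@fdiff_poly R 1 8 5 (- v) 9) //; apply: fdiff_ext => i _.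
by rewrite tpow_ge // subr_ge0 (le_trans v9) // lerDl.
Qed.

Lemma bump_high v : 17 <= v -> bump v = 0.
Proof.
move=> v17; rewrite /bump /nodes -(@fdiff0 R R 1 8 9); apply: fdiff_ext => i i8.
rewrite tpow_le // subr_le0 (le_trans _ v17) // -[X in _ <= X]/(17%:R) (_ : 17 = 9 + 8%:R :> R); last by ring.
by rewrite lerD2l ler_nat.
Qed.

Lemma bump_top v : 16 <= v -> v <= 17 -> bump v = (17 - v) ^+ 5.
Proof.
move=> v16 v17; rewrite /bump /nodes fdiff_last => [|i i8].
  by rewrite (_ : 9 + 1 *+ 8 = 17 :> R) ?tpow_ge ?subr_ge0 //; ring.
rewrite tpow_le // subr_le0 (le_trans _ v16) // (_ : 16 = 9 + 7%:R :> R); last by ring.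
by rewrite lerD2l ler_nat.
Qed.

(* The truncation only discards terms [bump (m y)] with [m y > 17], which vanish. *)
Definition fcomb y : R := comb (Num.truncn (17 / y)).+1 y.

Lemma fcombE M y : 0 < y -> 17 / y <= M%:R -> fcomb y = comb M y.
Proof.
move=> y0; set M0 := (Num.truncn (17 / y)).+1 => yM.
have y0' : 17 / y <= M0%:R by rewrite ltW // truncnS_gt.
have stab (M1 M2 : nat) : 17 / y <= M1%:R -> (M1 <= M2)%N -> comb M2 y = comb M1 y.
  move=> h M12; rewrite /comb (big_cat_nat (n := M1.+1)) //= [X in _ + X]big_nat [X in _ + X]big1 ?addr0 //.
  move=> m /andP[Mm _]; apply: bump_high; rewrite -ler_pdivrMr // (le_trans h) // ler_nat.
  exact: ltnW.
have [h|h] := leqP M0 M; first by rewrite (stab _ _ y0' h).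
by rewrite /fcomb -/M0 (stab _ _ yM (ltnW h)).
Qed.

Lemma fcomb_high y : 17 <= y -> fcomb y = 0.
Proof.
move=> y17; have y0 : 0 < y by rewrite (lt_le_trans _ y17).
rewrite /fcomb /comb big_nat big1 // => m /andP[m1 _]; apply: bump_high.
by rewrite (le_trans y17) // ler_peMl ?(ltW y0) // ler1n.
Qed.

Lemma fcomb_fourier y J : 0 < y -> (0 < J)%N ->
  `|fcomb y + kap * y ^+ 5 * nodes (fun s => cosum J (s / y))| <= 512 * kap * y ^+ 5 / J%:R.
Proof. by move=> y0 J0; apply: comb_fourier => //; rewrite ltW // truncnS_gt. Qed.

Lemma fcomb_bound y : 0 < y -> `|fcomb y| <= 768 * kap * y ^+ 5.
Proof.
move=> y0; have := @fcomb_fourier y 1 y0 isT; rewrite divr1.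
set F := nodes _; have F1 : `|F| <= 2 ^+ 8 * 1.
  apply: fdiff_bound => i _; rewrite /cosum big_nat1 expr1n divr1 ler_norml.
  by rewrite cos_geN1 cos_le1.
have ky : 0 <= kap * y ^+ 5 by rewrite mulr_ge0 ?exprn_ge0 ?(ltW kap_gt0) // ltW.
have h2 : `|kap * y ^+ 5 * F| <= 256 * kap * y ^+ 5.
  rewrite normrM (ger0_norm ky) (le_trans (ler_wpM2l ky F1)) // le_eqVlt; apply/orP; left; apply/eqP; ring.
rewrite -{2}(addrK (kap * y ^+ 5 * F) (fcomb y)) => h1.
rewrite (le_trans (ler_normB _ _)) // (le_trans (lerD h1 h2)) // le_eqVlt; apply/orP; left; apply/eqP; ring.
Qed.

(** Inversion over the multiples of [z], exact because [bump (n z)] vanishes for [n > A]. *)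
Lemma moebius_fcomb z A : 0 < z -> (0 < A)%N -> 17 / z <= A%:R ->
  \sum_(1 <= a < A.+1) (moebius a)%:~R * fcomb (a%:R * z) = bump z.
Proof.
move=> z0 A0 zA; rewrite -[z in RHS]mul1r -[1 * z]/(1%:R * z).
rewrite -(@moebius_inversion R (fun n => bump (n%:R * z)) A A0); last first.
  move=> n An; apply: bump_high; rewrite -ler_pdivrMr // (le_trans zA) // ler_nat.
  exact: ltnW.
rewrite !big_nat; apply: eq_bigr => a /andP[a1 _]; congr (_ * _).
have a0 : 0 < a%:R :> R by rewrite ltr0n.
rewrite (@fcombE A) ?mulr_gt0 //.
  by apply: eq_bigr => m _; rewrite natrM; congr bump; ring.
rewrite (le_trans _ zA) // ler_wpM2l // lef_pV2 ?posrE ?mulr_gt0 // ler_peMl ?(ltW z0) //.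
by rewrite ler1n.
Qed.

(** The term of frequency one in the Fourier expansion of the comb, in the sense that [fcomb y] is
    [sum_j cfun (y / j) / j]. *)
Definition cfun z : R := - (kap * z ^+ 5 * nodes (fun s => cos (2 * pi * s / z))).

(** Inversion over the frequencies, applied to [cos (2 pi n s / z) / n^6]. The truncation of the
    Fourier series costs [512 * 2] and that of the inversion [2^8 * 4], together [2048], times
    [kap z^5 / B]. *)
Lemma cfun_limit z B : 0 < z -> (0 < B)%N ->
  `|\sum_(1 <= b < B.+1) (moebius b)%:~R / b%:R * fcomb (z / b%:R) - cfun z| <= 2048 * kap * z ^+ 5 / B%:R.
Proof.
move=> z0 B0; have k0 := @kap_gt0 R.
have B1 : 0 < B%:R :> R by rewrite ltr0n.
have kz : 0 < kap * z ^+ 5 by apply: mulr_gt0 k0 _; rewrite exprn_gt0.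
have C0 : 0 <= 512 * kap * z ^+ 5 / B%:R.
  by rewrite -[512 * kap * _]mulrA; apply: divr_ge0; [exact: mulr_ge0 (ler0n _ _) (ltW kz)|exact: ltW].
pose S s := \sum_(1 <= b < B.+1) (moebius b)%:~R * \sum_(1 <= j < B.+1)
   (cos (2 * pi * (b * j)%:R * (s / z)) / (b * j)%:R ^+ 6) : R.
have HS s : `|S s - cos (2 * pi * s / z)| <= 4 / B%:R.
  pose G n : R[i] := (cos (2 * pi * n%:R * (s / z)) / n%:R ^+ 6)%:C.
  have Gb k : (0 < k)%N -> cn (G k) <= (k%:R ^+ 3)^-1.
    move=> k1; have k2 : 1 <= k%:R :> R by rewrite ler1n.
    have k3 : 0 < k%:R :> R by rewrite ltr0n.
    rewrite cn_real normrM (@le_trans _ _ `|(k%:R ^+ 6)^-1|) //.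
      by rewrite ler_piMl // ler_norml cos_geN1 cos_le1.
    by rewrite ger0_norm ?invr_ge0 ?exprn_ge0 // lef_pV2 ?posrE ?exprn_gt0 // ler_weXn2l.
  have G1 : G 1%N = (cos (2 * pi * s / z))%:C.
    by rewrite /G expr1n divr1 mulr1; congr (cos _)%:C; rewrite mulrA.
  case: B B0 {B1 C0} @S => // B _ S; have := @moebius_inversion_bound R G B Gb.
  rewrite G1 (_ : \sum_(_ <= _ < _) _ = (S s)%:C); last first.
    rewrite rmorph_sum; apply: eq_bigr => b _; rewrite rmorphM rmorph_int; congr (_ * _).
    by rewrite rmorph_sum.
  by rewrite -rmorphB -[X in X <= _]/(cn _%:C) cn_real.
pose err b := fcomb (z / b%:R) + kap * (z / b%:R) ^+ 5 * nodes (fun s => cosum B (s / (z / b%:R))).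
have Herr b : (0 < b)%N -> `|b%:R^-1 * err b| <= 512 * kap * z ^+ 5 / B%:R * (b%:R ^+ 2)^-1.
  move=> b1; have b0 : 0 < b%:R :> R by rewrite ltr0n.
  have := @fcomb_fourier (z / b%:R) B (divr_gt0 z0 b0) B0; rewrite -/(err b) => h.
  rewrite normrM ger0_norm ?invr_ge0 ?(ltW b0) // (le_trans (ler_wpM2l _ h)) ?invr_ge0 ?(ltW b0) //.
  rewrite (_ : b%:R^-1 * (512 * kap * (z / b%:R) ^+ 5 / B%:R) = 512 * kap * z ^+ 5 / B%:R * b%:R^-1 ^+ 6).
    apply: (ler_wpM2l C0); rewrite exprVn lef_pV2 ?posrE ?exprn_gt0 //.
    by rewrite ler_weXn2l // ler1n.
  by rewrite exprMn; ring.
rewrite (_ : \sum_(_ <= _ < _) _ - _ = \sum_(1 <= b < B.+1) (moebius b)%:~R * (b%:R^-1 * err b)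
   - kap * z ^+ 5 * nodes (fun s => S s - cos (2 * pi * s / z))); last first.
  have -> : nodes (fun s => S s - cos (2 * pi * s / z)) = nodes S - nodes (fun s => cos (2 * pi * s / z)).
    rewrite /nodes -mulN1r -fdiffZ -fdiffD; apply: fdiff_ext => i _; by rewrite mulN1r.
  have -> : nodes S = \sum_(1 <= b < B.+1) (moebius b)%:~R * (b%:R ^+ 6)^-1 * nodes (fun s => cosum B (s / (z / b%:R))).
    under [RHS]eq_bigr do rewrite -fdiffZ.
    rewrite /nodes -fdiff_sum; apply: fdiff_ext => i _; rewrite /S !big_nat; apply: eq_bigr => b /andP[b1 _].
    have b0 : b%:R != 0 :> R by rewrite pnatr_eq0 -lt0n.
    rewrite -mulrA; congr (_ * _); rewrite /cosum mulr_sumr !big_nat; apply: eq_bigr => j /andP[j1 _].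
    have j0 : j%:R != 0 :> R by rewrite pnatr_eq0 -lt0n.
    rewrite natrM (exprMn _ b%:R) (invfM (b%:R ^+ 6)) [RHS]mulrCA; congr (cos _ * _).
    rewrite -!mulrA; congr (2 * (pi * _)); rewrite mulrCA; congr (_ * _).
    by rewrite invf_div mulrCA mulrA.
  have -> : \sum_(1 <= b < B.+1) (moebius b)%:~R / b%:R * fcomb (z / b%:R) =
    \sum_(1 <= b < B.+1) (moebius b)%:~R * (b%:R^-1 * err b) - kap * z ^+ 5 *
      \sum_(1 <= b < B.+1) (moebius b)%:~R * (b%:R ^+ 6)^-1 * nodes (fun s => cosum B (s / (z / b%:R))).
    rewrite mulr_sumr -sumrB !big_nat; apply: eq_bigr => b /andP[b1 _].
    have b0 : b%:R != 0 :> R by rewrite pnatr_eq0 -lt0n.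
    rewrite /err expr_div_n; move: (fcomb _) (nodes _) (moebius b)%:~R => *; by field.
  rewrite /cfun; set X := \sum_(_ <= _ < _) _ * (_ * err _); set Y := \sum_(_ <= _ < _) _.
  move: (kap * z ^+ 5) X Y (nodes _) => *; ring.
rewrite (le_trans (ler_normB _ _)) //.
have h1 : `|\sum_(1 <= b < B.+1) (moebius b)%:~R * (b%:R^-1 * err b)| <= 512 * kap * z ^+ 5 / B%:R * 2.
  rewrite (le_trans (ler_norm_sum _ _ _)) //.
  rewrite (le_trans _ (ler_wpM2l C0 (sum_invsq_le B))) // mulr_sumr !big_nat ler_sum // => b /andP[b1 _].
  rewrite normrM (le_trans _ (Herr b b1)) // ler_piMl // -intr_norm -[1]/(1%:~R) ler_int; exact: moebius_norm.
have h2 : `|kap * z ^+ 5 * nodes (fun s => S s - cos (2 * pi * s / z))| <= kap * z ^+ 5 * (2 ^+ 8 * (4 / B%:R)).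
  by rewrite normrM gtr0_norm // ler_pM2l //; apply: fdiff_bound => i _.
rewrite (le_trans (lerD h1 h2)) // le_eqVlt; apply/orP; left; apply/eqP; ring.
Qed.

End MoebiusComb.

(** * Oscillatory kernel estimates *)

Section OscillatoryKernel.
Context {R : realType}.
Variable w : R.
Hypothesis w0 : 0 <= w.
Implicit Types (a b c phi : R) (p n : nat).

(* [(c, p, n, phi)] stands for [c a^p b^(-n) cos (w b / a + phi)]. *)
Definition wave := (R * nat * nat * R)%type.

Definition wave_val (t : wave) a b :=
  let: (c, p, n, phi) := t in c * (a ^+ p * b^-1 ^+ n * cos (w * b / a + phi)).

(** A derivative in either variable raises [n - p] by one and, for exponents up to 7, multiplies the
    sum of the [|c|] by at most [7 + w]. The truncated predecessors are guarded by lower bounds on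
    [p] and [n] in the derivative lemmas. *)
Definition wave_da (t : wave) : seq wave := let: (c, p, n, phi) := t in
  [:: (p%:R * c, p.-1, n, phi); (w * c, p.-2, n.-1, phi - pi / 2)].

Definition wave_db (t : wave) : seq wave := let: (c, p, n, phi) := t in
  [:: (- n%:R * c, p, n.+1, phi); (w * c, p.-1, n, phi + pi / 2)].

Definition waves (l : seq wave) a b := \sum_(t <- l) wave_val t a b.

Definition wave_norm (l : seq wave) : R := \sum_(t <- l) `|t.1.1.1|.

Lemma eps_deriv_invX n b : b != 0 -> eps_deriv (fun b => b^-1 ^+ n) b (- n%:R * b^-1 ^+ n.+1).
Proof.
case: n => [|n] b0; first by rewrite oppr0 mul0r; exact: eps_deriv_cst.
have := eps_derivX n (eps_derivV b0); congr eps_deriv.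
by rewrite -exprVn !exprS; ring.
Qed.

Lemma eps_deriv_wave_b t a b : a != 0 -> b != 0 -> (0 < t.1.1.2)%N ->
  eps_deriv (wave_val t a) b (waves (wave_db t) a b).
Proof.
case: t => [[[c [//|p]] n] phi] a0 b0 _; rewrite /waves /= !big_cons big_nil addr0.
have H : eps_deriv (fun b => w * b / a + phi) b (w / a).
  rewrite -[X in eps_deriv _ _ X]addr0; apply: eps_derivD; last exact: eps_deriv_cst.
  have := eps_derivZ (w / a) (eps_deriv_id b); rewrite mulr1.
  by congr eps_deriv; apply/funext => s; rewrite /= mulrAC.
have := eps_derivZ c (eps_derivM (eps_derivZ (a ^+ p.+1) (eps_deriv_invX n b0)) (eps_deriv_cos H)).
congr eps_deriv; rewrite /wave_val (addrA (w * b / a)) cosDpihalf !exprS.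
by move: (cos _) (sin _) (a ^+ p) (b^-1 ^+ n) => C S X Y; field; rewrite a0 b0.
Qed.

Lemma eps_deriv_wave_a t a b : a != 0 -> b != 0 -> (1 < t.1.1.2)%N -> (0 < t.1.2)%N ->
  eps_deriv ((wave_val t)^~ b) a (waves (wave_da t) a b).
Proof.
case: t => [[[c [|[|p]]] [|n]] phi] //= a0 b0 _ _; rewrite /waves /= !big_cons big_nil addr0.
have H : eps_deriv (fun a => w * b / a + phi) a (w * b * (- a ^- 2)).
  rewrite -[X in eps_deriv _ _ X]addr0; apply: eps_derivD; last exact: eps_deriv_cst.
  exact/eps_derivZ/eps_derivV.
have X : eps_deriv (fun a => a ^+ p.+2 * b^-1 ^+ n.+1) a (b^-1 ^+ n.+1 * (p.+2%:R * a ^+ p.+1)).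
  have := eps_derivZ (b^-1 ^+ n.+1) (eps_derivX p.+1 (eps_deriv_id a)); rewrite mulr1.
  by congr eps_deriv; apply/funext => s; rewrite /= mulrC.
have := eps_derivZ c (eps_derivM X (eps_deriv_cos H)).
congr eps_deriv; rewrite /wave_val (addrA (w * b / a)) cosBpihalf !exprS.
by move: (cos _) (sin _) (a ^+ p) (b^-1 ^+ n) => C S Y Z; field; rewrite a0 b0.
Qed.

Lemma waves_flatten (d : wave -> seq wave) l a b :
  waves (flatten [seq d t | t <- l]) a b = \sum_(t <- l) waves (d t) a b.
Proof. by elim: l => [|t l IH]; rewrite /waves ?big_nil //= big_cat /= big_cons -IH. Qed.

Definition waves_da l := flatten [seq wave_da t | t <- l].
Definition waves_db l := flatten [seq wave_db t | t <- l].

Lemma eps_deriv_seq (l : seq wave) (P : pred wave) (F : wave -> R -> R) dF (t : R) :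
  (forall i, P i -> eps_deriv (F i) t (dF i)) -> all P l ->
  eps_deriv (fun s => \sum_(i <- l) F i s) t (\sum_(i <- l) dF i).
Proof.
move=> H; elim: l => [|i l IH] /=.
  rewrite big_nil => _; rewrite (_ : (fun s => _) = fun=> 0); first exact: eps_deriv_cst.
  by apply/funext => s; rewrite big_nil.
move=> /andP[Pi Pl]; rewrite big_cons (_ : (fun s => _) = fun s => F i s + \sum_(i <- l) F i s).
  by apply: eps_derivD; [exact: H|exact: IH].
by apply/funext => s; rewrite big_cons.
Qed.

Lemma eps_deriv_waves_b l a b : a != 0 -> b != 0 -> all (fun t => 0 < t.1.1.2)%N l ->
  eps_deriv (waves l a) b (waves (waves_db l) a b).
Proof. by move=> a0 b0; rewrite waves_flatten; apply: eps_deriv_seq => t; exact: eps_deriv_wave_b. Qed.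

Lemma eps_deriv_waves_a l a b : a != 0 -> b != 0 ->
  all (fun t => (1 < t.1.1.2)%N && (0 < t.1.2)%N) l ->
  eps_deriv ((waves l)^~ b) a (waves (waves_da l) a b).
Proof.
move=> a0 b0; rewrite waves_flatten; apply: eps_deriv_seq => t /andP[t1 t2].
exact: eps_deriv_wave_a.
Qed.

Lemma wave_norm_flatten (d : wave -> seq wave) l K (P : pred wave) :
  (forall t, P t -> wave_norm (d t) <= K * `|t.1.1.1|) -> all P l ->
  wave_norm (flatten [seq d t | t <- l]) <= K * wave_norm l.
Proof.
move=> H; elim: l => [|t l IH] /=; first by rewrite /wave_norm big_nil mulr0.
move=> /andP[Pt Pl]; rewrite /wave_norm big_cat /= big_cons mulrDr lerD ?H //; exact: IH.
Qed.

Lemma wave_norm_da l : all (fun t => t.1.1.2 <= 7)%N l -> wave_norm (waves_da l) <= (7 + w) * wave_norm l.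
Proof.
apply: wave_norm_flatten => -[[[c p] n] phi] /= p7; rewrite /wave_norm !big_cons big_nil /= addr0.
by rewrite !normrM mulrDl (ger0_norm w0) lerD2r ler_wpM2r // ger0_norm // ler_nat.
Qed.

Lemma wave_norm_db l : all (fun t => t.1.2 <= 7)%N l -> wave_norm (waves_db l) <= (7 + w) * wave_norm l.
Proof.
apply: wave_norm_flatten => -[[[c p] n] phi] /= p7; rewrite /wave_norm !big_cons big_nil /= addr0.
by rewrite !normrM normrN mulrDl (ger0_norm w0) lerD2r ler_wpM2r // ger0_norm // ler_nat.
Qed.

(** For [n = p + d] the amplitude is [(a / b)^p b^(-d)], and [a <= r b] leaves only the power
    [b^(-d)]. *)
Lemma waves_bound l d a b r : all (fun t => (t.1.1.2 <= 6)%N && (t.1.2 == t.1.1.2 + d)%N) l ->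
  1 <= r -> 0 < a -> 0 < b -> a <= r * b ->
  `|waves l a b| <= wave_norm l * (r ^+ 6 * b^-1 ^+ d).
Proof.
move=> + r1 a0 b0 ab; rewrite /waves /wave_norm; elim: l => [|t l IH] /=.
  by rewrite !big_nil normr0 mul0r.
move=> /andP[/andP[p6 nE] /IH{}IH]; rewrite !big_cons mulrDl.
rewrite (le_trans (ler_normD _ _)) // lerD //; case: t p6 nE => [[[c p] n] phi] /= p6 /eqP ->.
rewrite normrM ler_wpM2l // exprD mulrA -exprMn normrM.
have h0 : 0 <= (a * b^-1) ^+ p * b^-1 ^+ d by rewrite mulr_ge0 ?exprn_ge0 ?mulr_ge0 ?invr_ge0 // ltW.
rewrite (ger0_norm h0) (@le_trans _ _ ((a * b^-1) ^+ p * b^-1 ^+ d)) //.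
  by rewrite ler_piMr // ler_norml cos_geN1 cos_le1.
rewrite ler_wpM2r ?exprn_ge0 ?invr_ge0 ?(ltW b0) // (@le_trans _ _ (r ^+ p)) ?ler_weXn2l //.
have ab1 : a * b^-1 <= r by rewrite ler_pdivrMr.
by rewrite lerXn2r // nnegrE ?divr_ge0 ?(ltW a0) ?(ltW b0) // (le_trans _ r1).
Qed.

Lemma eps_deriv_fdiff_param h k (f f1 : R -> R -> R) a t :
  (forall i, (i <= k)%N -> eps_deriv (f^~ (t + h *+ i)) a (f1 a (t + h *+ i))) ->
  eps_deriv (fun s => fdiff h k (f s) t) a (fdiff h k (f1 a) t).
Proof.
elim: k f f1 => [|k IH] f f1 H /=; first by have := H 0%N isT; rewrite addr0.
apply: (IH (fun s b => f s (b + h) - f s b) (fun s b => f1 s (b + h) - f1 s b)) => i ik.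
by apply: eps_derivB; [rewrite -addrA -mulrSr; exact: H|apply: H; exact: leqW].
Qed.

(** Up to the factor [x^5] this is [a y^5 cos (2 pi j s / y)] at [y = a x / b], with
    [w = 2 pi j s / x]. *)
Definition osc_kernel : seq wave := [:: (1, 6%N, 5%N, 0)].

(** Two derivatives in [a] and [k] in [b] take [n - p] from [-1] to [k + 1], which is the power of
    [t^-1]. The exponent 6 of [a] suffices for all of them: it drops by at most 2 for each
    derivative in [a] and by at most 1 for each in [b]. *)
Lemma kernel_fdiff h k a t r : 1 <= r -> 0 <= h -> (k <= 2)%N -> 0 < t -> 2 <= a -> a + 1 <= r * t ->
  `|fdiff 1 2 (fun s => fdiff h k (waves osc_kernel s) t) (a - 1)| <=
  h ^+ k * ((7 + w) ^+ 4 * (r ^+ 6 * t^-1 ^+ k.+1)).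
Proof.
move=> r1 h0 k2 t0 a2 art; have a1 : 0 < a - 1 by rewrite subr_gt0 (lt_le_trans _ a2) // ltr1n.
pose us i s := fdiff h k (waves (iter i waves_da osc_kernel) s) t.
have tb (i : nat) : t + h *+ i != 0 by rewrite gt_eqF // ltr_wpDr // mulrn_wge0.
have [||x /andP[x1 x2] ->] := @fdiff_MVT R 1 2 us (a - 1).
- exact: ler01.
- move=> i s i2 /andP[s1 _]; apply: (@eps_deriv_fdiff_param _ _ _ (waves (iter i.+1 waves_da osc_kernel))) => j _.
  apply: eps_deriv_waves_a => //; first by rewrite gt_eqF // (lt_le_trans a1).
  by case: i i2 => [|[|]].
rewrite expr1n mul1r /us; have x0 : 0 < x := lt_le_trans a1 x1.
set l2 := iter 2 _ _.
have [//||y /andP[y1 y2] ->] := @fdiff_MVT R h k (fun i => waves (iter i waves_db l2) x) t.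
  move=> i s ik /andP[s1 _]; apply: eps_deriv_waves_b; rewrite ?gt_eqF ?(lt_le_trans t0 s1) //.
  by case: i ik => [|[|i]] // ik; have := leq_trans ik k2.
have y0 : 0 < y := lt_le_trans t0 y1.
have W1 : 1 <= 7 + w by rewrite (@le_trans _ _ 7) ?ler1n // lerDl.
have W0 : 0 <= 7 + w := le_trans ler01 W1.
have n2 : wave_norm l2 <= (7 + w) ^+ 2.
  have h1 : wave_norm (waves_da osc_kernel) <= (7 + w) * 1.
    rewrite (le_trans (wave_norm_da _)) //; rewrite /wave_norm big_seq1 /= normr1 //.
  rewrite (le_trans (wave_norm_da _)) // expr2 ler_wpM2l // (le_trans h1) // mulr1 //.
have nk : wave_norm (iter k waves_db l2) <= (7 + w) ^+ 4.
  apply: (@le_trans _ _ ((7 + w) ^+ (2 + k))); last by rewrite ler_weXn2l // -[4%N]/(2 + 2)%N leq_add2l.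
  rewrite exprD; case: k k2 {us y1 y2 tb} => [|[|[|]]] // _.
  - by rewrite mulr1.
  - by rewrite expr1 (le_trans (wave_norm_db _)) // mulrC ler_wpM2r.
  rewrite (le_trans (wave_norm_db _)) // expr2 mulrA mulrC ler_wpM2r //.
  by rewrite (le_trans (wave_norm_db _)) // mulrC ler_wpM2r.
rewrite normrM (ger0_norm (exprn_ge0 _ h0)) ler_wpM2l ?exprn_ge0 //.
have xy : x <= r * y.
  rewrite (le_trans x2) // -mulr_natl mulr1 (_ : a - 1 + 2 = a + 1); last by ring.
  by rewrite (le_trans art) // ler_wpM2l // (le_trans ler01).
have q0 s : 0 < s -> 0 <= r ^+ 6 * s^-1 ^+ k.+1.
  by move=> s0; rewrite mulr_ge0 ?exprn_ge0 ?invr_ge0 ?(ltW s0) // (le_trans ler01).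
rewrite (@le_trans _ _ (wave_norm (iter k waves_db l2) * (r ^+ 6 * y^-1 ^+ k.+1))) //.
  apply: waves_bound => //; by case: k k2 {us y1 y2 tb nk q0} => [|[|[|]]].
rewrite ler_pM ?q0 //; first by rewrite /wave_norm sumr_ge0.
rewrite ler_wpM2l ?exprn_ge0 ?(le_trans ler01) // lerXn2r ?nnegrE ?invr_ge0 ?(ltW t0) ?(ltW y0) // lef_pV2 ?posrE //.
Qed.

End OscillatoryKernel.

(** * Differences of the comb kernel *)

Section CombKernel.
Context {R : realType}.
Variable x : R.
Hypothesis x0 : 0 < x.

(** The factor [a] compensates the weight [mu(a) / a], of which [T] is a second primitive. *)
Definition comb_kernel (a b : R) : R := a * fcomb (a * x / b).

Lemma fdiff_swap (V : zmodType) h k h' k' (f : R -> R -> V) (s t : R) :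
  fdiff h k (fun a => fdiff h' k' (f a) t) s = fdiff h' k' (fun b => fdiff h k (f^~ b) s) t.
Proof.
elim: k f => [//|k IH] f /=; rewrite -IH; apply: fdiff_ext => i _.
have N (u : R -> V) : fdiff h' k' (fun b => - u b) t = - fdiff h' k' u t.
  by apply/eqP; rewrite -addr_eq0 -fdiffD -(@fdiff0 R V h' k' t); apply/eqP/fdiff_ext => j _; rewrite addNr.
by rewrite fdiffD N.
Qed.

Definition comb_kernel_part J (a b : R) : R := - (kap * x ^+ 5 *
  nodes (fun s => \sum_(1 <= j < J.+1) (j%:R ^+ 6)^-1 * waves (2 * pi * j%:R * s / x) osc_kernel a b)).

Lemma comb_kernel_partP J a b : 0 < a -> 0 < b -> (0 < J)%N ->
  `|comb_kernel a b - comb_kernel_part J a b| <= 512 * kap * x ^+ 5 * a ^+ 6 * b^-1 ^+ 5 / J%:R.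
Proof.
move=> a0 b0 J0; have y0 : 0 < a * x / b by rewrite divr_gt0 // mulr_gt0.
have := fcomb_fourier y0 J0; rewrite /comb_kernel /comb_kernel_part opprK.
have -> : kap * x ^+ 5 * nodes (fun s => \sum_(1 <= j < J.+1) (j%:R ^+ 6)^-1 *
    waves (2 * pi * j%:R * s / x) osc_kernel a b) =
  a * (kap * (a * x / b) ^+ 5 * nodes (fun s => cosum J (s / (a * x / b)))).
  rewrite [in RHS]mulrA -!fdiffZ; apply: fdiff_ext => i _; set s := 9 + _.
  rewrite /cosum !mulr_sumr; apply: eq_bigr => j _; rewrite /waves /osc_kernel big_seq1 /= addr0 mul1r.
  have -> : 2 * pi * j%:R * (s / (a * x / b)) = 2 * pi * j%:R * s / x * b / a.
    by field; rewrite !gt_eqF.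
  by move: (cos _) (j%:R ^+ 6) kap => C Y K; rewrite expr_div_n exprMn exprVn; ring.
rewrite -mulrDr normrM (gtr0_norm a0) => h; rewrite (le_trans (ler_wpM2l (ltW a0) h)) //.
by rewrite expr_div_n exprMn exprVn le_eqVlt; apply/orP; left; apply/eqP; ring.
Qed.

(** Up to four derivatives of the [j]-th wave cost [j^4] against the coefficient [j^-6]. [W] is
    [7 + w] for [j = 1] at the largest node [17]. The Fourier series is cut at a [J] that may depend
    on [a] and [t], since its tail only has to fall below an arbitrary [e]. *)
Lemma comb_kernel_fdiff r : 1 <= r -> exists2 C, 0 <= C & forall h k a t,
  0 <= h -> h <= 2 -> (k <= 2)%N -> 0 < t -> 2 <= a -> a + 1 <= r * t ->
  `|fdiff 1 2 (fun s => fdiff h k (comb_kernel s) t) (a - 1)| <= C * t^-1 ^+ k.+1.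
Proof.
move=> r1; have k0 := @kap_gt0 R; have r0 : 0 <= r := le_trans ler01 r1.
pose W : R := 7 + 34 * pi / x; have W0 : 0 <= W by rewrite addr_ge0 // divr_ge0 ?mulr_ge0 ?pi_ge0 // ltW.
pose C := kap * x ^+ 5 * (2 ^+ 8 * (4 * W ^+ 4 * r ^+ 6 * 2)).
have kx : 0 <= kap * x ^+ 5 by rewrite mulr_ge0 ?exprn_ge0 // ltW.
exists C; first by rewrite mulr_ge0 // !mulr_ge0 ?exprn_ge0.
move=> h k a t h0 h2 k2 t0 a2 art; have a1 : 0 < a - 1 by rewrite subr_gt0 (lt_le_trans _ a2) // ltr1n.
have aa0 : 0 < a + 1 by rewrite (lt_le_trans a1) // lerD2l.
apply/ler_addgt0Pr => e e0.
pose E := 512 * (kap * x ^+ 5) * ((a + 1) ^+ 6 * t^-1 ^+ 5).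
have kx' : 0 <= 512 * (kap * x ^+ 5) := mulr_ge0 (ler0n _ 512) kx.
have E0 : 0 <= E.
  by apply: (mulr_ge0 kx'); apply: mulr_ge0; rewrite exprn_ge0 ?invr_ge0 ?(ltW t0) ?(ltW aa0).
(* The [16] is [2^2] from the differences in [a] times [2^k <= 4] from those in [b]. *)
pose J := (Num.truncn (16 * E / e)).+1.
have JE : 16 * (E / J%:R) <= e.
  by rewrite mulrA ler_pdivrMr ?ltr0n // [X in _ <= X]mulrC -ler_pdivrMr // ltW // truncnS_gt.
pose D s b := comb_kernel s b - comb_kernel_part J s b.
have -> : fdiff 1 2 (fun s => fdiff h k (comb_kernel s) t) (a - 1) =
   fdiff 1 2 (fun s => fdiff h k (comb_kernel_part J s) t) (a - 1) +
   fdiff 1 2 (fun s => fdiff h k (D s) t) (a - 1).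
  rewrite -fdiffD; apply: fdiff_ext => i _; rewrite -fdiffD; apply: fdiff_ext => l _.
  by rewrite /D [RHS]addrC subrK.
rewrite (le_trans (ler_normD _ _)) // lerD //; last first.
  apply: le_trans JE; rewrite (_ : 16 * (E / J%:R) = 2 ^+ 2 * (4 * (E / J%:R))); last by ring.
  apply: fdiff_bound => i i2; rewrite (@le_trans _ _ (2 ^+ k * (E / J%:R))) //; last first.
    by rewrite ler_wpM2r ?divr_ge0 // (_ : 4 = 2 ^+ 2 :> R) ?ler_weXn2l ?ler1n //; ring.
  have ai0 : 0 < a - 1 + 1 *+ i by rewrite ltr_wpDr // mulrn_wge0.
  apply: fdiff_bound => l lk; have tl0 : 0 < t + h *+ l by rewrite ltr_wpDr // mulrn_wge0.
  rewrite (le_trans (comb_kernel_partP ai0 tl0 _)) // ler_wpM2r ?invr_ge0 //.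
  rewrite -[X in X <= _]mulrA -[512 * kap * _]mulrA; apply: (ler_wpM2l kx').
  apply: ler_pM; rewrite ?exprn_ge0 ?invr_ge0 ?(ltW ai0) ?(ltW tl0) //.
    rewrite lerXn2r ?nnegrE ?(ltW ai0) ?(ltW aa0) //.
    have : i%:R <= 2 :> R by rewrite ler_nat.
    by clear; lra.
  rewrite lerXn2r ?nnegrE ?invr_ge0 ?(ltW tl0) ?(ltW t0) // lef_pV2 ?posrE // lerDl mulrn_wge0 //.
have -> : fdiff 1 2 (fun s => fdiff h k (comb_kernel_part J s) t) (a - 1) =
   - (kap * x ^+ 5) * nodes (fun v => \sum_(1 <= j < J.+1) (j%:R ^+ 6)^-1 *
     fdiff 1 2 (fun s => fdiff h k (waves (2 * pi * j%:R * v / x) osc_kernel s) t) (a - 1)).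
  rewrite -fdiffZ; transitivity (fdiff 1 2 (fun s => fdiff 1 8 (fun v => fdiff h k (fun b => - (kap * x ^+ 5) *
     \sum_(1 <= j < J.+1) (j%:R ^+ 6)^-1 * waves (2 * pi * j%:R * v / x) osc_kernel s b) t) 9) (a - 1)).
    apply: fdiff_ext => i _; rewrite fdiff_swap; apply: fdiff_ext => l _.
    by rewrite fdiffZ mulNr.
  rewrite fdiff_swap; apply: fdiff_ext => i _; set v := 9 + _.
  transitivity (fdiff 1 2 (fun s => - (kap * x ^+ 5) *
     \sum_(1 <= j < J.+1) (j%:R ^+ 6)^-1 * fdiff h k (waves (2 * pi * j%:R * v / x) osc_kernel s) t) (a - 1)).
    apply: fdiff_ext => l _; rewrite fdiffZ fdiff_sum; congr (_ * _).
    by apply: eq_bigr => j _; rewrite fdiffZ.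
  by rewrite fdiffZ fdiff_sum; congr (_ * _); apply: eq_bigr => j _; rewrite fdiffZ.
have kb (v : R) j : 0 <= v -> v <= 17 -> (0 < j)%N ->
  `|(j%:R ^+ 6)^-1 * fdiff 1 2 (fun s => fdiff h k (waves (2 * pi * j%:R * v / x) osc_kernel s) t) (a - 1)| <=
    4 * W ^+ 4 * r ^+ 6 * t^-1 ^+ k.+1 * (j%:R ^+ 2)^-1.
  move=> v0 v17 j0; have j1 : 1 <= j%:R :> R by rewrite ler1n.
  have j2 : 0 < j%:R :> R by rewrite ltr0n.
  have w0 : 0 <= 2 * pi * j%:R * v / x by rewrite divr_ge0 ?mulr_ge0 ?pi_ge0 // ltW.
  rewrite normrM ger0_norm ?invr_ge0 ?exprn_ge0 //.
  have := kernel_fdiff w0 r1 h0 k2 t0 a2 art => /(ler_wpM2l _) H.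
  rewrite (le_trans (H _ _)) ?invr_ge0 ?exprn_ge0 // => {H}.
  have hk : h ^+ k <= 4.
    rewrite (@le_trans _ _ (2 ^+ k)) ?lerXn2r ?nnegrE // (_ : 4 = 2 ^+ 2 :> R); last by ring.
    by rewrite ler_weXn2l // ler1n.
  have wj : (7 + 2 * pi * j%:R * v / x) ^+ 4 <= j%:R ^+ 4 * W ^+ 4.
    have p1 : 0 <= 7 + 2 * pi * j%:R * v / x := addr_ge0 (ler0n _ 7) w0.
    have p2 : 0 <= j%:R * W := mulr_ge0 (ltW j2) W0.
    rewrite -exprMn lerXn2r ?nnegrE // [j%:R * W]mulrDr lerD //.
      by rewrite ler_peMl.
    rewrite (_ : 2 * pi * j%:R * v / x = 2 * pi * j%:R / x * v); last by ring.
    rewrite (_ : j%:R * (34 * pi / x) = 2 * pi * j%:R / x * 17); last by ring.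
    by rewrite ler_wpM2l // divr_ge0 ?mulr_ge0 ?pi_ge0 // ltW.
  rewrite (@le_trans _ _ ((j%:R ^+ 6)^-1 * (4 * (j%:R ^+ 4 * W ^+ 4 * (r ^+ 6 * t^-1 ^+ k.+1))))) //.
    have p0 : 0 <= r ^+ 6 * t^-1 ^+ k.+1 by rewrite mulr_ge0 ?exprn_ge0 ?invr_ge0 // ltW.
    apply: ler_wpM2l; first by rewrite invr_ge0 exprn_ge0.
    apply: ler_pM hk _; [exact: exprn_ge0| |exact: ler_wpM2r].
    exact: mulr_ge0 (exprn_ge0 4 (addr_ge0 (ler0n _ 7) w0)) p0.
  rewrite le_eqVlt; apply/orP; left; apply/eqP; move: (r ^+ 6) (W ^+ 4) (t^-1 ^+ _) => X Y Z.
  by field; rewrite gt_eqF.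
rewrite mulNr normrN normrM (ger0_norm kx) /C -[X in _ <= X]mulrA ler_wpM2l //.
rewrite -[X in _ <= X]mulrA; apply: fdiff_bound => i i8.
have v0 : 0 <= 9 + 1 *+ i :> R by rewrite addr_ge0.
have v17 : 9 + 1 *+ i <= 17 :> R by rewrite (_ : 17 = 9 + 8%:R :> R) ?lerD2l ?ler_nat //; ring.
rewrite (le_trans (ler_norm_sum _ _ _)) //.
apply: (@le_trans _ _ (4 * W ^+ 4 * r ^+ 6 * t^-1 ^+ k.+1 * \sum_(1 <= j < J.+1) (j%:R ^+ 2)^-1)).
  by rewrite mulr_sumr !big_nat; apply: ler_sum => j /andP[j0 _]; exact: kb.
rewrite (_ : _ * 2 * _ = 4 * W ^+ 4 * r ^+ 6 * t^-1 ^+ k.+1 * 2); last by ring.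
by rewrite ler_wpM2l ?sum_invsq_le // !mulr_ge0 ?exprn_ge0 ?invr_ge0 // ?(ltW t0).
Qed.

End CombKernel.

(** * Summation by parts against the Moebius function *)

Section WeightedSummation.
Context {R : realType}.

(** With [s] and [r] the two roots, the right side is [(m s)^-1 * 6 m / (r (r + s))], and
    [r <= 3/2 s] gives [r (r + s) <= 15/4 m]. *)
Lemma inv_sqrt_step (m : R) : 1 <= m ->
  (m * Num.sqrt m)^-1 <= 6 / Num.sqrt m - 6 / Num.sqrt (m + 1).
Proof.
move=> m1; have m0 : 0 < m := lt_le_trans ltr01 m1.
have m2 : 0 < m + 1 by rewrite addr_gt0.
have s0 : 0 < Num.sqrt m by rewrite sqrtr_gt0.
have r0 : 0 < Num.sqrt (m + 1) by rewrite sqrtr_gt0.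
have sE : Num.sqrt m ^+ 2 = m by rewrite sqr_sqrtr // ltW.
have rE : Num.sqrt (m + 1) ^+ 2 = m + 1 by rewrite sqr_sqrtr // ltW.
set s := Num.sqrt m in s0 sE *; set r := Num.sqrt (m + 1) in r0 rE *.
have rs : r <= 3 / 2 * s.
  rewrite -(@ler_pXn2r _ 2) ?nnegrE ?(ltW r0) // ?mulr_ge0 ?divr_ge0 ?(ltW s0) //.
  by rewrite rE exprMn sE; move: m1; clear; lra.
have sr : s <= r by rewrite ler_wsqrtr // lerDl.
have -> : 6 / s - 6 / r = (m * s)^-1 * (6 * m / (r * (r + s))).
  have d : r + s != 0 by rewrite gt_eqF // addr_gt0.
  have : 6 / s - 6 / r = 6 * (r ^+ 2 - s ^+ 2) / (s * r * (r + s)).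
    by field; rewrite d !gt_eqF.
  by rewrite rE sE => ->; field; rewrite d !gt_eqF.
rewrite ler_peMr ?invr_ge0 ?mulr_ge0 ?(ltW m0) ?(ltW s0) //.
rewrite ler_pdivlMr ?mulr_gt0 ?addr_gt0 // mul1r.
rewrite (@le_trans _ _ (3 / 2 * s * (3 / 2 * s + s))) //.
  by rewrite ler_pM ?(ltW r0) ?addr_ge0 ?(ltW r0) ?(ltW s0) // lerD2r.
rewrite (_ : _ * _ = 15 / 4 * s ^+ 2); last by field.
by rewrite sE; move: m0; clear; lra.
Qed.

Lemma tail_sum (c a : R) B : 0 < c -> 0 < a ->
  \sum_(1 <= b < B.+1 | a <= c * b%:R) (b%:R * Num.sqrt b%:R)^-1 <= 6 * Num.sqrt (c / a).
Proof.
move=> c0 a0; have ac : 0 < a / c by rewrite divr_gt0.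
have q0 (x y : R) : 0 < x -> x <= y -> 6 / Num.sqrt y <= 6 / Num.sqrt x.
  move=> x0 xy; have y0 := lt_le_trans x0 xy.
  by rewrite ler_wpM2l // lef_pV2 ?posrE ?sqrtr_gt0 // ler_wsqrtr.
suff H : \sum_(1 <= b < B.+1 | a <= c * b%:R) (b%:R * Num.sqrt b%:R)^-1 +
     6 / Num.sqrt (Num.max B.+1%:R (a / c)) <= 6 * Num.sqrt (c / a).
  by apply: le_trans H; rewrite lerDl divr_ge0 // sqrtr_ge0.
have -> : Num.sqrt (c / a) = (Num.sqrt (a / c))^-1 by rewrite -sqrtrV ?invf_div // ltW.
elim: B => [|B IH].
  by rewrite big_geq // add0r q0 // le_max lexx orbT.
rewrite big_mkcond big_nat_recr //= -big_mkcond /=; case: ifPn => h.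
  apply: le_trans IH; rewrite -addrA lerD2l.
  have acB : a / c <= B.+1%:R by rewrite ler_pdivrMr // mulrC.
  rewrite (max_l acB) max_l; last by rewrite (le_trans acB) // ler_nat.
  by rewrite -lerBrDr -[B.+2%:R]natr1 inv_sqrt_step // ler1n.
apply: le_trans IH; rewrite addr0 lerD2l q0 //; first by rewrite lt_max ltr0n.
by rewrite ge_max !le_max lexx orbT ler_nat leqnSn.
Qed.

Definition ramp (N b : nat) : R := (minn b N)%:R / N%:R.

Lemma ramp_bound N b : (0 < N)%N -> 0 <= ramp N b <= b%:R / N%:R.
Proof.
by move=> N0; rewrite divr_ge0 //= ler_wpM2r ?invr_ge0 // ler_nat geq_minl.
Qed.

Lemma ramp_one N b : (0 < N)%N -> (N <= b)%N -> ramp N b = 1.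
Proof. by move=> N0 Nb; rewrite /ramp (minn_idPr Nb) divff // pnatr_eq0 -lt0n. Qed.

(** Discrete Leibniz rule. [ramp N b <= b / N] and the increments of the ramp, at most [1 / N], gain
    the factor [1 / N]; its own second difference lives only at the kink [b = N]. *)
Lemma ramp_second_difference (H : nat -> R) C N b : (0 < N)%N -> (1 < b)%N -> 0 <= C ->
  `|H b.+1| <= C / b.+1%:R -> `|H b.+1 - H b.-1| <= C / b%:R ^+ 2 ->
  `|H b.+1 - 2 * H b + H b.-1| <= C / b%:R ^+ 3 ->
  `|ramp N b.+1 * H b.+1 - 2 * (ramp N b * H b) + ramp N b.-1 * H b.-1| <=
    C / N%:R * (2 / b%:R ^+ 2 + (if b == N then b%:R^-1 else 0)).
Proof.
move=> N0 b1 C0 h1 h2 h3; have bp : (0 < b)%N by rewrite ltnW.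
have b0 : 0 < b%:R :> R by rewrite ltr0n.
have n0 : 0 < N%:R :> R by rewrite ltr0n.
have dm : 0 <= ramp N b - ramp N b.-1 <= N%:R^-1.
  rewrite -mulrBl -natrB; last by rewrite leq_min !geq_min leq_pred leqnn orbT.
  rewrite divr_ge0 //= ler_piMl ?invr_ge0 // -[1]/(1%:R) ler_nat.
  by rewrite leq_subLR addn1; case: (b) bp => // c _ /=; rewrite -minnSS leq_min geq_minl geq_min leqnSn orbT.
have dd : `|ramp N b.+1 - ramp N b - (ramp N b - ramp N b.-1)| <= if b == N then N%:R^-1 else 0.
  rewrite -!mulrBl normrM [`|N%:R^-1|]gtr0_norm ?invr_gt0 //.
  case: eqP => [->|/eqP bN].
    rewrite minnn (minn_idPr (leqnSn N)) subrr sub0r normrN (minn_idPl (leq_pred N)).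
    rewrite ler_piMl ?invr_ge0 // -natrB ?leq_pred // ger0_norm // -[1]/(1%:R) ler_nat.
    by rewrite leq_subLR addn1 prednK.
  suff -> : (minn b.+1 N)%:R - (minn b N)%:R - ((minn b N)%:R - (minn b.-1 N)%:R) = 0 :> R.
    by rewrite normr0 mul0r.
  have [bltN|] := ltnP b N.
    rewrite !(minn_idPl _) // ?(ltnW bltN) // ?(leq_trans (leq_pred _)) ?(ltnW bltN) //.
    rewrite -[b.+1%:R]natr1 -[b in LHS](prednK bp) -[b.-1.+1%:R]natr1; ring.
  rewrite leq_eqVlt eq_sym (negPf bN) /= => Nb.
  have Nb1 : (N <= b.-1)%N by rewrite -ltnS prednK.
  by rewrite (minn_idPr Nb1) (minn_idPr (leqW (ltnW Nb))) !subrr.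
rewrite (_ : _ + _ = ramp N b * (H b.+1 - 2 * H b + H b.-1) + (ramp N b - ramp N b.-1) * (H b.+1 - H b.-1)
   + (ramp N b.+1 - ramp N b - (ramp N b - ramp N b.-1)) * H b.+1); last by ring.
have /andP[g0 gb] := ramp_bound b N0; case/andP: dm => d0 d1.
have e1 : `|ramp N b * (H b.+1 - 2 * H b + H b.-1)| <= C / N%:R / b%:R ^+ 2.
  rewrite normrM (ger0_norm g0) (le_trans (ler_pM g0 _ gb h3)) // le_eqVlt; apply/orP; left; apply/eqP.
  by field; rewrite !gt_eqF.
have e2 : `|(ramp N b - ramp N b.-1) * (H b.+1 - H b.-1)| <= C / N%:R / b%:R ^+ 2.
  rewrite normrM (ger0_norm d0) (le_trans (ler_pM d0 _ d1 h2)) // le_eqVlt; apply/orP; left; apply/eqP; ring.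
have e3 : `|(ramp N b.+1 - ramp N b - (ramp N b - ramp N b.-1)) * H b.+1| <=
    C / N%:R * (if b == N then b%:R^-1 else 0).
  have hb : `|H b.+1| <= C / b%:R.
    by rewrite (le_trans h1) // ler_wpM2l // lef_pV2 ?posrE ?ltr0n // ler_nat.
  rewrite normrM (le_trans (ler_pM _ _ dd hb)) //; case: ifP => _; last by rewrite mul0r mulr0.
  by rewrite le_eqVlt; apply/orP; left; apply/eqP; ring.
rewrite (le_trans (ler_normD _ _)) // [X in _ <= X]mulrDr lerD // (le_trans (ler_normD _ _)) //.
by rewrite (le_trans (lerD e1 e2)) // le_eqVlt; apply/orP; left; apply/eqP; ring.
Qed.

(** The inner sum, over [b]. As [H] vanishes for [c b < a], only the tail of [sum b^(-3/2)] beyond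
    [a / c] enters, of size [sqrt (c / a)]. The [17] adds [4] for the start of the sum, [2 * 6] for
    the tail and [1] for the kink of the ramp; the last term is the boundary at [B]. *)
Lemma ramp_summation (T w H : nat -> R) (K C c a : R) N B :
  T 0%N = 0 -> (forall n, T n.+2 - 2 * T n.+1 + T n = w n.+1) ->
  0 <= K -> (forall n, `|T n| <= K * Num.sqrt n%:R) ->
  0 <= C -> 0 < c -> 0 < a -> (0 < N)%N -> (N <= B)%N ->
  (forall b, (0 < b)%N -> `|H b| <= C / b%:R) ->
  (forall b, (1 < b)%N -> `|H b.+1 - H b.-1| <= C / b%:R ^+ 2) ->
  (forall b, (1 < b)%N -> `|H b.+1 - 2 * H b + H b.-1| <= C / b%:R ^+ 3) ->
  (forall b, (0 < b)%N -> c * b%:R < a -> [/\ H b.-1 = 0, H b = 0 & H b.+1 = 0]) ->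
  `|\sum_(1 <= b < B.+2) w b * (ramp N b * H b)| <=
    17 * (K * C / N%:R) * Num.sqrt (c / a) + 4 * (K * C) / Num.sqrt B.+2%:R.
Proof.
move=> T0 Tw K0 HT C0 c0 a0 N0 NB H1 H2 H3 Hz.
have n0 : 0 < N%:R :> R by rewrite ltr0n.
have KC : 0 <= K * C by rewrite mulr_ge0.
have KCN : 0 <= K * C / N%:R by rewrite divr_ge0.
have ca0 : 0 < c / a by rewrite divr_gt0.
have inv_sq b : (0 < b)%N -> a <= c * b%:R -> (Num.sqrt b%:R)^-1 <= Num.sqrt (c / a).
  move=> b0 ab; have bp : 0 < b%:R :> R by rewrite ltr0n.
  rewrite -sqrtrV // ler_wsqrtr // -[b%:R^-1]div1r ler_pdivrMr // mulrAC ler_pdivlMr //.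
  by rewrite mul1r.
rewrite (@second_summation R T w (fun b => ramp N b * H b) B T0 Tw).
have e1 : `|T 1%N * (ramp N 2 * H 2%N - 2 * (ramp N 1 * H 1%N))| <= 4 * (K * C / N%:R) * Num.sqrt (c / a).
  have [ac|ca] := ltP (c * 1%:R) a.
    have [_ h1 h2] := Hz 1%N isT ac; rewrite h1 h2 !mulr0 subrr mulr0 normr0.
    by rewrite mulr_ge0 ?sqrtr_ge0 // mulr_ge0.
  have c1 : 1 <= Num.sqrt (c / a) by have := inv_sq 1%N isT ca; rewrite sqrtr1 invr1.
  have /andP[r10 r1] := ramp_bound 1 N0; have /andP[r20 r2] := ramp_bound 2 N0.
  have t1 : `|T 1%N| <= K by have := HT 1%N; rewrite sqrtr1 mulr1.
  have g2 : `|ramp N 2 * H 2%N| <= 2 / N%:R * (C / 2).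
    by rewrite normrM (ger0_norm r20) ler_pM // H1.
  have g1 : `|2 * (ramp N 1 * H 1%N)| <= 2 * (1 / N%:R * (C / 1)).
    by rewrite normrM ger0_norm // ler_wpM2l // normrM (ger0_norm r10) ler_pM // H1.
  rewrite normrM (le_trans (ler_pM _ _ t1 (le_trans (ler_normB _ _) (lerD g2 g1)))) //.
  rewrite [X in X <= _](_ : _ = 3 * (K * C / N%:R)); last by field; rewrite gt_eqF.
  rewrite -[X in X <= _]mulr1 ler_pM ?mulr_ge0 // ler_wpM2r // ler_nat //.
have e2 : `|\sum_(2 <= b < B.+2) T b * (ramp N b.+1 * H b.+1 - 2 * (ramp N b * H b) + ramp N b.-1 * H b.-1)|
    <= 13 * (K * C / N%:R) * Num.sqrt (c / a).
  rewrite (le_trans (ler_norm_sum _ _ _)) //.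
  apply: (@le_trans _ _ (\sum_(2 <= b < B.+2) K * C / N%:R *
     ((if a <= c * b%:R then 2 * (b%:R * Num.sqrt b%:R)^-1 else 0) +
      (if b == N then Num.sqrt (c / a) else 0)))).
    rewrite !big_nat; apply: ler_sum => b /andP[b1 _]; have bp := ltnW b1.
    have b0 : 0 < b%:R :> R by rewrite ltr0n.
    have s0 : 0 < Num.sqrt b%:R :> R by rewrite sqrtr_gt0.
    have sE : Num.sqrt b%:R ^+ 2 = b%:R :> R by rewrite sqr_sqrtr // ltW.
    have [ab|ba] := leP a (c * b%:R); last first.
      have [h1 h2 h3] := Hz b bp ba; rewrite h1 h2 h3 !mulr0 subrr addr0 mulr0 normr0.
      by rewrite mulr_ge0 // addr_ge0 //; case: ifP => // _; rewrite sqrtr_ge0.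
    have := ramp_second_difference N0 b1 C0 (H1 _ (ltnW (leqW b1))) (H2 _ b1) (H3 _ b1).
    move=> h; rewrite normrM (le_trans (ler_pM _ _ (HT b) h)) //.
    rewrite mulrACA [K * (C / _)]mulrA.
    rewrite ler_wpM2l // mulrDr lerD //.
      have E (s : R) : s != 0 -> s * (2 / (s ^+ 2) ^+ 2) = 2 / (s ^+ 2 * s) by move=> ?; field.
      by have := E _ (lt0r_neq0 s0); rewrite sE => ->.
    case: ifP => _; last by rewrite mulr0.
    have E (s : R) : s != 0 -> s * (s ^+ 2)^-1 = s^-1 by move=> ?; field.
    by have := E _ (lt0r_neq0 s0); rewrite sE => ->; exact: inv_sq.
  rewrite -mulr_sumr big_split /= (_ : 13 * _ * _ = K * C / N%:R * (12 * Num.sqrt (c / a) + Num.sqrt (c / a))); last by ring.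
  rewrite ler_wpM2l // lerD //.
    rewrite -big_mkcond /= -mulr_sumr (_ : 12 * _ = 2 * (6 * Num.sqrt (c / a))); last by ring.
    rewrite ler_wpM2l // (le_trans _ (tail_sum B.+1 c0 a0)) //.
    rewrite [X in _ <= X]big_ltn_cond //; case: ifP => _ //.
    by rewrite lerDr invr_ge0 mulr_ge0 ?sqrtr_ge0.
  by rewrite -big_mkcond big_nat1_eq; case: ifP; rewrite ?sqrtr_ge0.
have e3 : `|T B.+2 * (ramp N B.+1 * H B.+1) - T B.+1 * (ramp N B.+2 * H B.+2)| <= 4 * (K * C) / Num.sqrt B.+2%:R.
  have b0 : 0 < B.+1%:R :> R by rewrite ltr0n.
  have b2 : 0 < B.+2%:R :> R by rewrite ltr0n.
  have s0 : 0 < Num.sqrt B.+2%:R :> R by rewrite sqrtr_gt0.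
  rewrite (ramp_one N0 (leqW NB)) (ramp_one N0 (leqW (leqW NB))) !mul1r.
  have f1 : `|T B.+2 * H B.+1| <= K * Num.sqrt B.+2%:R * (C / B.+1%:R) by rewrite normrM ler_pM // H1.
  have f2 : `|T B.+1 * H B.+2| <= K * Num.sqrt B.+2%:R * (C / B.+1%:R).
    rewrite normrM ler_pM //.
      by rewrite (le_trans (HT _)) // ler_wpM2l // ler_wsqrtr // ler_nat.
    by rewrite (le_trans (H1 B.+2 isT)) // ler_wpM2l // lef_pV2 ?posrE // ler_nat.
  rewrite (le_trans (ler_normB _ _)) // (le_trans (lerD f1 f2)) //.
  have : Num.sqrt B.+2%:R ^+ 2 <= 2 * B.+1%:R :> R.
    by rewrite sqr_sqrtr // -natrM ler_nat mul2n -addnn addSn ltnS leq_addl.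
  rewrite -ler_pdivrMr // => h.
  rewrite (_ : _ + _ = 2 * (K * C) * (Num.sqrt B.+2%:R ^+ 2 / B.+1%:R) / Num.sqrt B.+2%:R); last by field; rewrite !gt_eqF.
  rewrite ler_wpM2r ?invr_ge0 ?(ltW s0) // (_ : 4 * _ = 2 * (K * C) * 2); last by ring.
  by rewrite ler_wpM2l // mulr_ge0.
rewrite (le_trans (ler_normD _ _)) // lerD // (le_trans (ler_normD _ _)) //.
by rewrite (le_trans (lerD e1 e2)) // le_eqVlt; apply/orP; left; apply/eqP; ring.
Qed.

End WeightedSummation.

(** * Duality for the Moebius function at exponent 1/2 *)

Section DualSum.
Context {R : realType}.

(** The eighth difference of the cosine is an eighth derivative at some point, at most
    [(2 pi / z)^8], against the factor [z^5]. *)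
Lemma cfun_bound (z : R) : 0 < z -> `|cfun z| <= kap * (2 * pi) ^+ 8 * z^-1 ^+ 3.
Proof.
move=> z0; have k0 := @kap_gt0 R; set w := 2 * pi / z.
pose us i s : R := w ^+ i * cos (w * s + i%:R * (pi / 2)).
have [||x _ E] := @fdiff_MVT R 1 8 us 9; first exact: ler01.
  move=> i s _ _; have := eps_deriv_wave (w ^+ i) w (i%:R * (pi / 2)) s.
  rewrite (mulrA (w ^+ i) w) -exprSr => h; rewrite /us -[i.+1%:R]natr1 [(i%:R + 1) * _]mulrDl mul1r addrA.
  exact: h.
rewrite expr1n mul1r in E.
have {E} E : nodes (fun s => cos (2 * pi * s / z)) = us 8%N x.
  rewrite -E; apply: fdiff_ext => i _; rewrite /us expr0 mul1r mul0r addr0.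
  by congr cos; rewrite mulrAC.
have b : `|us 8%N x| <= w ^+ 8.
  rewrite normrM ger0_norm ?exprn_ge0 ?divr_ge0 ?mulr_ge0 ?pi_ge0 ?(ltW z0) // ler_piMr //.
    by rewrite exprn_ge0 ?divr_ge0 ?mulr_ge0 ?pi_ge0 ?(ltW z0).
  by rewrite ler_norml cos_geN1 cos_le1.
have kz : 0 <= kap * z ^+ 5 by rewrite mulr_ge0 ?exprn_ge0 // ltW.
rewrite /cfun normrN normrM E (ger0_norm kz) (le_trans (ler_wpM2l kz b)) //.
rewrite /w expr_div_n; move: kap ((2 * pi) ^+ 8) => K P; rewrite le_eqVlt; apply/orP; left; apply/eqP.
by field; rewrite gt_eqF.
Qed.

Section Stencil.
Variable x : R.
Hypothesis x0 : 0 < x.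

Definition stencil (a b : nat) : R :=
  comb_kernel x a.+1%:R b%:R - 2 * comb_kernel x a%:R b%:R + comb_kernel x a.-1%:R b%:R.

(** [fcomb y] vanishes for [y >= 17]. The stencils next to [(a, b)] involve at least [a - 1] and at
    most [b + 1 <= 2 b], so [a - 1 >= 34 b / x] suffices, and [c1 b < a] implies it because
    [1 <= b]. *)
Let c1 : R := 1 + 34 / x.

Lemma stencil_zero (a b : nat) : (1 < a)%N -> (0 < b)%N -> c1 * b%:R < a%:R ->
  [/\ stencil a b.-1 = 0, stencil a b = 0 & stencil a b.+1 = 0].
Proof.
move=> a1 b0 h; have Z (a' b' : nat) : (a.-1 <= a')%N -> (b' <= b.+1)%N -> comb_kernel x a'%:R b'%:R = 0.
  move=> ha hb; have [->|bp] := posnP b'.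
    by rewrite /comb_kernel invr0 mulr0 /fcomb /comb big_nat big1 ?mulr0 // => m _; rewrite mulr0 bump_low.
  have b'0 : 0 < b'%:R :> R by rewrite ltr0n.
  rewrite /comb_kernel fcomb_high ?mulr0 // ler_pdivlMr //.
  have h1 : a%:R - 1 <= a'%:R :> R by rewrite lerBlDr natr1 ler_nat -(ltn_predK a1) ltnS.
  have h2 : b'%:R <= 2 * b%:R :> R.
    by rewrite -natrM ler_nat (leq_trans hb) // mul2n -addnn -add1n leq_add2r.
  have b1 : 1 <= b%:R :> R by rewrite ler1n.
  have h3 : 34 / x * b%:R <= a'%:R.
    by move: h h1 b1; rewrite /c1 mulrDl mul1r; clear; lra.
  rewrite (le_trans (ler_wpM2l (ler0n _ 17) h2)) // mulrA -natrM.
  by move: h3; rewrite mulrAC ler_pdivrMr.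
have SZ b' : (b' <= b.+1)%N -> stencil a b' = 0.
  move=> hb; rewrite /stencil (Z a.+1) ?(leq_trans (leq_pred a) (leqnSn a)) // (Z a) ?leq_pred //.
  by rewrite (Z a.-1) // mulr0 subrr addr0.
by split; apply: SZ => //; rewrite ?leqnSn // (leq_trans (leq_pred b)).
Qed.

(** Beyond [a <= c1 b] everything vanishes. Within, [comb_kernel_fdiff] is applied at [t = b] or at
    the leftmost point [t = b - 1], with [r = 4 c1] because [a + 1 <= 2 c1 b <= 4 c1 t]. Replacing
    [b - 1] by [b] costs at most [2^3], the factor [8]. *)
Lemma stencil_bound : exists2 C, 0 <= C & forall a : nat, (1 < a)%N ->
  [/\ forall b, (0 < b)%N -> `|stencil a b| <= C / b%:R,
      forall b, (1 < b)%N -> `|stencil a b.+1 - stencil a b.-1| <= C / b%:R ^+ 2 &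
      forall b, (1 < b)%N -> `|stencil a b.+1 - 2 * stencil a b + stencil a b.-1| <= C / b%:R ^+ 3].
Proof.
have c10 : 0 < 34 / x by rewrite divr_gt0.
have c11 : 1 <= c1 by rewrite lerDl ltW.
have r1 : 1 <= 4 * c1 by rewrite (@le_trans _ _ (4 * 1)) ?ler_wpM2l // mulr1 ler1n.
have [C C0 HC] := comb_kernel_fdiff x0 r1.
exists (8 * C); first by rewrite mulr_ge0.
move=> a a1; have a2 : 2 <= a%:R :> R by rewrite ler_nat.
have SE b : stencil a b = fdiff 1 2 (fun s => comb_kernel x s b%:R) (a%:R - 1).
  rewrite /stencil /= subrK -[a.+1%:R]natr1 -[a in a.-1%:R](ltn_predK a1) /= .
  rewrite (_ : a%:R - 1 = a.-1%:R); last by rewrite -[a in LHS](ltn_predK a1) -natr1 addrK.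
  by move: (comb_kernel _ _ _) (comb_kernel _ _ _) (comb_kernel _ _ _) => *; ring.
have half b : (1 < b)%N -> 0 < b%:R - 1 :> R /\ b%:R <= 2 * (b%:R - 1) :> R.
  by move=> b1; have : 2 <= b%:R :> R; [rewrite ler_nat|clear; split; lra].
have art b t : (0 < b)%N -> a%:R <= c1 * b%:R -> b%:R <= 2 * t -> a%:R + 1 <= 4 * c1 * t.
  move=> b0 ab bt; rewrite (@le_trans _ _ (2 * (c1 * b%:R))) //; first by move: a2 ab; clear; lra.
  have := ler_wpM2l (le_trans ler01 c11) bt; clear; lra.
have inv b k : (1 < b)%N -> (b%:R - 1)^-1 ^+ k <= 2 ^+ k / b%:R ^+ k :> R.
  move=> /half[h1 h2]; rewrite -expr_div_n lerXn2r ?nnegrE ?invr_ge0 ?divr_ge0 ?(ltW h1) //.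
  by rewrite ler_pdivlMr ?(lt_le_trans h1) ?gerBl // mulrC ler_pdivrMr.
split=> b bp.
- have [ab|ba] := leP a%:R (c1 * b%:R); last first.
    by have [_ -> _] := stencil_zero a1 bp ba; rewrite normr0 divr_ge0 // mulr_ge0.
  have b0 : 0 < b%:R :> R by rewrite ltr0n.
  have := HC 0 0%N a%:R b%:R (lexx 0) (ler0n _ 2) isT b0 a2; rewrite SE /= expr1 => h.
  rewrite (le_trans (h _)) //; last by rewrite ler_wpM2r ?invr_ge0 // ler_peMl // ler1n.
  by apply: (art b) => //; rewrite mulr_natl mulr2n lerDl.
- have [ab|ba] := leP a%:R (c1 * b%:R); last first.
    have [-> _ ->] := stencil_zero a1 (ltnW bp) ba.
    by rewrite subrr normr0 divr_ge0 ?exprn_ge0 // mulr_ge0.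
  have [t0 bt] := half b bp.
  have := HC 2 1%N a%:R (b%:R - 1) (ler0n _ 2) (lexx 2) isT t0 a2 (art _ _ (ltnW bp) ab bt) => h.
  rewrite (_ : _ - _ = fdiff 1 2 (fun s => fdiff 2 1 (comb_kernel x s) (b%:R - 1)) (a%:R - 1)).
    rewrite (le_trans h) // (le_trans (ler_wpM2l C0 (inv _ _ bp))) // mulrA ler_wpM2r ?invr_ge0 ?exprn_ge0 //.
    by rewrite mulrC ler_wpM2r // -natrX ler_nat.
  rewrite !SE fdiff_swap [RHS]/= -[b in b.-1%:R](ltn_predK bp) /=.
  rewrite (_ : b%:R - 1 = b.-1%:R); last by rewrite -[b in LHS](ltn_predK bp) -natr1 addrK.
  by rewrite -natrD addn2 (ltn_predK bp).
have [ab|ba] := leP a%:R (c1 * b%:R); last first.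
  have [-> -> ->] := stencil_zero a1 (ltnW bp) ba.
  by rewrite mulr0 subrr addr0 normr0 divr_ge0 ?exprn_ge0 // mulr_ge0.
have [t0 bt] := half b bp.
have := HC 1 2%N a%:R (b%:R - 1) ler01 (ler_nat R 1 2) isT t0 a2 (art _ _ (ltnW bp) ab bt) => h.
rewrite (_ : _ - _ + _ = fdiff 1 2 (fun s => fdiff 1 2 (comb_kernel x s) (b%:R - 1)) (a%:R - 1)).
  rewrite (le_trans h) // (le_trans (ler_wpM2l C0 (inv _ _ bp))) // mulrA ler_wpM2r ?invr_ge0 ?exprn_ge0 //.
  by rewrite mulrC ler_wpM2r // -natrX ler_nat.
rewrite !SE [RHS]fdiff_swap; set u := fun b => fdiff 1 2 (_^~ b) _.
rewrite -/(u b.+1%:R) -/(u b%:R) -/(u b.-1%:R) /=.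
rewrite subrK natr1 (_ : b%:R - 1 = b.-1%:R); last by rewrite -[b in LHS](ltn_predK bp) -natr1 addrK.
by move: (u _) (u _) (u _) => *; ring.
Qed.

End Stencil.

End DualSum.

(** * Exchange of the two Moebius sums *)

Section MoebiusDuality.
Context {R : realType}.
Variable T : nat -> R.
Hypothesis HT : moebius_primitive 2^-1 T.

Lemma primitive_sqrt : exists2 K, 0 <= K & forall n, `|T n| <= K * Num.sqrt n%:R.
Proof.
by have [K K0 HK] := moebius_primitive_bound HT; exists K => // n; rewrite -powR12_sqrt.
Qed.

(** A Cesaro mean: [|T a| / sqrt a] tends to [0], and the finitely many exceptions contribute at
    most [S], negligible against [N]. *)
Lemma primitive_average (q e : R) : 0 < q -> 0 < e -> exists N1, forall N A, (N1 <= N)%N ->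
  A%:R <= q * N%:R -> \sum_(1 <= a < A.+1) `|T a| / Num.sqrt a%:R <= e * N%:R.
Proof.
move=> q0 e0; have [_ _ HTe] := HT; have [K K0 HK] := primitive_sqrt.
have d0 : 0 < e / (2 * q) by rewrite divr_gt0 // mulr_gt0.
have [n0 Hn0] := HTe _ d0; pose S := K * n0%:R.
exists (Num.truncn (2 * S / e)).+1 => N A NN Aq.
have t1 a : (0 < a)%N -> `|T a| / Num.sqrt a%:R <= (if (a < n0)%N then K else 0) + e / (2 * q).
  move=> a0; have s0 : 0 < Num.sqrt a%:R :> R by rewrite sqrtr_gt0 ltr0n.
  rewrite ler_pdivrMr //; have [h|h] := ltnP a n0.
    by rewrite (le_trans (HK a)) // ler_wpM2r ?(ltW s0) // lerDl ltW.
  by rewrite add0r -powR12_sqrt // Hn0.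
apply: (@le_trans _ _ (S + A%:R * (e / (2 * q)))).
  apply: (@le_trans _ _ (\sum_(1 <= a < A.+1) ((if (a < n0)%N then K else 0) + e / (2 * q)))).
    by rewrite !big_nat; apply: ler_sum => a /andP[a0 _]; exact: t1.
  rewrite big_split /= lerD //; last first.
    by rewrite sumr_const_nat subn1 /= [X in _ <= X]mulr_natl.
  suff H : \sum_(1 <= a < A.+1) (if (a < n0)%N then K else 0) <= K * (minn A n0)%:R.
    by rewrite (le_trans H) // /S ler_wpM2l // ler_nat geq_minr.
  elim: A {Aq} => [|A IH]; first by rewrite big_geq // mulr_ge0.
  rewrite big_nat_recr //= (le_trans (lerD IH (lexx _))) //; case: ifPn => h.
    rewrite (minn_idPl (ltnW h)) (minn_idPl (ltnW (ltnW h))).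
    by rewrite -[A.+1%:R]natr1 mulrDr mulr1.
  by rewrite addr0 ler_wpM2l // ler_nat leq_min geq_minr geq_min leqnSn.
have hS : S <= e / 2 * N%:R.
  rewrite mulrC -ler_pdivrMr ?divr_gt0 // (_ : S / (e / 2) = 2 * S / e); last by field; rewrite gt_eqF.
  by rewrite ltW // (lt_le_trans (truncnS_gt _)) // ler_nat.
have hA : A%:R * (e / (2 * q)) <= e / 2 * N%:R.
  rewrite (le_trans (ler_wpM2r (ltW d0) Aq)) // le_eqVlt; apply/orP; left; apply/eqP; field.
  by rewrite gt_eqF.
by rewrite (le_trans (lerD hS hA)) // -mulrDl -splitr.
Qed.

Variable x : R.
Hypotheses (x0 : 0 < x) (x18 : x <= 18).

Let w (b : nat) : R := (moebius b)%:~R / b%:R.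

(* The ramp makes the exchange of the sums over [a] and [b] possible: a second difference in [a]
   and one in [b] then bring the sum down to [T n = o(sqrt n)]. *)
Let smoothed N B (a : nat) : R := \sum_(1 <= b < B.+2) w b * (ramp N b * comb_kernel x a%:R b%:R).

Let partial B (a : nat) : R := \sum_(1 <= b < B.+2) w b * fcomb (a%:R * x / b%:R).

Let w_le b : `|w b| <= b%:R^-1.
Proof.
rewrite normrM [`|b%:R^-1|]ger0_norm ?invr_ge0 // ler_piMl ?invr_ge0 //.
by rewrite -intr_norm -[1]/(1%:~R) ler_int moebius_norm.
Qed.

Let moebius1 : moebius 1 = 1. Proof. by []. Qed.

(** The defect [1 - ramp N b] is supported on [b < N], where [a <= A] reaches far enough for
    [moebius_fcomb] to return [bump (x / b)]. For [b >= 2] the argument is at most [9], so only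
    [b = 1] survives, with ramp value [1 / N]. *)
Lemma smoothed_sum N B A : (0 < N)%N -> (0 < A)%N -> 17 * N%:R / x <= A%:R ->
  \sum_(1 <= a < A.+1) (moebius a)%:~R / a%:R * smoothed N B a =
  \sum_(1 <= a < A.+1) (moebius a)%:~R * partial B a - (1 - N%:R^-1) * bump x.
Proof.
move=> N0 A0 NA; apply/eqP; rewrite -subr_eq opprK; apply/eqP.
have -> : (1 - N%:R^-1) * bump x = \sum_(1 <= b < B.+2) w b * (1 - ramp N b) * bump (x / b%:R).
  rewrite big_ltn // big_nat big1 => [|b /andP[b1 _]].
    by rewrite addr0 /w moebius1 divr1 mul1r divr1 /ramp (minn_idPl N0) div1r.
  rewrite bump_low ?mulr0 // ler_pdivrMr ?ltr0n 1?ltnW // (le_trans x18) //.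
  by rewrite -[18]/(18%:R) (_ : 18%:R = 9 * 2%:R :> R) ?ler_wpM2l ?ler_nat //; ring.
have -> : \sum_(1 <= b < B.+2) w b * (1 - ramp N b) * bump (x / b%:R) =
   \sum_(1 <= b < B.+2) w b * (1 - ramp N b) *
     \sum_(1 <= a < A.+1) (moebius a)%:~R * fcomb (a%:R * (x / b%:R)).
  rewrite !big_nat; apply: eq_bigr => b /andP[b1 _]; have b0 : 0 < b%:R :> R by rewrite ltr0n.
  have [bN|Nb] := leqP b N; last by rewrite ramp_one ?(ltnW Nb) // subrr mulr0 !mul0r.
  rewrite moebius_fcomb ?divr_gt0 // (le_trans _ NA) // invf_div mulrA ler_wpM2r ?invr_ge0 ?(ltW x0) //.
  by rewrite ler_wpM2l // ler_nat.
under [X in _ + X]eq_bigr do rewrite mulr_sumr.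
rewrite exchange_big /= -big_split !big_nat; apply: eq_bigr => a /andP[a1 _] /=.
have an0 : a%:R != 0 :> R by rewrite pnatr_eq0 -lt0n.
rewrite /smoothed /partial !mulr_sumr -big_split; apply: eq_bigr => b _ /=.
rewrite /comb_kernel [a%:R * (x / b%:R)]mulrA.
by move: (fcomb _) (ramp _ _) (w b) => F r v; field.
Qed.

Lemma smoothed_stencil N B a : (0 < a)%N ->
  smoothed N B a.+1 - 2 * smoothed N B a + smoothed N B a.-1 =
  \sum_(1 <= b < B.+2) w b * (ramp N b * stencil x a b).
Proof.
move=> _; rewrite /smoothed mulr_sumr -sumrB -big_split; apply: eq_bigr => b _ /=.
by rewrite /stencil; ring.
Qed.

(** [fcomb y = O(y^5)] makes the sum over [b] converge absolutely, and the ramp supplies [1 / N].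
    The [128] is [2^6], from [a^6], times the bound [2] on [sum b^-2]. *)
Lemma smoothed_small N B a : (0 < N)%N -> (0 < a)%N -> (a <= 2)%N ->
  `|smoothed N B a| <= 128 * (768 * kap * x ^+ 5) / N%:R.
Proof.
move=> N0 a0 a2; set Q := 768 * kap * x ^+ 5.
have Q0 : 0 <= Q := mulr_ge0 (mulr_ge0 (ler0n _ 768) (ltW kap_gt0)) (exprn_ge0 5 (ltW x0)).
have NN : 0 < N%:R :> R by rewrite ltr0n.
have P0 : 0 <= 64 * Q / N%:R by rewrite divr_ge0 // mulr_ge0.
rewrite (_ : _ / _ = 64 * Q / N%:R * 2); last by ring.
rewrite (le_trans _ (ler_wpM2l P0 (sum_invsq_le B.+1))) // (le_trans (ler_norm_sum _ _ _)) //.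
rewrite mulr_sumr !big_nat; apply: ler_sum => b /andP[b1 _].
have b0 : 0 < b%:R :> R by rewrite ltr0n.
have ap : 0 < a%:R :> R by rewrite ltr0n.
have /andP[r0 r1] := @ramp_bound R N b N0.
have F1 : `|comb_kernel x a%:R b%:R| <= 64 * Q * b%:R^-1 ^+ 5.
  have y0 : 0 < a%:R * x / b%:R by rewrite divr_gt0 // mulr_gt0.
  rewrite normrM (gtr0_norm ap) (le_trans (ler_wpM2l (ltW ap) (fcomb_bound y0))) //.
  rewrite [X in X <= _](_ : _ = a%:R ^+ 6 * (Q * b%:R^-1 ^+ 5)); last first.
    by rewrite /Q expr_div_n !exprMn exprVn; move: kap => k; ring.
  rewrite -[X in _ <= X]mulrA ler_wpM2r //; first by rewrite mulr_ge0 // exprn_ge0 // invr_ge0 ltW.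
  by rewrite -natrX ler_nat (leq_trans (_ : _ <= 2 ^ 6)%N) // leq_exp2r.
rewrite normrM (le_trans (ler_pM _ _ (w_le b) (_ : `|ramp N b * _| <= b%:R / N%:R * (64 * Q * b%:R^-1 ^+ 5)))) //.
  by rewrite normrM (ger0_norm r0) ler_pM.
rewrite [X in X <= _](_ : _ = 64 * Q / N%:R * b%:R^-1 ^+ 5); last first.
  by rewrite mulrA (mulrA b%:R^-1) mulVf ?gt_eqF // mul1r mulrA [N%:R^-1 * _]mulrC.
by rewrite ler_wpM2l // -exprVn ler_wiXn2l // ?invr_ge0 ?(ltW b0) // invf_le1 // ler1n.
Qed.

Lemma partial_cfun B a : (0 < a)%N ->
  `|partial B a - cfun (a%:R * x)| <= 2048 * kap * x ^+ 5 * a%:R ^+ 5 / B.+1%:R.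
Proof.
move=> a0; have y0 : 0 < a%:R * x by rewrite mulr_gt0 // ltr0n.
have := @cfun_limit R (a%:R * x) B.+1 y0 isT; rewrite exprMn [a%:R ^+ 5 * _]mulrC mulrA.
exact.
Qed.

(** For [a x >= 17 N] the terms with [b <= N] vanish and the ramp is [1] on the others: the sum is
    [a * partial B a], close to [a * cfun (a x) = O(a^-2)]. *)
Lemma smoothed_large N B a : (0 < N)%N -> (0 < a)%N -> 17 * N%:R / x <= a%:R ->
  `|smoothed N B a| <= kap * (2 * pi) ^+ 8 * x^-1 ^+ 3 * a%:R^-1 ^+ 2 + 2048 * kap * x ^+ 5 * a%:R ^+ 6 / B.+1%:R.
Proof.
move=> N0 a0 Na; have ap : 0 < a%:R :> R by rewrite ltr0n.
have -> : smoothed N B a = a%:R * cfun (a%:R * x) + a%:R * (partial B a - cfun (a%:R * x)).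
  rewrite -mulrDr addrC subrK /smoothed /partial mulr_sumr !big_nat; apply: eq_bigr => b /andP[b1 _].
  rewrite /comb_kernel; have [bN|Nb] := leqP b N; last first.
    by rewrite ramp_one ?(ltnW Nb) // mul1r mulrCA.
  rewrite fcomb_high ?mulr0 ?mulr0 // ler_pdivlMr ?ltr0n //.
  move: Na; rewrite ler_pdivrMr //; apply: le_trans; by rewrite ler_wpM2l // ler_nat.
rewrite (le_trans (ler_normD _ _)) // lerD // normrM (gtr0_norm ap).
  have := cfun_bound (mulr_gt0 ap x0) => /(ler_wpM2l (ltW ap))/le_trans; apply.
  rewrite invfM exprMn; move: (kap * _) => k; rewrite le_eqVlt; apply/orP; left; apply/eqP.
  by field; rewrite !gt_eqF.
rewrite (le_trans (ler_wpM2l (ltW ap) (partial_cfun B a0))) // le_eqVlt; apply/orP; left; apply/eqP.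
by move: kap => k; ring.
Qed.

(** By [smoothed_sum] it is enough that [sum_a mu(a) / a * smoothed N B a] be small. After two
    summations by parts in [a], [ramp_summation] bounds the interior by
    [L2 / N * sum |T a| / sqrt a], [smoothed_small] the lower end and [smoothed_large] the upper
    one. The parameters are chosen in the order [N], then [A] of order [N], then [B], so large that
    the errors growing with [A] disappear. *)
Lemma dual_sum e : 0 < e -> forall N0, exists2 A, (N0 <= A)%N &
  `|\sum_(1 <= a < A.+1) (moebius a)%:~R * cfun (a%:R * x) - bump x| <= e.
Proof.
move=> e0 N0; have [T0 Tw _] := HT; have [K K0 HK] := primitive_sqrt.
have [C C0 HC] := @stencil_bound R x x0.
pose c1 : R := 1 + 34 / x; have c10 : 0 < c1 by rewrite addr_gt0 // divr_gt0.
have Tw' n : T n.+2 - 2 * T n.+1 + T n = w n.+1 := Tw n.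
have [Q Q0 Hsmall] : exists2 Q, 0 <= Q & forall N B a, (0 < N)%N -> (0 < a)%N -> (a <= 2)%N ->
    `|smoothed N B a| <= 128 * Q / N%:R.
  exists (768 * kap * x ^+ 5); last by move=> N B a; exact: smoothed_small.
  exact: mulr_ge0 (mulr_ge0 (ler0n _ 768) (ltW kap_gt0)) (exprn_ge0 5 (ltW x0)).
have [K4 K40 Hpartial] : exists2 K4, 0 <= K4 & (forall B a, (0 < a)%N ->
    `|partial B a - cfun (a%:R * x)| <= K4 * a%:R ^+ 5 / B.+1%:R) /\
    exists2 K3, 0 <= K3 & forall N B a, (0 < N)%N -> (0 < a)%N -> 17 * N%:R / x <= a%:R ->
    `|smoothed N B a| <= K3 * a%:R^-1 ^+ 2 + K4 * a%:R ^+ 6 / B.+1%:R.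
  exists (2048 * kap * x ^+ 5).
    exact: mulr_ge0 (mulr_ge0 (ler0n _ 2048) (ltW kap_gt0)) (exprn_ge0 5 (ltW x0)).
  split; first by move=> B a; exact: partial_cfun.
  exists (kap * (2 * pi) ^+ 8 * x^-1 ^+ 3); last by move=> N B a; exact: smoothed_large.
  apply: mulr_ge0; last by rewrite exprn_ge0 ?invr_ge0 ?(ltW x0).
  by apply: (mulr_ge0 (ltW kap_gt0)); rewrite exprn_ge0 // mulr_ge0 ?pi_ge0.
have {Hpartial} [Hpartial [K3 K30 Hlarge]] := Hpartial.
(* All terms of [L1] enter with the factor [1 / N]; [384 = 128 + 2 * 128] bounds
   [smoothed N B 2 - 2 * smoothed N B 1]. *)
pose L1 := K * (384 * Q) + 4 * (K * K3) * x + `|bump x|.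
have L10 : 0 <= L1 by rewrite /L1 !addr_ge0 ?mulr_ge0 ?ler0n ?normr_ge0 ?(ltW x0).
pose L2 := 17 * (K * C) * Num.sqrt c1.
have L20 : 0 <= L2 by rewrite /L2 !mulr_ge0 ?sqrtr_ge0.
pose q := 17 / x + 1; have q0 : 0 < q by rewrite addr_gt0 // divr_gt0.
have L21 : 0 < L2 + 1 by rewrite ltr_wpDl.
have [N1 HN1] := primitive_average q0 (divr_gt0 e0 (mulr_gt0 (ltr0n R 2) L21)).
(* The entry [2 * N0] ensures [N0 <= A], since [A >= 17 N / x >= 17 N / 18]. *)
pose N := maxn (maxn N1 (2 * N0)%N) (Num.truncn (2 * L1 / e)).+1.
have NN : (0 < N)%N by rewrite /N leq_max orbT.
have Np : 0 < N%:R :> R by rewrite ltr0n.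
have NL : L1 / N%:R <= e / 2.
  rewrite ler_pdivrMr // [X in _ <= X]mulrC -ler_pdivrMr ?divr_gt0 //.
  rewrite (_ : L1 / (e / 2) = 2 * L1 / e); last by field; rewrite gt_eqF.
  by rewrite ltW // (lt_le_trans (truncnS_gt _)) // ler_nat leq_maxr.
pose A' := Num.truncn (17 * N%:R / x); pose A := A'.+1.
have NA : 17 * N%:R / x <= A%:R by rewrite ltW // truncnS_gt.
have AN : A%:R <= q * N%:R.
  have h : A'%:R <= 17 * N%:R / x.
    have p : 0 <= 17 * N%:R / x by rewrite divr_ge0 ?mulr_ge0 // ltW.
    by have /andP[] := truncn_itv p.
  rewrite -natr1 /q mulrDl mul1r lerD ?ler1n // (le_trans h) // le_eqVlt; apply/orP; left; apply/eqP; ring.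
have N0A : (N0 <= A)%N.
  rewrite -(ler_nat R) (le_trans _ NA) // ler_pdivlMr // (le_trans (ler_wpM2l _ x18)) //.
  have h : 2 * N0%:R <= N%:R :> R by rewrite -natrM ler_nat /N leq_max leq_max leqnn orbT.
  by have := ler0n R N0; move: h; clear; lra.
have Ap : 0 < A%:R :> R by rewrite ltr0n.
exists A => //.
have sle (n : nat) : Num.sqrt n%:R <= n%:R :> R.
  case: n => [|n]; first by rewrite sqrtr0.
  rewrite -[X in _ <= X](@sqr_sqrtr _ n.+1%:R) // expr2 ler_peMl ?sqrtr_ge0 //.
  by rewrite -[X in X <= _]sqrtr1 ler_wsqrtr // ler1n.
have Binv (B : nat) : B.+1%:R^-1 <= 2 / Num.sqrt B.+2%:R :> R.
  rewrite ler_pdivlMr ?sqrtr_gt0 // mulrC ler_pdivrMr ?ltr0n // (le_trans (sle _)) //.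
  by rewrite -natrM ler_nat mul2n -addnn addSn ltnS leq_addl.
have main B : (N < B)%N -> `|\sum_(1 <= a < A.+1) (moebius a)%:~R * partial B a - (1 - N%:R^-1) * bump x| <=
    (K * (384 * Q) + 4 * (K * K3) * x) / N%:R + L2 / N%:R * (\sum_(1 <= a < A.+1) `|T a| / Num.sqrt a%:R) +
    (4 * (K * C) * (\sum_(1 <= a < A.+1) `|T a|) + 2 * (K * A.+1%:R * (K4 * A.+1%:R ^+ 6))) * (2 / Num.sqrt B.+2%:R).
  move=> NB; have NB' := ltnW NB.
  have sB0 : 0 < Num.sqrt B.+2%:R :> R by rewrite sqrtr_gt0.
  rewrite -(@smoothed_sum N B A NN isT NA) (@second_summation R T w (smoothed N B) A' T0 Tw').
  have e1 : `|T 1%N * (smoothed N B 2 - 2 * smoothed N B 1)| <= K * (384 * Q) / N%:R.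
    have t1 : `|T 1%N| <= K by have := HK 1%N; rewrite sqrtr1 mulr1.
    have b2 := Hsmall N B 2%N NN isT isT; have b1 := Hsmall N B 1%N NN isT isT.
    rewrite -mulrA normrM ler_pM // (le_trans (ler_normB _ _)) // normrM ger0_norm //.
    rewrite (_ : 384 * Q / N%:R = 128 * Q / N%:R + 2 * (128 * Q / N%:R)); last by ring.
    by rewrite lerD // ler_wpM2l.
  have e2 : `|\sum_(2 <= a < A'.+2) T a * (smoothed N B a.+1 - 2 * smoothed N B a + smoothed N B a.-1)| <=
     L2 / N%:R * (\sum_(1 <= a < A.+1) `|T a| / Num.sqrt a%:R) +
     4 * (K * C) * (\sum_(1 <= a < A.+1) `|T a|) * (1 / Num.sqrt B.+2%:R).
    rewrite (le_trans (ler_norm_sum _ _ _)) //.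
    apply: (@le_trans _ _ (\sum_(1 <= a < A.+1) (L2 / N%:R * (`|T a| / Num.sqrt a%:R) +
       4 * (K * C) * (1 / Num.sqrt B.+2%:R) * `|T a|))).
      have Z (a : nat) : 0 <= L2 / N%:R * (`|T a| / Num.sqrt a%:R) + 4 * (K * C) * (1 / Num.sqrt B.+2%:R) * `|T a|.
        by rewrite addr_ge0 ?mulr_ge0 ?divr_ge0 ?sqrtr_ge0.
      rewrite [X in _ <= X]big_ltn // (le_trans _ (lerD (Z 1%N) (lexx _))) // add0r.
      rewrite !big_nat; apply: ler_sum => a /andP[a1 _].
      have ap : 0 < a%:R :> R by rewrite ltr0n ltnW.
      have sa0 : 0 < Num.sqrt a%:R :> R by rewrite sqrtr_gt0.
      have [H1 H2 H3] := HC a a1.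
      rewrite smoothed_stencil ?(ltnW a1) // normrM.
      have := @ramp_summation R T w (stencil x a) K C c1 a%:R N B T0 Tw' K0 HK C0 c10 ap NN NB' H1 H2 H3.
      move=> /(_ (fun b b0 h => stencil_zero x0 a1 b0 h))/(ler_wpM2l (normr_ge0 (T a)))/le_trans; apply.
      rewrite sqrtrM ?(ltW c10) // sqrtrV ?(ltW ap) // /L2 le_eqVlt; apply/orP; left; apply/eqP; ring.
    rewrite big_split /= -!mulr_sumr lerD2l le_eqVlt; apply/orP; left; apply/eqP; ring.
  have B2 := Binv B.
  have sl (a : nat) : (A <= a)%N -> (a <= A.+1)%N ->
      `|smoothed N B a| <= K3 * A%:R^-1 ^+ 2 + K4 * A.+1%:R ^+ 6 / B.+1%:R.
    move=> Aa aA; have ap : 0 < a%:R :> R by rewrite ltr0n (leq_trans _ Aa).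
    rewrite (le_trans (Hlarge N B a NN (leq_trans (ltn0Sn _) Aa) _)) //.
      by rewrite (le_trans NA) // ler_nat.
    rewrite lerD //.
      apply: (ler_wpM2l K30); rewrite lerXn2r ?nnegrE ?invr_ge0 // lef_pV2 ?posrE // ler_nat //.
    rewrite ler_wpM2r ?invr_ge0 //; apply: (ler_wpM2l K40).
    by rewrite lerXn2r ?nnegrE // ler_nat.
  have e3 : `|T A'.+2 * smoothed N B A'.+1 - T A'.+1 * smoothed N B A'.+2| <=
     4 * (K * K3) * x / N%:R + 2 * (K * A.+1%:R * (K4 * A.+1%:R ^+ 6)) * (2 / Num.sqrt B.+2%:R).
    have f (n m : nat) : (n <= A.+1)%N -> (A <= m)%N -> (m <= A.+1)%N ->
       `|T n * smoothed N B m| <= K * A.+1%:R * (K3 * A%:R^-1 ^+ 2 + K4 * A.+1%:R ^+ 6 / B.+1%:R).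
      move=> nA Am mA; rewrite normrM ler_pM ?sl //.
      rewrite (le_trans (HK n)) // ler_wpM2l // (le_trans (sle n)) // ler_nat //.
    rewrite (le_trans (ler_normB _ _)) // (le_trans (lerD (f _ _ _ _ _) (f _ _ _ _ _))) //.
    rewrite -mulr2n -[X in X <= _]mulr_natl mulrDr mulrDr lerD //.
      rewrite (_ : 2 * _ = 2 * (K * K3) * (A.+1%:R * A%:R^-1 ^+ 2)); last by ring.
      rewrite (_ : _ / N%:R = 2 * (K * K3) * (2 * (x / N%:R))); last by ring.
      rewrite ler_wpM2l ?mulr_ge0 //.
      have xn : A%:R^-1 <= x / N%:R.
        rewrite -[x / N%:R]invf_div lef_pV2 ?posrE ?divr_gt0 // (le_trans _ NA) // ler_wpM2r ?invr_ge0 ?(ltW x0) //.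
        by rewrite ler_peMl // ler1n.
      rewrite (@le_trans _ _ (2 * A%:R^-1)) ?ler_wpM2l //.
      rewrite expr2 mulrA ler_wpM2r ?invr_ge0 // ler_pdivrMr // -natrM ler_nat mul2n -addnn.
      by rewrite -addn1 leq_add2l.
    rewrite [X in X <= _](_ : _ = 2 * (K * A.+1%:R * (K4 * A.+1%:R ^+ 6)) * B.+1%:R^-1); last by ring.
    apply: (ler_wpM2l _ B2); apply: (mulr_ge0 (ler0n _ 2)); apply: mulr_ge0; first exact: mulr_ge0.
    by apply: (mulr_ge0 K40); rewrite exprn_ge0.
  rewrite (le_trans (ler_normD _ _)) // (le_trans (lerD (ler_normD _ _) (lexx _))) //.
  rewrite (le_trans (lerD (lerD e1 e2) e3)) //.
  have : 4 * (K * C) * (\sum_(1 <= a < A.+1) `|T a|) * (1 / Num.sqrt B.+2%:R) <=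
     4 * (K * C) * (\sum_(1 <= a < A.+1) `|T a|) * (2 / Num.sqrt B.+2%:R).
    have h12 : 1 / Num.sqrt B.+2%:R <= 2 / Num.sqrt B.+2%:R :> R by rewrite ler_wpM2r ?invr_ge0 ?sqrtr_ge0 // ler1n.
    apply: (ler_wpM2l _ h12); apply: mulr_ge0; last by rewrite sumr_ge0.
    by apply: (mulr_ge0 (ler0n _ 4)); apply: mulr_ge0.
  by lra.
(* [D] gathers the errors carrying [1 / sqrt B]; [N] and [A] are fixed by now. *)
pose D := 4 * (K * C) * (\sum_(1 <= a < A.+1) `|T a|) + 2 * (K * A.+1%:R * (K4 * A.+1%:R ^+ 6)) + K4 * A.+1%:R ^+ 6.
have D0 : 0 <= D by rewrite /D !addr_ge0 // !mulr_ge0 ?sumr_ge0 ?exprn_ge0.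
pose z := 4 * D * (L2 + 1) / e; have z0 : 0 <= z by rewrite divr_ge0 ?mulr_ge0 // ltW.
pose B := maxn N.+1 (Num.truncn (z ^+ 2)).+1.
have sB0 : 0 < Num.sqrt B.+2%:R :> R by rewrite sqrtr_gt0.
have zB : z <= Num.sqrt B.+2%:R.
  rewrite -[z]ger0_norm // -sqrtr_sqr ler_wsqrtr // ltW // (lt_le_trans (truncnS_gt _)) // ler_nat.
  by rewrite (leq_trans (leq_maxr N.+1 _)) // (leq_trans (leqnSn _)).
have DB : D * (2 / Num.sqrt B.+2%:R) <= e / (2 * (L2 + 1)).
  rewrite mulrA ler_pdivrMr // mulrAC ler_pdivlMr ?mulr_gt0 //.
  by move: zB; rewrite ler_pdivrMr //; clear; lra.
have h1 := main B (leq_maxl _ _).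
have h2 : `|\sum_(1 <= a < A.+1) (moebius a)%:~R * cfun (a%:R * x) - \sum_(1 <= a < A.+1) (moebius a)%:~R * partial B a|
    <= K4 * A.+1%:R ^+ 6 * (2 / Num.sqrt B.+2%:R).
  rewrite -sumrB (le_trans (ler_norm_sum _ _ _)) //.
  apply: (@le_trans _ _ (\sum_(1 <= a < A.+1) K4 * A.+1%:R ^+ 5 / B.+1%:R)).
    rewrite !big_nat; apply: ler_sum => a /andP[a1 aA]; rewrite -mulrBr normrM.
    rewrite (le_trans (_ : _ <= 1 * (K4 * a%:R ^+ 5 / B.+1%:R))) //.
      by rewrite ler_pM // 1?distrC ?Hpartial // -intr_norm -[1]/(1%:~R) ler_int moebius_norm.
    rewrite mul1r ler_wpM2r ?invr_ge0 // ler_wpM2l // lerXn2r ?nnegrE // ler_nat ltnW //.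
  rewrite sumr_const_nat subn1 /= -[X in X <= _]mulr_natr.
  rewrite (_ : _ * A%:R = K4 * A.+1%:R ^+ 5 * A%:R * B.+1%:R^-1); last by ring.
  rewrite ler_pM ?mulr_ge0 ?exprn_ge0 ?invr_ge0 ?Binv //.
  by rewrite -mulrA ler_wpM2l // [X in _ <= X]exprSr ler_wpM2l ?exprn_ge0 // ler_nat.
have h3 := HN1 N A (leq_trans (leq_maxl _ _) (leq_maxl _ _)) AN.
have h4 : L2 / N%:R * (\sum_(1 <= a < A.+1) `|T a| / Num.sqrt a%:R) <= L2 * (e / (2 * (L2 + 1))).
  rewrite -[L2 / _ * _]mulrA ler_wpM2l // mulrC ler_pdivrMr //; exact: h3.
have h5 : L2 * (e / (2 * (L2 + 1))) + e / (2 * (L2 + 1)) = e / 2 by field; rewrite gt_eqF.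
rewrite (_ : _ - bump x = (\sum_(1 <= a < A.+1) (moebius a)%:~R * cfun (a%:R * x) - \sum_(1 <= a < A.+1) (moebius a)%:~R * partial B a)
  + (\sum_(1 <= a < A.+1) (moebius a)%:~R * partial B a - (1 - N%:R^-1) * bump x) - N%:R^-1 * bump x); last by ring.
rewrite (le_trans (ler_normB _ _)) // (le_trans (lerD (ler_normD _ _) (lexx _))) //.
rewrite normrM [`|N%:R^-1|]ger0_norm ?invr_ge0 // (le_trans (lerD (lerD h2 h1) (lexx _))) //.
move: NL DB h4 h5; rewrite /L1 /D.
move: (\sum_(_ <= _ < _) _) (\sum_(_ <= _ < _) _) `|bump x| (2 / _) => S1 S2 b y; clear.
set E := e / (2 * _); move: E => E; lra.
Qed.

End MoebiusDuality.

(** * The dual function is holomorphic *)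

Section ComplexDual.
Context {R : realType}.

Lemma fdiff_real h k (u : R -> R) t : (fdiff h k u t)%:C = fdiff h k (fun s => (u s)%:C) t.
Proof.
by elim: k u => //= k IH u; rewrite IH; apply: fdiff_ext => i _; rewrite rmorphB.
Qed.

Lemma cos_cexp (x : R) : (cos x)%:C = 2^-1 * (cexp ('i * x%:C) + cexp (- 'i * x%:C)).
Proof.
rewrite /cexp !ReM !ImM /= !(mul0r, mul1r, mulr0, addr0, add0r, oppr0, subr0, mulN1r) expR0 cosN sinN mul1r.
rewrite (_ : cos x +i* sin x = (cos x)%:C + 'i * (sin x)%:C); last by simpc.
rewrite (_ : cos x +i* - sin x = (cos x)%:C - 'i * (sin x)%:C); last by simpc.
by rewrite mul1r; field.
Qed.

(** The value of [nodes] on [s -> cexp (z * s)], in closed form by [fdiff_cexp]. *)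
Definition cstencil (z : R[i]) : R[i] := cexp (z * 9%:C) * (cexp z - 1) ^+ 8.

(* The entire numerator makes [cfun z] a holomorphic function of [w = 1 / z]. *)
Definition cdual (w : R[i]) : R[i] :=
  - (kap%:C * w^-1 ^+ 5 * (2^-1 * (cstencil ((2 * pi)%:C * w * 'i) + cstencil (- ((2 * pi)%:C * w * 'i))))).

Lemma cdual_real (z : R) : cdual z^-1%:C = (cfun z)%:C.
Proof.
rewrite /cfun /cdual; move: kap => K; set D := nodes _.
rewrite (_ : (- (K * z ^+ 5 * D))%:C = - (K%:C * z%:C ^+ 5 * D%:C)); last first.
  by rewrite -rmorphXn -!rmorphM -rmorphN.
rewrite /D /nodes fdiff_real {D}.
have -> : fdiff 1 8 (fun s => (cos (2 * pi * s / z))%:C) 9 =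
   2^-1 * (cstencil ((2 * pi)%:C * z^-1%:C * 'i) + cstencil (- ((2 * pi)%:C * z^-1%:C * 'i))).
  rewrite /cstencil -!fdiff_cexp -fdiffD -fdiffZ; apply: fdiff_ext => i _; rewrite cos_cexp.
  congr (_ * (cexp _ + cexp _)); rewrite !rmorphM /=; ring.
by rewrite -[in LHS]fmorphV invrK.
Qed.

Lemma cexp_sub1_bound (B : R) : 0 < B -> exists2 C : R, 0 <= C & forall w : R[i], cn w <= B -> cn (cexp w - 1) <= C * cn w.
Proof.
move=> B0; have [c [C C0 HC]] := cexp_linear_bound B0.
exists (C * B + cn c) => [|w wB]; first by rewrite addr_ge0 ?cn_ge0 // mulr_ge0 // ltW.
rewrite -[cexp w - 1](subrK (c * w)) (le_trans (cnD _ _)) // cnM mulrDl lerD2r.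
by rewrite (le_trans (HC w wB)) // expr2 mulrA ler_wpM2r ?cn_ge0 // ler_wpM2l.
Qed.

Lemma cstencil_bound (B : R) : 0 < B -> exists2 C : R, 0 <= C & forall z : R[i], cn z <= B -> cn (cstencil z) <= C * cn z ^+ 8.
Proof.
move=> B0; have [C C0 HC] := cexp_sub1_bound B0.
exists (expR (B * 9) * C ^+ 8) => [|z zB]; first by rewrite mulr_ge0 ?expR_ge0 ?exprn_ge0.
rewrite /cstencil cnM cnX -mulrA -exprMn ler_pM ?cn_ge0 ?exprn_ge0 ?cn_ge0 //.
  rewrite cn_cexp ler_expR ReM /= mulr0 subr0 ler_wpM2r // (le_trans _ zB) //.
  exact: le_trans (ler_norm _) (Re_le_cn z).
by rewrite lerXn2r ?nnegrE ?mulr_ge0 ?cn_ge0 ?HC.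
Qed.

(** The zero of order eight of [cstencil] at [0] absorbs the pole [w^-5] and leaves [w^3]; at
    [w = 0] the convention [0^-1 = 0] makes [cdual] vanish. *)
Lemma cdual_bound (Y : R) : 0 < Y -> exists2 C : R, 0 <= C & forall w, cn w <= Y -> cn (cdual w) <= C * cn w ^+ 3.
Proof.
move=> Y0; have k0 := ltW (@kap_gt0 R).
have p0 : 0 < 2 * pi :> R by rewrite mulr_gt0 // pi_gt0.
have [C C0 HC] := cstencil_bound (mulr_gt0 p0 Y0).
have D0 : 0 <= kap * (C * (2 * pi) ^+ 8) by apply: (mulr_ge0 k0); rewrite mulr_ge0 // exprn_ge0 // ltW.
exists (kap * (C * (2 * pi) ^+ 8)) => // w wY; have [->|w0] := eqVneq w 0.
  by rewrite /cdual invr0 expr0n mulr0 mul0r oppr0 cn0 mulr_ge0 ?exprn_ge0.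
have c0 : 0 < cn w by rewrite cn_gt0.
have zE : cn ((2 * pi)%:C * w * 'i) = 2 * pi * cn w by rewrite !cnM cn_i mulr1 cn_real gtr0_norm.
have zB : cn ((2 * pi)%:C * w * 'i) <= 2 * pi * Y by rewrite zE ler_wpM2l // ltW.
have h1 := HC _ zB; have := HC (- ((2 * pi)%:C * w * 'i)); rewrite cnN => /(_ zB) h2.
rewrite zE in h1 h2.
rewrite /cdual cnN cnM [cn (kap%:C * _)]cnM [cn (2^-1 * _)]cnM cnX cnV cn_real (ger0_norm k0).
rewrite (_ : cn (2^-1 : R[i]) = 2^-1); last first.
  by rewrite (_ : 2^-1 = (2^-1)%:C) ?cn_real ?ger0_norm // fmorphV rmorph_nat.
rewrite (@le_trans _ _ (kap * (cn w)^-1 ^+ 5 * (C * (2 * pi * cn w) ^+ 8))) //.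
  apply: ler_wpM2l; first by apply: (mulr_ge0 k0); rewrite exprn_ge0 // invr_ge0 ltW.
  by rewrite ler_pdivrMl // (le_trans (cnD _ _)) // (le_trans (lerD h1 h2)) // [X in _ <= X]mulr_natl mulr2n.
rewrite exprMn; move: kap ((2 * pi) ^+ 8) => k p; rewrite le_eqVlt; apply/orP; left; apply/eqP.
by field; rewrite gt_eqF.
Qed.

Lemma hol_cdual (w : R[i]) : w != 0 -> hol cdual w.
Proof.
move=> w0; have hz : hol (fun w : R[i] => (2 * pi)%:C * w * 'i) w.
  by apply: holM; [apply: holM; [exact: hol_cst|exact: hol_id]|exact: hol_cst].
have hc g : hol g w -> hol (fun w => cstencil (g w)) w.
  move=> hg; apply: holM; first by apply: hol_comp (hol_cexp _); apply: holM => //; exact: hol_cst.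
  by apply: holX; apply: holB; [apply: hol_comp hg (hol_cexp _)|exact: hol_cst].
apply: holN; apply: holM.
  by apply: holM; [exact: hol_cst|apply: holX; apply: holV => //; exact: hol_id].
by apply: holM; [exact: hol_cst|apply: holD; apply: hc => //; exact: holN].
Qed.

Definition dual_term n (w : R[i]) : R[i] := (moebius n.+1)%:~R * cdual (w / n.+1%:R).

Lemma cn_natV n : cn (n.+1%:R^-1 : R[i]) = n.+1%:R^-1.
Proof. by rewrite (_ : n.+1%:R^-1 = (n.+1%:R^-1)%:C) ?cn_real ?ger0_norm // fmorphV rmorph_nat. Qed.

Lemma dual_term_bound (Y : R) : 0 < Y -> exists2 C : R, 0 <= C &
  forall n w, cn w <= Y -> cn (dual_term n w) <= C / n.+1%:R ^+ 2.
Proof.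
move=> Y0; have [C C0 HC] := cdual_bound Y0.
exists (C * Y ^+ 3) => [|n w wY]; first by rewrite mulr_ge0 // exprn_ge0 // ltW.
have i1 : n.+1%:R^-1 <= 1 :> R by rewrite invf_le1 ?ler1n.
have h : cn (w / n.+1%:R) = cn w / n.+1%:R by rewrite cnM cn_natV.
have m1 : cn ((moebius n.+1)%:~R : R[i]) <= 1.
  rewrite -(rmorph_int (real_complex R)) cn_real.
  by rewrite -intr_norm -[1]/(1%:~R) ler_int moebius_norm.
rewrite /dual_term cnM -[X in _ <= X]mul1r ler_pM ?cn_ge0 //.
rewrite (le_trans (HC _ _)) ?h //; first by rewrite -[Y]mulr1 ler_pM ?cn_ge0 ?invr_ge0.
rewrite -mulrA; apply: (ler_wpM2l C0); rewrite exprMn ler_pM ?exprn_ge0 ?cn_ge0 ?invr_ge0 //.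
  by rewrite lerXn2r ?nnegrE ?cn_ge0 // ltW.
by rewrite -exprVn [X in X <= _]exprSr ler_piMr // exprn_ge0 ?invr_ge0.
Qed.

Lemma sum_dual_majorant (C : R) n : 0 <= C -> \sum_(k < n) C / k.+1%:R ^+ 2 <= C * 2.
Proof.
move=> C0; rewrite -mulr_sumr ler_wpM2l // (le_trans _ (@sum_invsq_le R n)) //.
by rewrite big_add1 big_mkord.
Qed.

Lemma dual_function : exists E : R[i] -> R[i], (forall w, csum (dual_term^~ w) (E w)) /\
  forall w, 0 < complex.Re w -> hol E w.
Proof.
have /choice[E HE] : forall w, exists l, csum (dual_term^~ w) l.
  move=> w; have Y0 : 0 < cn w + 1 by rewrite ltr_wpDl ?cn_ge0.
  have [C C0 HC] := dual_term_bound Y0.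
  apply: (@csum_exists _ _ (fun n => C / n.+1%:R ^+ 2) (C * 2)) => n; last exact: sum_dual_majorant.
  by apply: HC; rewrite lerDl.
(* Half of the real part keeps the square about [w] off the point [0], which [hol_cdual]
   excludes. *)
exists E; split=> // w w0; set r := complex.Re w / 2.
have r0 : 0 < r by rewrite divr_gt0.
have Y0 : 0 < cn w + (r + r) by rewrite ltr_wpDl ?cn_ge0 // addr_gt0.
have [C C0 HC] := dual_term_bound Y0.
apply: (@weierstrass _ dual_term E w r (fun n => C / n.+1%:R ^+ 2) (C * 2)) => //.
- move=> n z z1 _; have z0 : z != 0.
    apply/negP => /eqP zE; move: z1; rewrite zE sub0r ReN normrN gtr0_norm // /r.
    by move: w0; clear; lra.
  apply: holM; first exact: hol_cst.
  apply: hol_comp; first by apply: holM; [exact: hol_id|exact: hol_cst].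
  by apply: hol_cdual; rewrite mulf_neq0 // invr_eq0 pnatr_eq0.
- move=> n z z1 z2; apply: HC; rewrite -[z](subrK w) addrC (le_trans (cnD _ _)) // lerD2l.
  by rewrite (le_trans (cn_le_ReIm _)) // lerD.
- by move=> n; exact: sum_dual_majorant.
Qed.

(** The partial sums converge by hypothesis, so closeness to [bump x] for arbitrarily large [A], as
    given by [dual_sum], identifies the limit. *)
Lemma dual_bump (T : nat -> R) E (x : R) : moebius_primitive 2^-1 T -> (forall w, csum (dual_term^~ w) (E w)) ->
  0 < x -> x <= 18 -> E x^-1%:C = (bump x)%:C.
Proof.
move=> HT HE x0 x18; apply/eqP; rewrite -subr_eq0; apply/eqP; apply: cn_eq0_le => e e0.
have e2 : 0 < e / 2 by rewrite divr_gt0.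
have [N HN] := HE x^-1%:C _ e2; have [A NA hA] := dual_sum HT x0 x18 e2 N.
have := HN A NA; rewrite (_ : \sum_(k < A) _ = (\sum_(1 <= a < A.+1) (moebius a)%:~R * cfun (a%:R * x))%:C).
  move: hA; set S := \sum_(_ <= _ < _) _ => h1 h2.
  have hB : (S - bump x)%:C = S%:C - (bump x)%:C by rewrite -rmorphB.
  rewrite (_ : E _ - _ = (S - bump x)%:C - (S%:C - E x^-1%:C)); last by rewrite hB opprB [RHS]addrC addrA subrK.
  by rewrite (le_trans (cnB _ _)) // cn_real [e]splitr lerD.
rewrite big_add1 big_mkord rmorph_sum; apply: eq_bigr => k _.
rewrite rmorphM rmorph_int -[X in _ = _ * X]/((cfun _)%:C) -cdual_real; congr (_ * cdual _).
have -> : ((k.+1%:R * x)^-1)%:C = x^-1%:C * (k.+1%:R^-1 : R)%:C by rewrite invfM mulrC -rmorphM.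
by rewrite [(k.+1%:R^-1)%:C]fmorphV rmorph_nat.
Qed.

Lemma moebius_primitive_half (T : nat -> R) : ~ moebius_primitive 2^-1 T.
Proof.
move=> HT; have [E [HE holE]] := dual_function.
have key := dual_bump HT HE.
(* The middle of [[16, 17]], where [bump] equals [(17 - v)^5]; it lies below the limit [18] of
   [dual_bump]. *)
pose b : R := 33 / 2; have b0 : 0 < b by rewrite divr_gt0.
have nz : bump b != 0.
  by rewrite bump_top; [apply: lt0r_neq0; apply: exprn_gt0| |]; rewrite /b; lra.
have bV : b^-1 = 2 / 33 :> R by rewrite invf_div.
have : E (b^-1%:C + 0) = 0.
  (* The segment from [1] to [2/33] keeps a margin [1/40 < 2/33] inside the right half-plane. At
     [1 + d / 2] the value is that of [bump] at a point below [1], hence [0]. *)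
  apply: (@identity_segment _ E 1 b^-1%:C (1 / 40)); rewrite ?cn0 ?divr_gt0 //.
    move=> t /andP[t0 t1] z; rewrite !ReD !ReN !ReD !ReM !ReD !ReN /= !mul0r subr0 => z1 _; apply: holE.
    move: z1; rewrite ler_norml bV => /andP[z1 _]; move: t0 t1 z1; clear; lra.
  move=> d d0; exists (d / 2)%:C; split.
  - by rewrite -cn_gt0 cn_real normr_gt0 gt_eqF // divr_gt0.
  - by rewrite cn_real gtr0_norm ?divr_gt0 // ltr_pdivrMr // ltr_pMr // ltr1n.
  have u0 : 0 < 1 + d / 2 by rewrite addr_gt0 ?divr_gt0.
  have u1 : (1 + d / 2)^-1 <= 1 by rewrite invf_le1 // lerDl divr_ge0 // ltW.
  rewrite (_ : 1 + (d / 2)%:C = (1 + d / 2)^-1^-1%:C); last by rewrite invrK rmorphD.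
  by rewrite key ?invr_gt0 ?bump_low //; rewrite (le_trans u1) // ler1n.
rewrite addr0 key //; last by rewrite /b; lra.
by move=> /eqP; rewrite -cn_eq0 cn_real normr_eq0; apply/negP.
Qed.

End ComplexDual.

Theorem proposition4p1 (R : realType) :
  (forall zeta : R[i] -> R[i], is_riemann_zeta zeta ->
   forall p : R, 1 < p ->
   (exists s : R[i], [/\ s != 1, zeta s = 0 & p^-1 <= complex.Re s]) ->
   diverges_Lp p (@G R)) /\
  diverges_Lp 2 (@G R).
Proof.
split=> [zeta Hz p p1 [s [s1 zs ps]] /(converges_Lp_primitive p1)[T HT]|].
  have p0 : 0 < p by exact: lt_trans p1.
  by apply: (moebius_primitive_no_zero Hz _ _ HT s1 zs ps); rewrite ?invr_gt0 // invf_lt1.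
by move=> /(converges_Lp_primitive (ltr1n R 2))[T]; exact: moebius_primitive_half.
Qed.
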